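(* 1. There exists a graded set $\mathcal{D}_P$ such that $\mathbf{PQSym}_+$, with the $Dup$-$Dend$ structure $(.,\nwarrow,\tilde\Delta_\prec,\tilde\Delta_\succ)$ described in the context, is isomorphic to $(\mathbf{H}_p^{\mathcal{D}_P})_+$ as graded $Dup$-$Dend$ bialgebras. 2. There exists a graded set $\mathcal{D}_F$ such that $\mathbf{FQSym}_+$, with the restricted $Dup$-$Dend$ structure, is isomorphic to $(\mathbf{H}_p^{\mathcal{D}_F})_+$ as graded $Dup$-$Dend$ bialgebras.
   Context: $K$ is a commutative field; all vector spaces are over $K$. **$Dup$-$Dend$ bialgebras.** A duplicial algebra is a vector space $A$ with two bilinear products $.$ (written $xy$) and $\nwarrow$ such that for all $x,y,z\in A$: $(xy)z=x(yz)$, $(x\nwarrow y)\nwarrow z=x\nwarrow(y\nwarrow z)$, $(xy)\nwarrow z=x(y\nwarrow z)$. A dendriform coalgebra is a vector space $A$ with two maps $\tilde\Delta_\prec,\tilde\Delta_\succ:A\to A\otimes A$ such that, with $\tilde\Delta=\tilde\Delta_\prec+\tilde\Delta_\succ$: $$(\tilde\Delta_\prec\otimes Id)\tilde\Delta_\prec=(Id\otimes\tilde\Delta)\tilde\Delta_\prec,\quad (\tilde\Delta_\succ\otimes Id)\tilde\Delta_\prec=(Id\otimes\tilde\Delta_\prec)\tilde\Delta_\succ,\quad (\tilde\Delta\otimes Id)\tilde\Delta_\succ=(Id\otimes\tilde\Delta_\succ)\tilde\Delta_\succ.$$ Sweedler notation: $\tilde\Delta(a)=a'\otimes a''$, $\tilde\Delta_\prec(a)=a'_\prec\otimes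 a''_\prec$, $\tilde\Delta_\succ(a)=a'_\succ\otimes a''_\succ$. A $Dup$-$Dend$ bialgebra is a family $(A,.,\nwarrow,\tilde\Delta_\prec,\tilde\Delta_\succ)$ such that $(A,.,\nwarrow)$ is a duplicial algebra, $(A,\tilde\Delta_\prec,\tilde\Delta_\succ)$ is a dendriform coalgebra, and for all $x,y\in A$: $$\tilde\Delta_\prec(xy)=y\otimes x+x'y\otimes x''+xy'_\prec\otimes y''_\prec+y'_\prec\otimes xy''_\prec+x'y'_\prec\otimes x''y''_\prec,$$ $$\tilde\Delta_\succ(xy)=x\otimes y+x'\otimes x''y+xy'_\succ\otimes y''_\succ+y'_\succ\otimes xy''_\succ+x'y'_\succ\otimes x''y''_\succ,$$ $$\tilde\Delta_\prec(x\nwarrow y)=y\otimes x+y'_\prec\otimes x\nwarrow y''_\prec+x'_\prec\nwarrow y\otimes x''_\prec+x'_\succ y\otimes x''_\succ+x'_\succ y'_\prec\otimes x''_\succ\nwarrow y''_\prec,$$ $$\tilde\Delta_\succ(x\nwarrow y)=y'_\succ\otimes x\nwarrow y''_\succ+x'_\succ\otimes x''_\succ\nwarrow y+x'_\succ y'_\succ\otimes x''_\succ\nwarrow y''_\succ.$$ It is graded if $A=\bigoplus_{n\ge0}A_n$ and all four structure maps are homogeneous of degree $0$. Isomorphisms of graded $Dup$-$Dend$ bialgebras are linear bijections, homogeneous of degree $0$, compatible with all four structure maps. **$\mathbf{PQSym}_+$ and $\mathbf{FQSym}_+$.** A parking function of degree $n$ is a word $(a_1,\ldots,a_n)$ of $n$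 positive integers whose nondecreasing rearrangement $(a'_1,\ldots,a'_n)$ satisfies $a'_i\le i$ for all $i$; it is viewed as a map from $\{1,\ldots,n\}$ to the positive integers. $\mathbf{PQSym}_+$ has basis the parking functions of degree $\ge1$, graded by degree. For $\sigma=(a_1,\ldots,a_k)$, $\tau=(b_1,\ldots,b_l)$ put $\sigma\otimes\tau=(a_1,\ldots,a_k,b_1+k,\ldots,b_l+k)$. $Sh(k,l)$ is the set of permutations of $\{1,\ldots,k+l\}$ increasing on $\{1,\ldots,k\}$ and on $\{k+1,\ldots,k+l\}$. Let $m_\sigma$ be the maximal index $i$ such that $\sigma(i)$ is maximal. For $\sigma,\tau$ of degrees $k,l$: $$\sigma.\tau=\sum_{\zeta\in Sh(k,l)}(\sigma\otimes\tau)\circ\zeta^{-1},\qquad \sigma\nwarrow\tau=\sum_{\substack{\zeta\in Sh(k,l)\\ \zeta(k+1)\ge\zeta(m_\sigma)}}(\sigma\otimes\tau)\circ\zeta^{-1}.$$ For $\sigma$ of degree $n$ and $0\le k\le n$, $\sigma_1^{(k)}$ and $\sigma_2^{(k)}$ are the parkizations of the words formed by the first $k$ letters and the last $n-k$ letters of $\sigma$. The parkization of a word $w=(w_1,\ldots,w_n)$ of positive integers is obtained as follows: let $d(w)$ be the smallest $i\ge 1$ with $|\{j:w_j\le i\}|<i$; if $d(w)=n+1$, then $w$ is a parking function and is its own parkization; otherwise decrease by $1$ all letters greater than $d(w)$ and repeat. Then $$\tilde\Delta_\prec(\sigma)=\sum_{k=1}^{m_\sigma-1}\sigma_2^{(k)}\otimes\sigma_1^{(k)},\qquad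 \tilde\Delta_\succ(\sigma)=\sum_{k=m_\sigma}^{n-1}\sigma_2^{(k)}\otimes\sigma_1^{(k)}.$$ (The sum $\tilde\Delta_\prec+\tilde\Delta_\succ$ is the opposite of the reduced coproduct $\sigma\mapsto\sum_{k=1}^{n-1}\sigma_1^{(k)}\otimes\sigma_2^{(k)}$ of $\mathbf{PQSym}$.) $\mathbf{FQSym}_+$ is the subspace of $\mathbf{PQSym}_+$ spanned by all permutations (words $(\sigma(1)\ldots\sigma(n))$, $\sigma\in\mathfrak{S}_n$, $n\ge1$), stable under all these operations. **$(\mathbf{H}_p^{\mathcal{D}})_+$.** A rooted forest is a finite graph whose connected components are rooted trees; edges are oriented from leaves to roots, $w\to v$ means there is an edge from $w$ to $v$, and $v\twoheadrightarrow w$ means there is an oriented path from $v$ to $w$ (with $v\twoheadrightarrow v$). A planar forest is a rooted forest with a total order (from left to right) on its roots and, for each vertex $v$, on $\{w:w\to v\}$. For a graded set $\mathcal{D}=\bigsqcup_n\mathcal{D}(n)$, $(\mathbf{H}_p^{\mathcal{D}})_+$ has basis the non-empty planar forests with vertices decorated by elements of $\mathcal{D}$, the degree being the sum of the degrees of the decorations. $FG$ is concatenation; $F\nwarrow G$ is obtained by grafting $G$ on the rightmost leaf of $F$. A subset $\boldsymbol v$ of the vertex set $V(F)$ is an admissible cut if there are no two distinct $v,w\in\boldsymbol v$ with $v\twoheadrightarrow w$; $Lea_{\boldsymbol v}F$ is the sub-forest on $\{w:\exists v\in\boldsymbol v,\ w\twoheadrightarrow v\}$ and $Roo_{\boldsymbol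 v}F$ the sub-forest on the other vertices. With $r_F$ the rightmost leaf of $F$, $\tilde\Delta_\prec(F)$ (resp. $\tilde\Delta_\succ(F)$) is the sum of $Lea_{\boldsymbol v}F\otimes Roo_{\boldsymbol v}F$ over the admissible cuts with $Lea_{\boldsymbol v}F$ and $Roo_{\boldsymbol v}F$ both non-empty and $r_F\in Lea_{\boldsymbol v}F$ (resp. $r_F\in Roo_{\boldsymbol v}F$). *)

(* Defs.v *)
From HB Require Import structures.
From mathcomp Require Import all_boot all_order all_fingroup all_algebra.
From mathcomp Require Import finmap.
From mathcomp.multinomials Require Import monalg.

Set Implicit Arguments.
Unset Strict Implicit.
Unset Printing Implicit Defensive.

Import GRing.Theory.

Local Open Scope ring_scope.

(** * Spaces with a basis *)

(* {malg K[B]} is the K-vector space with basis B; << b >> is the basis vector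
   of b.  The tensor product of {malg K[B]} and {malg K[C]} is taken to be
   {malg K[B * C]}, the basis vector << (b, c) >> being << b >> (x) << c >>. *)
Section FreeSpaces.
Variable K : fieldType.

Definition lext (B : choiceType) (V : lmodType K) (f : B -> V)
    (x : {malg K[B]}) : V :=
  \sum_(b <- msupp x) x@_b *: f b.

Definition bext (B C : choiceType) (V : lmodType K) (f : B -> C -> V)
    (x : {malg K[B]}) (y : {malg K[C]}) : V :=
  lext (fun b => lext (f b) y) x.

Definition tens (B C : choiceType) (x : {malg K[B]}) (y : {malg K[C]}) :
    {malg K[(B * C)%type]} :=
  bext (fun b c => << (b, c) >>) x y.

(* f (x) g, for f and g linear *)
Definition tmap (B C B' C' : choiceType)
    (f : {malg K[B]} -> {malg K[B']}) (g : {malg K[C]} -> {malg K[C']})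
    (t : {malg K[(B * C)%type]}) : {malg K[(B' * C')%type]} :=
  lext (fun p => tens (f << p.1 >>) (g << p.2 >>)) t.

(* (a (x) b, c (x) d) |-> f(a, c) (x) g(b, d), for f and g bilinear *)
Definition tmap2 (B : choiceType) (f g : {malg K[B]} -> {malg K[B]} -> {malg K[B]})
    (t s : {malg K[(B * B)%type]}) : {malg K[(B * B)%type]} :=
  bext (fun p q => tens (f << p.1 >> << q.1 >>) (g << p.2 >> << q.2 >>)) t s.

Definition tassoc (B : choiceType) :
    {malg K[(B * B * B)%type]} -> {malg K[(B * (B * B))%type]} :=
  lext (fun p => << (p.1.1, (p.1.2, p.2)) >>).

Definition homog (B : choiceType) (deg : B -> nat) (n : nat) (x : {malg K[B]}) :=
  forall b, b \in msupp x -> deg b = n.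

(* b as a basis vector of the space whose basis is the subset P of T; 0 if b is
   not in P.  By linear extension this is the projection on the span of P. *)
Definition vec (T : choiceType) (P : pred T) (b : T) : {malg K[{b : T | P b}]} :=
  oapp (fun s => << s >>) 0 (insub b).

End FreeSpaces.

(** * Dup-Dend bialgebras *)

(* A space graded by a grading of its basis, with two products and two
   coproducts given on the basis. *)
Record based (K : fieldType) := Based {
  bas : choiceType;
  bdeg : bas -> nat;
  bdot : bas -> bas -> {malg K[bas]};
  bnw : bas -> bas -> {malg K[bas]};
  bprec : bas -> {malg K[(bas * bas)%type]};
  bsucc : bas -> {malg K[(bas * bas)%type]} }.

Section DupDend.
Variables (K : fieldType) (A : based K).

Definition space : lmodType K := {malg K[bas A]}.
Definition space2 : lmodType K := {malg K[(bas A * bas A)%type]}.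

Definition bdeg2 (p : bas A * bas A) : nat := (bdeg p.1 + bdeg p.2)%N.

Definition dot : space -> space -> space := bext (@bdot K A).
Definition nw : space -> space -> space := bext (@bnw K A).
Definition dprec : space -> space2 := lext (@bprec K A).
Definition dsucc : space -> space2 := lext (@bsucc K A).
Definition dred (x : space) : space2 := dprec x + dsucc x.

Definition duplicial : Prop :=
  forall x y z : space,
  [/\ dot (dot x y) z = dot x (dot y z),
      nw (nw x y) z = nw x (nw y z)
    & nw (dot x y) z = dot x (nw y z)].

Definition dendriform_coalgebra : Prop :=
  forall x : space,
  [/\ tassoc (tmap dprec id (dprec x)) = tmap id dred (dprec x),
      tassoc (tmap dsucc id (dprec x)) = tmap id dprec (dsucc x)
    & tassoc (tmap dred id (dsucc x)) = tmap id dsucc (dsucc x)].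

Definition DupDend_compat : Prop :=
  forall x y : space,
  [/\ dprec (dot x y) =
        tens y x + tmap (dot^~ y) id (dred x) + tmap (dot x) id (dprec y)
        + tmap id (dot x) (dprec y) + tmap2 dot dot (dred x) (dprec y),
      dsucc (dot x y) =
        tens x y + tmap id (dot^~ y) (dred x) + tmap (dot x) id (dsucc y)
        + tmap id (dot x) (dsucc y) + tmap2 dot dot (dred x) (dsucc y),
      dprec (nw x y) =
        tens y x + tmap id (nw x) (dprec y) + tmap (nw^~ y) id (dprec x)
        + tmap (dot^~ y) id (dsucc x) + tmap2 dot nw (dsucc x) (dprec y)
    & dsucc (nw x y) =
        tmap id (nw x) (dsucc y) + tmap id (nw^~ y) (dsucc x)
        + tmap2 dot nw (dsucc x) (dsucc y)].

Definition DupDend_graded : Prop :=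
  [/\ forall m n x y, homog (@bdeg K A) m x -> homog (@bdeg K A) n y ->
        homog (@bdeg K A) (m + n) (dot x y),
      forall m n x y, homog (@bdeg K A) m x -> homog (@bdeg K A) n y ->
        homog (@bdeg K A) (m + n) (nw x y),
      forall n x, homog (@bdeg K A) n x -> homog bdeg2 n (dprec x)
    & forall n x, homog (@bdeg K A) n x -> homog bdeg2 n (dsucc x)].

Definition graded_DupDend_bialgebra : Prop :=
  [/\ duplicial, dendriform_coalgebra, DupDend_compat & DupDend_graded].

End DupDend.

Definition DupDend_isomorphism (K : fieldType) (A B : based K)
    (f : {linear space A -> space B}) : Prop :=
  [/\ bijective f,
      forall n x, homog (@bdeg K A) n x -> homog (@bdeg K B) n (f x),
      forall x y, f (dot x y) = dot (f x) (f y) /\ f (nw x y) = nw (f x) (f y),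
      forall x, tmap f f (dprec x) = dprec (f x)
    & forall x, tmap f f (dsucc x) = dsucc (f x)].

Definition isomorphic_graded_DupDend (K : fieldType) (A B : based K) : Prop :=
  [/\ graded_DupDend_bialgebra A, graded_DupDend_bialgebra B
    & exists f : {linear space A -> space B}, DupDend_isomorphism f].

(* The span of a set P of basis elements, with the restricted structure.  The
   values of the operations are projected on the span of P, which is immaterial
   when P is stable. *)
Section Restriction.
Variables (K : fieldType) (A : based K) (P : pred (bas A)).

Definition restr : space A -> {malg K[{b : bas A | P b}]} := lext (@vec K _ P).

Definition restrict : based K :=
  @Based K {b : bas A | P b} (fun b => bdeg (val b))
    (fun b c => restr (bdot (val b) (val c)))
    (fun b c => restr (bnw (val b) (val c)))
    (fun b => tmap restr restr (bprec (val b)))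
    (fun b => tmap restr restr (bsucc (val b))).

Definition stable_basis : Prop :=
  (forall b c, P b -> P c ->
     {subset msupp (bdot b c) <= P} /\ {subset msupp (bnw b c) <= P}) /\
  (forall b, P b ->
     {in msupp (bprec b), forall p, P p.1 && P p.2} /\
     {in msupp (bsucc b), forall p, P p.1 && P p.2}).

End Restriction.

(** * Parking functions *)

Definition is_parking (w : seq nat) : bool :=
  all (fun a => 0 < a)%N w &&
  [forall i : 'I_(size w), nth 0%N (sort leq w) i <= i.+1]%N.

Definition is_permutation (w : seq nat) : bool := perm_eq w (iota 1 (size w)).

(* d(w); the search succeeds at size w + 1 at the latest *)
Definition park_d (w : seq nat) : nat :=
  (find (fun i => count (fun a => a <= i) w < i) (iota 1 (size w).+1)).+1%N.

Definition park_step (w : seq nat) : seq nat :=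
  if park_d w == (size w).+1 then w
  else [seq if (park_d w < a)%N then a.-1 else a | a <- w].

(* Every step which is not trivial decreases sumn w, so that a fixed point of
   park_step is reached. *)
Definition parkize (w : seq nat) : seq nat := iter (sumn w) park_step w.

(* m_s, counted from 1 *)
Definition max_pos (s : seq nat) : nat :=
  (\max_(i < size s | nth 0 s i == \max_(a <- s) a) i.+1)%N.

Definition shift_cat (s t : seq nat) : seq nat :=
  s ++ [seq (b + size s)%N | b <- t].

(* Positions are counted from 0 in words and in permutations. *)
Definition is_shuffle (k l : nat) (z : 'S_(k + l)) : bool :=
  [forall i : 'I_(k + l), forall j : 'I_(k + l),
     (i < j) && ((j < k) || (k <= i)) ==> (z i < z j)]%N.

Definition shuffled (s t : seq nat) (z : 'S_(size s + size t)) : seq nat :=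
  [seq nth 0%N (shift_cat s t) ((z^-1)%g i) | i : 'I_(size s + size t)].

(* the condition z(k+1) >= z(m_s), where k = size s *)
Definition after_max (s t : seq nat) (z : 'S_(size s + size t)) : bool :=
  [forall i : 'I_(size s + size t), forall j : 'I_(size s + size t),
     (i.+1 == max_pos s) && (j == size s :> nat) ==> (z i <= z j)]%N.

(* vec is never applied outside of the basis below: see pq_basis_shuffled and
   pq_basis_parkize. *)
Section PQSym.
Variable K : fieldType.

Definition pq_basis (w : seq nat) : bool := is_parking w && (w != [::]).

Let PF := {w : seq nat | pq_basis w}.

Definition pq_dot (s t : PF) : {malg K[PF]} :=
  \sum_(z | is_shuffle z) vec K pq_basis (@shuffled (val s) (val t) z).

Definition pq_nw (s t : PF) : {malg K[PF]} :=
  \sum_(z | is_shuffle z && after_max z)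
    vec K pq_basis (@shuffled (val s) (val t) z).

Definition pq_cut (s : PF) (k : nat) : {malg K[(PF * PF)%type]} :=
  tens (vec K pq_basis (parkize (drop k (val s))))
       (vec K pq_basis (parkize (take k (val s)))).

Definition pq_prec (s : PF) : {malg K[(PF * PF)%type]} :=
  \sum_(1 <= k < max_pos (val s)) pq_cut s k.

Definition pq_succ (s : PF) : {malg K[(PF * PF)%type]} :=
  \sum_(max_pos (val s) <= k < size (val s)) pq_cut s k.

Definition PQSym : based K :=
  @Based K PF (fun s => size (val s)) pq_dot pq_nw pq_prec pq_succ.

(* restricted structure; see FQSym_stable *)
Definition FQSym : based K :=
  @restrict K PQSym (fun s : PF => is_permutation (val s)).

End PQSym.

Lemma park_d_gt0 w : (0 < park_d w)%N.
Proof. by []. Qed.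

Lemma park_d_le w : (park_d w <= (size w).+1)%N.
Proof.
rewrite /park_d; set P := (fun i => _).
suff : has P (iota 1 (size w).+1) by rewrite has_find size_iota.
apply/hasP; exists (size w).+1; first by rewrite mem_iota leqnn.
by rewrite /P ltnS count_size.
Qed.

Lemma park_d_count w : (count (fun a => a <= park_d w) w < park_d w)%N.
Proof.
pose P i := (count (fun a => a <= i) w < i)%N.
have hP : has P (iota 1 (size w).+1).
  by rewrite has_find size_iota; exact: park_d_le.
by have := nth_find 0%N hP; rewrite nth_iota // -[X in (_ < X)%N](size_iota 1) -has_find.
Qed.

Lemma park_d_min w i : (0 < i < park_d w)%N ->
  (i <= count (fun a => a <= i) w)%N.
Proof.
case: i => // i; rewrite /= ltnS => lti.
have := before_find 0%N lti; rewrite nth_iota ?add1n.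
  by move/negbT; rewrite -leqNgt.
by apply: leq_trans lti _; rewrite leqW // -ltnS; exact: park_d_le.
Qed.

Lemma count_leqS d (w : seq nat) : count (fun a => a <= d.+1)%N w =
  (count (fun a => a <= d)%N w + count_mem d.+1 w)%N.
Proof.
elim: w => //= a w ->; rewrite addnACA; congr addn.
by rewrite leq_eqVlt ltnS; case: eqP => [->|]; rewrite ?ltnn ?addn0.
Qed.

Lemma park_d_notin w : park_d w \notin w.
Proof.
have cd := park_d_count w; have := @park_d_min w (park_d w).-1.
move: cd (park_d_gt0 w); case: (park_d w) => // d.
rewrite count_leqS ltnS => cd _ /= md.
have le_d : (d <= count (fun a => a <= d) w)%N.
  by case: (d) md => // e -> //=.
have : (count_mem d.+1 w == 0)%N.
  by rewrite -leqn0 -(leq_add2l (count (fun a => a <= d)%N w)) addn0 (leq_trans cd).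
by rewrite eqn0Ngt -has_count has_pred1.
Qed.

Lemma park_stepE w :
  park_step w = [seq if (park_d w < a)%N then a.-1 else a | a <- w] \/
  park_step w = w.
Proof. by rewrite /park_step; case: eqP; [right | left]. Qed.

Lemma size_park_step w : size (park_step w) = size w.
Proof. by case: (park_stepE w) => ->; rewrite ?size_map. Qed.

Lemma park_step_gt0 w : all (fun a => 0 < a)%N w ->
  all (fun a => 0 < a)%N (park_step w).
Proof.
case: (park_stepE w) => -> //; rewrite all_map; apply: sub_all => a /= a0.
by case: (ltnP (park_d w) a) => // da; rewrite -subn1 subn_gt0; apply: leq_ltn_trans da.
Qed.

Lemma park_step_uniq w : uniq w -> uniq (park_step w).
Proof.
case: (park_stepE w) => -> // uw; rewrite map_inj_in_uniq // => a b aw bw.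
have nd c : c \in w -> c != park_d w.
  by apply: contraTneq => ->; rewrite park_d_notin.
have := nd _ aw; have := nd _ bw.
move: (park_d w) => d bd ad; case: (ltnP d a) => da; case: (ltnP d b) => db //.
- by move/(congr1 S); rewrite !prednK // ?(leq_ltn_trans (leq0n d) da) ?(leq_ltn_trans (leq0n d) db).
- move=> E; have : (b < d)%N by rewrite ltn_neqAle bd.
  by rewrite -E -ltnS prednK ?(leq_ltn_trans (leq0n d) da) // ltnS leqNgt da.
- move=> E; have : (a < d)%N by rewrite ltn_neqAle ad.
  by rewrite E -ltnS prednK ?(leq_ltn_trans (leq0n d) db) // ltnS leqNgt db.
Qed.

Lemma park_step_sumn w : park_d w != (size w).+1 ->
  (sumn (park_step w) < sumn w)%N.
Proof.
move=> dw; have le_d : (park_d w <= size w)%N.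
  by rewrite -ltnS ltn_neqAle dw park_d_le.
rewrite /park_step (negPf dw); set d := park_d w.
have : has (fun a => d < a)%N w.
  rewrite has_count -(ltn_add2l (count (fun a => a <= d)%N w)) addn0.
  have -> : (count (fun a => a <= d) w + count (fun a => d < a) w = size w)%N.
    rewrite -[RHS](count_predC (fun a => a <= d)%N); congr addn.
    by apply: eq_count => a /=; rewrite ltnNge.
  by apply: leq_trans le_d; exact: park_d_count.
have le_f a : ((if d < a then a.-1 else a) <= a)%N.
  by case: ifP => // _; exact: leq_pred.
have le_s (s : seq nat) : (sumn [seq if d < a then a.-1 else a | a <- s] <= sumn s)%N.
  by elim: s => //= a s IH; apply: leq_add.
elim: (w) => //= a s IH /orP[da|hs]; last by rewrite -addnS leq_add ?IH.
by rewrite -addSn leq_add // da prednK //; case: (a) da.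
Qed.

Lemma parkize_ind (P : seq nat -> Prop) w :
  P w -> (forall u, P u -> P (park_step u)) -> P (parkize w).
Proof. by move=> Pw PS; rewrite /parkize; elim: (sumn w) => //= n; apply: PS. Qed.

Lemma size_parkize w : size (parkize w) = size w.
Proof. by apply: (@parkize_ind (fun u => size u = size w)) => // u <-; rewrite size_park_step. Qed.

Lemma park_d_parkize w : park_d (parkize w) = (size (parkize w)).+1.
Proof.
suff H n : (sumn w <= n)%N ->
    park_d (iter n park_step w) = (size (iter n park_step w)).+1 by exact: H.
elim: n w => [|n IH] w; have [dw|/park_step_sumn lt_s] := eqVneq (park_d w) (size w).+1.
- by [].
- by move=> le_s; have := leq_trans lt_s le_s.
- move=> _; have fixw : park_step w = w by rewrite /park_step dw eqxx.
  by have -> : iter n.+1 park_step w = w by elim: n.+1 => //= m ->.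
by move=> le_s; rewrite iterSr; apply: IH; rewrite -ltnS; apply: leq_trans le_s.
Qed.

Lemma park_d_is_parking w : all (fun a => 0 < a)%N w ->
  park_d w = (size w).+1 -> is_parking w.
Proof.
move=> w0 dw; rewrite /is_parking w0; apply/forallP => i /=.
have := @park_d_min w i.+1; rewrite dw /= ltnS ltn_ord => /(_ isT).
set s := sort leq w; have ss : sorted leq s by apply: sort_sorted; exact: leq_total.
have szs : size s = size w by rewrite size_sort.
rewrite -(seq.permP (permEl (perm_sort leq w))) -/s leqNgt => le_c.
apply: contraNT le_c => lt_i.
rewrite -ltnNge in lt_i; rewrite ltnS -[s in count _ s](cat_take_drop i) count_cat.
rewrite [X in (_ + X)%N](_ : _ = 0%N).
  by rewrite addn0 (leq_trans (count_size _ _)) // size_take; case: ltnP.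
apply/eqP; rewrite eqn0Ngt -has_count; apply/(hasPn) => a.
move=> /(nthP 0%N)[j]; rewrite size_drop nth_drop => lt_j <-.
rewrite -ltnNge (leq_trans lt_i) //.
apply: (sorted_leq_nth leq_trans leqnn) => //; rewrite ?inE ?szs ?leq_addr //.
by move: lt_j; rewrite ltn_subRL szs.
Qed.

Lemma is_parking_parkize w : all (fun a => 0 < a)%N w -> is_parking (parkize w).
Proof.
move=> w0; apply: park_d_is_parking; last exact: park_d_parkize.
by apply: (@parkize_ind (fun u => all (fun a => 0 < a)%N u)) => // u; exact: park_step_gt0.
Qed.

Lemma pq_basis_parkize w : all (fun a => 0 < a)%N w -> w != [::] ->
  pq_basis (parkize w).
Proof.
by move=> w0 wn; rewrite /pq_basis is_parking_parkize // -size_eq0 size_parkize size_eq0.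
Qed.

Lemma perm_shuffled s t z : perm_eq (@shuffled s t z) (shift_cat s t).
Proof.
have sz : size (shift_cat s t) = (size s + size t)%N by rewrite size_cat size_map.
apply/(perm_iotaP 0%N); exists [seq val ((z^-1)%g i) | i : 'I_(size s + size t)].
  rewrite sz -val_enum_ord [X in perm_eq X _](map_comp val) perm_map //.
  rewrite uniq_perm ?enum_uniq //.
    by rewrite map_inj_uniq ?enum_uniq //; exact: perm_inj.
  move=> i; rewrite mem_enum; apply/mapP; exists (z i); rewrite ?mem_enum //.
  by rewrite permK.
by rewrite /shuffled -map_comp.
Qed.

Lemma is_parking_perm w w' : perm_eq w w' -> is_parking w = is_parking w'.
Proof.
move=> ww'; rewrite /is_parking (perm_all _ ww'); congr andb.
have -> : sort leq w = sort leq w'.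
  by apply/perm_sortP; [exact: leq_total|exact: leq_trans|exact: anti_leq|].
by rewrite (perm_size ww').
Qed.

Lemma is_parkingP w : reflect
  (all (fun a => 0 < a)%N w /\
   forall i, (i <= size w)%N -> (i <= count (fun a => a <= i) w)%N)
  (is_parking w).
Proof.
apply: (iffP idP) => [|[w0 cw]]; last first.
  apply: park_d_is_parking => //; apply/eqP; rewrite eqn_leq park_d_le ltnNge.
  by apply/negP => /cw; rewrite leqNgt park_d_count.
case/andP => w0 /forallP pw; split=> // -[|i] lti //.
set s := sort leq w; have ss : sorted leq s by apply: sort_sorted; exact: leq_total.
have szs : size s = size w by rewrite size_sort.
rewrite -(seq.permP (permEl (perm_sort leq w))) -/s.
rewrite -[s in count _ s](cat_take_drop i.+1) count_cat; apply: leq_trans (leq_addr _ _).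
have sz : size (take i.+1 s) = i.+1 by rewrite size_takel // szs.
rewrite -{1}sz leq_eqVlt eq_sym -all_count; apply/orP; left.
apply/(all_nthP 0%N) => j; rewrite sz => ltj; rewrite nth_take //.
apply: leq_trans (pw (Ordinal lti)) => /=.
have ltjs : (j < size w)%N by apply: leq_trans lti.
by apply: (sorted_leq_nth leq_trans leqnn) => //; rewrite ?inE ?szs.
Qed.

Lemma is_parking_shift_cat s t : is_parking s -> is_parking t ->
  is_parking (shift_cat s t).
Proof.
move=> /is_parkingP[s0 cs] /is_parkingP[t0 ct]; apply/is_parkingP; split.
  rewrite all_cat s0 all_map; apply: sub_all t0 => a /= a0.
  by rewrite addn_gt0 a0.
move=> i; rewrite size_cat size_map count_cat count_map => lti.
have [les|lts] := leqP i (size s).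
  by apply: leq_trans (cs _ les) (leq_addr _ _).
rewrite -{1}(subnKC (ltnW lts)) leq_add //.
  by rewrite (leq_trans (cs _ (leqnn _))) // sub_count // => a /= /leq_trans->; rewrite // ltnW.
apply: leq_trans (ct (i - size s)%N _) _; first by rewrite leq_subLR.
by apply: sub_count => a /=; rewrite leq_subRL 1?addnC // ltnW.
Qed.

Lemma pq_basis_shuffled s t z : pq_basis s -> pq_basis t ->
  pq_basis (@shuffled s t z).
Proof.
case/andP => ps sn /andP[pt _].
rewrite /pq_basis (is_parking_perm (perm_shuffled z)) is_parking_shift_cat //=.
rewrite -size_eq0 (perm_size (perm_shuffled z)) size_cat addn_eq0 negb_and.
by rewrite size_eq0 sn.
Qed.

Lemma uniq_is_permutation w : is_parking w -> uniq w -> is_permutation w.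
Proof.
case/is_parkingP => w0 cw uw; rewrite /is_permutation.
have le_w : {subset w <= iota 1 (size w)}.
  move=> a aw; rewrite mem_iota (allP w0) //= add1n ltnS.
  have := cw _ (leqnn (size w)); rewrite leq_eqVlt ltnNge count_size orbF eq_sym.
  by rewrite -all_count => /allP/(_ _ aw).
have [] := uniq_min_size uw le_w; first by rewrite size_iota.
by move=> _ E; apply: uniq_perm => //; exact: iota_uniq.
Qed.

Lemma is_permutation_shift_cat s t : is_permutation s -> is_permutation t ->
  is_permutation (shift_cat s t).
Proof.
move=> ps pt; rewrite /is_permutation size_cat size_map iotaD perm_cat //.
rewrite addnC iotaDl; under eq_map => b do rewrite addnC.
exact: perm_map.
Qed.

Lemma is_permutation_uniq w : is_permutation w -> uniq w.
Proof. by move=> /perm_uniq->; exact: iota_uniq. Qed.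

Lemma msupp_vec (K : fieldType) (T : choiceType) (P : pred T) b s :
  s \in msupp (vec K P b) -> val s = b.
Proof.
rewrite /vec; case: insubP => [u _ <-|_] /=; last by rewrite msupp0.
by rewrite msuppU oner_eq0 inE => /eqP->.
Qed.

Lemma msupp_bigsum (K : fieldType) (B : choiceType) (I : Type) (r : seq I)
    (P : pred I) (F : I -> {malg K[B]}) b :
  b \in msupp (\sum_(i <- r | P i) F i) -> exists i, P i /\ b \in msupp (F i).
Proof.
elim/big_rec: _ => [|i x Pi IH]; first by rewrite msupp0.
by move/(fsubsetP (msuppD_le _ _)); rewrite inE => /orP[bF|/IH//]; exists i.
Qed.

Lemma msupp_tens (K : fieldType) (B C : choiceType) (x : {malg K[B]})
    (y : {malg K[C]}) p :
  p \in msupp (tens x y) -> (p.1 \in msupp x) && (p.2 \in msupp y).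
Proof.
rewrite /tens /bext /lext big_seq => /msupp_bigsum[b [bx]].
move/(fsubsetP (msuppZ_le _ _)); rewrite big_seq => /msupp_bigsum[c [cy]].
move/(fsubsetP (msuppZ_le _ _)); rewrite msuppU oner_eq0 inE => /eqP->.
by rewrite bx cy.
Qed.

Lemma FQSym_stable (K : fieldType) :
  @stable_basis K (PQSym K) (fun s => is_permutation (val s)).
Proof.
split=> [b c Pb Pc|b Pb].
  have main z (s : bas (PQSym K)) :
      s \in msupp (vec K pq_basis (@shuffled (val b) (val c) z)) ->
      is_permutation (val s).
    move/msupp_vec->; have sz := perm_shuffled z.
    by rewrite /is_permutation (perm_size sz) (perm_trans sz) //; exact: is_permutation_shift_cat.
  by split=> s /msupp_bigsum[z [_ /main]].
have main k : {in msupp (pq_cut K b k), forall p,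
    is_permutation (val p.1) && is_permutation (val p.2)}.
  have sub u w (s : bas (PQSym K)) : subseq u (val b) -> s \in msupp (vec K pq_basis w) ->
      w = parkize u -> is_permutation (val s).
    move=> ub /msupp_vec sw wu; apply: uniq_is_permutation.
      by case/andP: (valP s).
    rewrite sw wu; apply: (@parkize_ind uniq) => [|v]; last exact: park_step_uniq.
    exact: subseq_uniq ub (is_permutation_uniq Pb).
  move=> p /msupp_tens/andP[p1 p2].
  apply/andP; split; [apply: sub p1 erefl | apply: sub p2 erefl].
    exact: drop_subseq.
  exact: take_subseq.
by split=> p /msupp_bigsum[k [_ /main]].
Qed.

(** * Planar decorated forests *)

Inductive ptree (D : Type) := Node of D & seq (ptree D).

Section PtreeChoice.
Variable D : Type.

Fixpoint ptree_encode (t : ptree D) : GenTree.tree D :=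
  let: Node d ts := t in GenTree.Node 0 (GenTree.Leaf d :: map ptree_encode ts).

Fixpoint ptree_decode (g : GenTree.tree D) : option (ptree D) :=
  if g is GenTree.Node _ (GenTree.Leaf d :: gs)
  then Some (Node d (pmap ptree_decode gs)) else None.

Fixpoint ptree_encodeK (t : ptree D) : ptree_decode (ptree_encode t) = Some t :=
  let: Node d ts := t in
  let fix go ts : pmap ptree_decode (map ptree_encode ts) = ts :=
    match ts with
    | [::] => erefl
    | t :: ts =>
      etrans (congr1 (fun o => oapp (cons^~ (pmap ptree_decode (map ptree_encode ts)))
                        (pmap ptree_decode (map ptree_encode ts)) o)
                (ptree_encodeK t))
             (congr1 (cons t) (go ts))
    end in
  congr1 (fun ts => Some (Node d ts)) (go ts).

End PtreeChoice.

HB.instance Definition _ (D : choiceType) :=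
  Choice.copy (ptree D) (pcan_type (@ptree_encodeK D)).

(* Vertices are represented by their addresses: the vertex [:: i0; i1; ...] is
   reached from the root number i0 by going to its child number i1, and so on.
   In particular w ->> v if and only if (the address of) v is a prefix of w. *)
Section Forests.
Variable D : choiceType.
Notation tree := (ptree D).
Notation forest := (seq (ptree D)).

Fixpoint tree_graft (G : forest) (t : tree) : tree :=
  let: Node d ts := t in
  Node d ((fix go ts := match ts with
           | [::] => G
           | [:: t'] => [:: tree_graft G t']
           | t' :: ts' => t' :: go ts'
           end) ts).

(* F nw G, for F non-empty *)
Fixpoint graft (F G : forest) : forest :=
  match F with
  | [::] => [::]
  | [:: t] => [:: tree_graft G t]
  | t :: F' => t :: graft F' G
  end.

Lemma graft_neq_nil F G : F != [::] -> graft F G != [::].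
Proof. by case: F => // t [|]. Qed.

(* address of the rightmost leaf of a tree, relative to its root *)
Fixpoint tree_rleaf (t : tree) : seq nat :=
  let: Node _ ts := t in
  (fix go i ts := match ts with
   | [::] => [::]
   | [:: t'] => i :: tree_rleaf t'
   | _ :: ts' => go i.+1 ts'
   end) 0%N ts.

Definition rleaf (F : forest) : seq nat :=
  if F is t :: F' then size F' :: tree_rleaf (last t F') else [::].

Fixpoint tree_verts (t : tree) : seq (seq nat) :=
  let: Node _ ts := t in
  [::] :: (fix go i ts := match ts with
           | [::] => [::]
           | t' :: ts' => map (cons i) (tree_verts t') ++ go i.+1 ts'
           end) 0%N ts.

Fixpoint verts_from (i : nat) (F : forest) : seq (seq nat) :=
  if F is t :: F' then map (cons i) (tree_verts t) ++ verts_from i.+1 F'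
  else [::].

Definition verts (F : forest) : seq (seq nat) := verts_from 0 F.

Definition V (F : forest) : finType := seq_sub (verts F).

(* The sub-forest on the set X of vertices, with the left to right order induced
   by F.  The recursion attaches a vertex of X to its closest proper ancestor in
   X; this is its parent in F (or nothing, and the vertex is a root) when X is
   closed under descendants or under ancestors. *)
Fixpoint tree_sub (X : pred (seq nat)) (t : tree) : forest :=
  let: Node d ts := t in
  let ts' := (fix go i ts := match ts with
              | [::] => [::]
              | u :: us => tree_sub (fun p => X (i :: p)) u ++ go i.+1 us
              end) 0%N ts in
  if X [::] then [:: Node d ts'] else ts'.

Fixpoint sub_from (X : pred (seq nat)) (i : nat) (F : forest) : forest :=
  if F is t :: F' then tree_sub (fun p => X (i :: p)) t ++ sub_from X i.+1 F'
  else [::].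

Definition addresses (F : forest) (X : {set V F}) : seq (seq nat) :=
  [seq val x | x in X].

Definition subforest (F : forest) (X : {set V F}) : forest :=
  sub_from (fun p => p \in addresses X) 0 F.

Definition reaches (F : forest) (v w : V F) : bool := prefix (val w) (val v).

Definition admissible (F : forest) (c : {set V F}) : bool :=
  [forall v in c, forall w in c, (v != w) ==> ~~ reaches v w].

Definition lea_set (F : forest) (c : {set V F}) : {set V F} :=
  [set w | [exists v in c, reaches w v]].

Definition roo_set (F : forest) (c : {set V F}) : {set V F} := ~: lea_set c.

Definition Lea (F : forest) (c : {set V F}) : forest := subforest (lea_set c).
Definition Roo (F : forest) (c : {set V F}) : forest := subforest (roo_set c).

Definition proper_cut (F : forest) (c : {set V F}) : bool :=
  [&& admissible c, Lea c != [::] & Roo c != [::]].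

Variable deg : D -> nat.

Fixpoint tree_deg (t : tree) : nat :=
  let: Node d ts := t in (deg d + sumn (map tree_deg ts))%N.

Definition forest_deg (F : forest) : nat := sumn (map tree_deg F).

Variable K : fieldType.

Definition hp_basis (F : forest) : bool := F != [::].

Let NF := {F : forest | hp_basis F}.

Definition hp_prec (F : NF) : {malg K[(NF * NF)%type]} :=
  \sum_(c : {set V (val F)} | proper_cut c &&
                              (rleaf (val F) \in addresses (lea_set c)))
    tens (vec K hp_basis (Lea c)) (vec K hp_basis (Roo c)).

Definition hp_succ (F : NF) : {malg K[(NF * NF)%type]} :=
  \sum_(c : {set V (val F)} | proper_cut c &&
                              (rleaf (val F) \in addresses (roo_set c)))
    tens (vec K hp_basis (Lea c)) (vec K hp_basis (Roo c)).

Definition Hp : based K :=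
  @Based K NF (fun F => forest_deg (val F))
    (fun F G => vec K hp_basis (val F ++ val G))
    (fun F G => vec K hp_basis (graft (val F) (val G)))
    hp_prec hp_succ.

End Forests.

(* Main.v *)
(* A graded Dup-Dend bialgebra A without elements of degree 0 is isomorphic to
   H = (H_p^D)_+, where D is a homogeneous basis of the space of elements killed
   by both coproducts.  As H is the free duplicial algebra on its vertices,
   sending them to that basis defines phi : H -> A, which is compatible with the
   products, hence, by the compatibility axioms, with the coproducts.

   That phi is bijective is proved by induction on the degree.  Let pi project H
   on the span of the one-vertex forests.  The operator
     Psi = pi + J2 (pi (x) id) D_prec + J3 (id (x) pi) D_succ
              + J4 (id (x) (pi (x) id) D_prec) D_succ,
     J2 (d (x) R) = R nw d,  J3 (L (x) d) = L d,  J4 (L (x) d (x) R) = R nw (L d),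
   maps a forest F to F plus forests which are larger for some measure, so that
   it is invertible.  Its last three terms can be read off its value; given a in A
   of degree n, there is therefore x in H for which the pulled back coproducts of
   a - phi x are not seen by Psi.  By coassociativity they vanish, and a - phi x
   is in the span of the basis D.  If phi x = 0, then both coproducts of x vanish
   by induction, so that Psi x = pi x and x is a combination of vertices.

   For PQSym and FQSym, parkization decreases each letter by an amount depending
   only on the multiset of letters.  It is strictly increasing on the letters of
   a word, and therefore compatible with shuffles, with deconcatenation and with
   the position of the last maximal letter. *)

From HB Require Import structures.
From mathcomp Require Import all_boot all_order all_fingroup all_algebra.
From mathcomp Require Import finmap zify.
From mathcomp.multinomials Require Import monalg.
From Stdlib Require Import ClassicalEpsilon.
Require Import Defs.

Set Implicit Arguments.
Unset Strict Implicit.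
Unset Printing Implicit Defensive.

Import GRing.Theory.

Local Open Scope ring_scope.

(** * Linear extension and tensor products *)

(** The difficult half is surjectivity. The coproducts of a in A, of degree n, pull back to a pair
    (u0, v0) of tensors over H, whose factors have degree < n; what is missing is an x in H with
    these coproducts. [Psi] reduces this to inverting one linear map. Write F = R nw (L r) with r
    the rightmost leaf. The four terms of [Psi] produce forests with L and R empty or not, in the
    four possible ways, so that they can be prescribed separately. Prescribing the last three for x
    leaves a difference (u, v) which satisfies the dendriform relations and whose left factor in u,
    right factor in v, is invisible to [Psi]. Triangularity comes from the cut of F with upper part
    L, which reassembles to F. Any other cut leaving r in the lower part either leaves vertices of L
    there, and r gets deeper, or takes vertices of R, and L grows. Identities between families of
    cuts or shuffles are stated as equalities of sums of an arbitrary function H with values in a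
    commutative monoid or group: they compose by substitution for H, and a tensor-valued H turns
    them into the axioms. *)

Section LinearExtension.
Variable K : fieldType.
Implicit Types (B C : choiceType) (V W : lmodType K).

Lemma lextEw B V (f : B -> V) (x : {malg K[B]}) (d : {fset B}) :
  (msupp x `<=` d)%fset -> lext f x = \sum_(b <- d) x@_b *: f b.
Proof.
move=> sxd; rewrite /lext (big_fset_incl _ sxd) // => b _.
by move=> /mcoeff_outdom->; rewrite scale0r.
Qed.

Lemma lext_is_linear B V (f : B -> V) : linear (lext f).
Proof.
move=> a x y; pose d := (msupp x `|` msupp y)%fset.
rewrite !(@lextEw _ _ _ _ d) ?fsubsetUl ?fsubsetUr //; last first.
  apply: fsubset_trans (msuppD_le _ _) _.
  by apply: fsetUSS => //; exact: msuppZ_le.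
rewrite scaler_sumr -big_split /=; apply: eq_bigr => b _.
by rewrite mcoeffD mcoeffZ scalerDl scalerA.
Qed.

HB.instance Definition _ B V (f : B -> V) :=
  GRing.isLinear.Build K {malg K[B]} V _ (lext f) (lext_is_linear f).

Lemma lextU B V (f : B -> V) b : lext f << b >> = f b.
Proof.
by rewrite (@lextEw _ _ _ _ [fset b]%fset) ?msuppU_le // big_seq_fset1 mcoeffUU scale1r.
Qed.

Lemma lextU_id B (x : {malg K[B]}) : lext (fun b => << b >> : {malg K[B]}) x = x.
Proof.
rewrite /lext [RHS]monalgE; apply: eq_bigr => b _.
by apply/malgP => c; rewrite mcoeffZ !mcoeffU mulr_natr.
Qed.

Lemma linear_lext B V W (f : {linear V -> W}) (g : B -> V) x :
  f (lext g x) = lext (f \o g) x.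
Proof. by rewrite /lext linear_sum; apply: eq_bigr => b _; rewrite linearZ. Qed.

Lemma eq_lext B V (f g : B -> V) : f =1 g -> lext f =1 lext g.
Proof. by move=> fg x; apply: eq_bigr => b _; rewrite fg. Qed.

Lemma lextE B V (f : {linear {malg K[B]} -> V}) x : f x = lext (fun b => f << b >>) x.
Proof. by rewrite -[in LHS](lextU_id x) linear_lext. Qed.

Lemma eq_linear_basis B V (f g : {linear {malg K[B]} -> V}) :
  (forall b, f << b >> = g << b >>) -> f =1 g.
Proof. by move=> fg x; rewrite (lextE f) (lextE g); exact: eq_lext. Qed.

(** Linearity is a hypothesis on plain functions here, since most maps below are composites or
    sections such as [dot^~ y], for which no linear structure is inferred. *)
Lemma eq_lin_basis B V (f g : {malg K[B]} -> V) : linear f -> linear g ->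
  (forall b, f << b >> = g << b >>) -> f =1 g.
Proof.
move=> lf lg fg.
pose F := GRing.isLinear.Build K {malg K[B]} V _ f lf.
pose G := GRing.isLinear.Build K {malg K[B]} V _ g lg.
pose f' : {linear {malg K[B]} -> V} := HB.pack f F.
pose g' : {linear {malg K[B]} -> V} := HB.pack g G.
exact: (@eq_linear_basis _ _ f' g').
Qed.

Lemma lext_lin B V (f g : B -> V) a x :
  lext (fun b => a *: f b + g b) x = a *: lext f x + lext g x.
Proof.
rewrite /lext scaler_sumr -big_split; apply: eq_bigr => b _ /=.
by rewrite scalerDr !scalerA [a * _]mulrC.
Qed.

Lemma bextUU B C V (f : B -> C -> V) b c : bext f << b >> << c >> = f b c.
Proof. by rewrite /bext !lextU. Qed.

Lemma bext_linl B C V (f : B -> C -> V) y : linear (fun x => bext f x y).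
Proof. by move=> a x x'; rewrite /bext linearP. Qed.

Lemma bext_linr B C V (f : B -> C -> V) x : linear (bext f x).
Proof.
move=> a y y'; rewrite /bext -lext_lin; apply: eq_lext => b; exact: linearP.
Qed.

Lemma tensUU B C (b : B) (c : C) :
  tens (<< b >> : {malg K[B]}) (<< c >> : {malg K[C]}) = << (b, c) >>.
Proof. exact: bextUU. Qed.

Lemma tens_linl B C (y : {malg K[C]}) : linear (fun x : {malg K[B]} => tens x y).
Proof. exact: bext_linl. Qed.

Lemma tens_linr B C (x : {malg K[B]}) : linear (fun y : {malg K[C]} => tens x y).
Proof. exact: bext_linr. Qed.

End LinearExtension.

Section LinearPredicate.
Variables (K : fieldType) (U V W : lmodType K).

Lemma lin_comp (f : V -> W) (g : U -> V) : linear f -> linear g -> linear (f \o g).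
Proof. by move=> lf lg a x y /=; rewrite lg lf. Qed.

Lemma lin_add (f g : U -> V) : linear f -> linear g -> linear (fun x => f x + g x).
Proof. by move=> lf lg a x y; rewrite lf lg scalerDr addrACA. Qed.

Variables (f : U -> V) (lf : linear f).

Lemma lin0 : f 0 = 0.
Proof. by have := lf (-1) 0 0; rewrite scaler0 add0r scaleN1r addNr. Qed.

Lemma linD x y : f (x + y) = f x + f y.
Proof. by have := lf 1 x y; rewrite !scale1r. Qed.

Lemma linZ a x : f (a *: x) = a *: f x.
Proof. by have := lf a x 0; rewrite lin0 !addr0. Qed.

Lemma linB x y : f (x - y) = f x - f y.
Proof. by rewrite linD -scaleN1r linZ scaleN1r. Qed.

Lemma lin_sum (I : Type) (r : seq I) (P : pred I) (F : I -> U) :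
  f (\sum_(i <- r | P i) F i) = \sum_(i <- r | P i) f (F i).
Proof. by elim/big_rec2: _ => [|i y x _ <-]; rewrite ?lin0 ?linD. Qed.

End LinearPredicate.

Section Tensors.
Variable K : fieldType.
Implicit Types B C : choiceType.
Local Notation M B := {malg K[B]}.

HB.instance Definition _ B C (V : lmodType K) (f : B -> C -> V) (x : M B) :=
  GRing.isLinear.Build K (M C) V _ (bext f x) (bext_linr f x).

HB.instance Definition _ B C (x : M B) :=
  GRing.isLinear.Build K (M C) (M (B * C)%type) _ (tens x) (tens_linr x).

HB.instance Definition _ B C B' C' (f : M B -> M B') (g : M C -> M C') :=
  GRing.Linear.copy (tmap f g) (lext (fun p => tens (f << p.1 >>) (g << p.2 >>))).

HB.instance Definition _ B := GRing.Linear.copy (@tassoc K B)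
  (lext (fun p => << (p.1.1, (p.1.2, p.2)) >>)).

Lemma tens_sum B C (I J : Type) (r : seq I) (s : seq J) (F : I -> M B) (G : J -> M C) :
  tens (\sum_(i <- r) F i) (\sum_(j <- s) G j) =
  \sum_(i <- r) \sum_(j <- s) tens (F i) (G j).
Proof.
rewrite (lin_sum (tens_linl _)); apply: eq_bigr => i _; exact: linear_sum.
Qed.

Lemma tens0l B C (y : M C) : tens (0 : M B) y = 0.
Proof. exact: lin0 (tens_linl y). Qed.

Lemma tens0r B C (x : M B) : tens x (0 : M C) = 0.
Proof. exact: linear0. Qed.

Lemma tmapU B C B' C' (f : M B -> M B') (g : M C -> M C') p :
  tmap f g << p >> = tens (f << p.1 >>) (g << p.2 >>).
Proof. exact: lextU. Qed.

Lemma eq_tmap B C B' C' (f f' : M B -> M B') (g g' : M C -> M C') :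
  (forall b, f << b >> = f' << b >>) -> (forall b, g << b >> = g' << b >>) ->
  tmap f g =1 tmap f' g'.
Proof. by move=> ff gg; apply: eq_lext => p; rewrite ff gg. Qed.

Lemma eq_tens_basis B C (V : lmodType K) (f g : M B -> M C -> V) x y :
  (forall x, linear (f x)) -> (forall y, linear (f^~ y)) ->
  (forall x, linear (g x)) -> (forall y, linear (g^~ y)) ->
  (forall b c, f << b >> << c >> = g << b >> << c >>) -> f x y = g x y.
Proof.
move=> fr fl gr gl fg.
apply: (eq_lin_basis (fl y) (gl y)) => b.
exact: (eq_lin_basis (fr << b >>) (gr << b >>)).
Qed.

Lemma tmap_tens B C B' C' (f : M B -> M B') (g : M C -> M C') x y :
  linear f -> linear g -> tmap f g (tens x y) = tens (f x) (g y).
Proof.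
move=> lf lg; apply: (@eq_tens_basis _ _ _ (fun x y => tmap f g (tens x y))
  (fun x y => tens (f x) (g y))).
- by move=> {}x a z t; rewrite !linearP.
- by move=> {}y a z t; rewrite tens_linl linearP.
- by move=> {}x a z t; rewrite lg linearP.
- by move=> {}y a z t; rewrite lf tens_linl.
by move=> b c; rewrite tensUU tmapU.
Qed.

Lemma tmap_comp B C B' C' B'' C'' (f : M B' -> M B'') (g : M C' -> M C'')
    (f' : M B -> M B') (g' : M C -> M C') t : linear f -> linear g ->
  tmap f g (tmap f' g' t) = tmap (f \o f') (g \o g') t.
Proof.
move=> lf lg; rewrite {2}/tmap linear_lext; apply: eq_lext => p.
exact: tmap_tens.
Qed.

Lemma tmap_id B C (t : M (B * C)%type) : tmap id id t = t.
Proof.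
rewrite -[RHS]lextU_id; apply: eq_lext => -[b c]; exact: tensUU.
Qed.

Lemma tmapDl B C B' C' (f f' : M B -> M B') (g : M C -> M C') t :
  tmap (fun x => f x + f' x) g t = tmap f g t + tmap f' g t.
Proof.
rewrite /tmap /lext -big_split; apply: eq_bigr => p _ /=.
by rewrite (linD (tens_linl _)) scalerDr.
Qed.

Lemma tmapDr B C B' C' (f : M B -> M B') (g g' : M C -> M C') t :
  tmap f (fun x => g x + g' x) t = tmap f g t + tmap f g' t.
Proof.
rewrite /tmap /lext -big_split; apply: eq_bigr => p _ /=.
by rewrite linearD scalerDr.
Qed.

Lemma tassoc_tens B (x y z : M B) : tassoc (tens (tens x y) z) = tens x (tens y z).
Proof.
apply: (@eq_lin_basis _ _ _ (fun x => tassoc (tens (tens x y) z))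
  (fun x => tens x (tens y z))) => [a u v|a u v|b].
- by rewrite !tens_linl linearP.
- by rewrite tens_linl.
apply: (@eq_tens_basis _ _ _ (fun y z => tassoc (tens (tens << b >> y) z))
  (fun y z => tens << b >> (tens y z))).
- by move=> c a u v; rewrite !linearP.
- by move=> c a u v; rewrite !(linearP, tens_linl).
- by move=> c a u v; rewrite !linearP.
- by move=> c a u v; rewrite tens_linl !linearP.
by move=> c d; rewrite !tensUU /tassoc lextU.
Qed.

Lemma tmap2UU B (f g : M B -> M B -> M B) p q :
  tmap2 f g << p >> << q >> =
  tens (f << p.1 >> << q.1 >>) (g << p.2 >> << q.2 >>).
Proof. exact: bextUU. Qed.

Lemma tmap2_linl B (f g : M B -> M B -> M B) s : linear (fun t => tmap2 f g t s).
Proof. exact: bext_linl. Qed.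

Lemma tmap2_linr B (f g : M B -> M B -> M B) t : linear (tmap2 f g t).
Proof. exact: bext_linr. Qed.

Lemma tmap2_tens B (f g : M B -> M B -> M B) x x' y y' :
  (forall x, linear (f x)) -> (forall y, linear (f^~ y)) ->
  (forall x, linear (g x)) -> (forall y, linear (g^~ y)) ->
  tmap2 f g (tens x x') (tens y y') = tens (f x y) (g x' y').
Proof.
move=> fr fl gr gl.
apply: (@eq_tens_basis _ _ _ (fun x x' => tmap2 f g (tens x x') (tens y y'))
  (fun x x' => tens (f x y) (g x' y'))).
- by move=> c a u v; rewrite linearP tmap2_linl.
- by move=> c a u v; rewrite tens_linl tmap2_linl.
- by move=> c a u v; rewrite gl linearP.
- by move=> c a u v; rewrite fl tens_linl.
move=> b b'.
apply: (@eq_tens_basis _ _ _ (fun y y' => tmap2 f g (tens << b >> << b' >>) (tens y y'))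
  (fun y y' => tens (f << b >> y) (g << b' >> y'))).
- by move=> c a u v; rewrite linearP tmap2_linr.
- by move=> c a u v; rewrite tens_linl tmap2_linr.
- by move=> c a u v; rewrite gr linearP.
- by move=> c a u v; rewrite fr tens_linl.
by move=> c c'; rewrite !tensUU tmap2UU.
Qed.

End Tensors.

Section Operations.
Variables (K : fieldType) (A : based K).

HB.instance Definition _ (x : space A) := GRing.isLinear.Build K (space A) (space A) _
  (dot x) (bext_linr (@bdot K A) x).
HB.instance Definition _ (x : space A) := GRing.isLinear.Build K (space A) (space A) _
  (nw x) (bext_linr (@bnw K A) x).
HB.instance Definition _ := GRing.isLinear.Build K (space A) (space2 A) _
  (@dprec K A) (lext_is_linear (@bprec K A)).
HB.instance Definition _ := GRing.isLinear.Build K (space A) (space2 A) _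
  (@dsucc K A) (lext_is_linear (@bsucc K A)).

Lemma dot_linl (y : space A) : linear ((@dot K A)^~ y).
Proof. exact: bext_linl. Qed.
Lemma dot_linr (x : space A) : linear (dot x).
Proof. exact: linearP. Qed.
Lemma nw_linl (y : space A) : linear ((@nw K A)^~ y).
Proof. exact: bext_linl. Qed.
Lemma nw_linr (x : space A) : linear (nw x).
Proof. exact: linearP. Qed.

Lemma dred_linear : linear (@dred K A).
Proof. by apply: lin_add; exact: linearP. Qed.

HB.instance Definition _ := GRing.isLinear.Build K (space A) (space2 A) _
  (@dred K A) dred_linear.

End Operations.

Lemma add5 (V : zmodType) (x y x' y' z z' t t' u u' : V) :
  x = x' -> y = y' -> z = z' -> t = t' -> u = u' ->
  x + y + z + t + u = x' + y' + z' + t' + u'.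
Proof. by do 5!move->. Qed.

Lemma lin_id (K : fieldType) (V : lmodType K) : linear (@id V).
Proof. by []. Qed.

(** Linearity in a parameter of the operator rather than in the tensor, as for
    [tmap (dot^~ y) id (dred x)] seen as a function of y. *)
Lemma tmap_parl (K : fieldType) (B C B' C' : choiceType) (W : lmodType K)
    (f : W -> {malg K[B]} -> {malg K[B']}) (g : {malg K[C]} -> {malg K[C']}) t :
  (forall u, linear (f^~ u)) -> linear (fun y => tmap (f y) g t).
Proof.
move=> lf a x y; rewrite /tmap -lext_lin; apply: eq_lext => p.
by rewrite lf tens_linl.
Qed.

Lemma tmap_parr (K : fieldType) (B C B' C' : choiceType) (W : lmodType K)
    (f : {malg K[B]} -> {malg K[B']}) (g : W -> {malg K[C]} -> {malg K[C']}) t :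
  (forall u, linear (g^~ u)) -> linear (fun y => tmap f (g y) t).
Proof.
move=> lg a x y; rewrite /tmap -lext_lin; apply: eq_lext => p.
by rewrite lg linearP.
Qed.

Lemma lin_add5 (K : fieldType) (V W : lmodType K) (f g h i j : V -> W) :
  linear f -> linear g -> linear h -> linear i -> linear j ->
  linear (fun x => f x + g x + h x + i x + j x).
Proof. by move=> lf lg lh li lj; do 4![apply: lin_add => //]. Qed.

Lemma lin_add3 (K : fieldType) (V W : lmodType K) (f g h : V -> W) :
  linear f -> linear g -> linear h -> linear (fun x => f x + g x + h x).
Proof. by move=> lf lg lh; do 2![apply: lin_add => //]. Qed.

Lemma tmap_lin (K : fieldType) (B C B' C' : choiceType)
    (f : {malg K[B]} -> {malg K[B']}) (g : {malg K[C]} -> {malg K[C']}) :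
  linear (tmap f g).
Proof. exact: linearP. Qed.

Lemma tassoc_lin (K : fieldType) (B : choiceType) : linear (@tassoc K B).
Proof. exact: linearP. Qed.

Section Homogeneity.
Variable K : fieldType.
Implicit Types B C : choiceType.

Lemma homog0 B (deg : B -> nat) n : homog deg n (0 : {malg K[B]}).
Proof. by move=> b; rewrite msupp0 inE. Qed.

Lemma homogU B (deg : B -> nat) b n : deg b = n -> homog deg n (<< b >> : {malg K[B]}).
Proof. by move=> db c; rewrite msuppU oner_eq0 inE => /eqP->. Qed.

Lemma homogD B (deg : B -> nat) n (x y : {malg K[B]}) :
  homog deg n x -> homog deg n y -> homog deg n (x + y).
Proof.
by move=> hx hy b /(fsubsetP (msuppD_le _ _)); rewrite inE => /orP[/hx|/hy].
Qed.

Lemma homogZ B (deg : B -> nat) n a (x : {malg K[B]}) :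
  homog deg n x -> homog deg n (a *: x).
Proof. by move=> hx b /(fsubsetP (msuppZ_le _ _))/hx. Qed.

Lemma homogB B (deg : B -> nat) n (x y : {malg K[B]}) :
  homog deg n x -> homog deg n y -> homog deg n (x - y).
Proof. by move=> hx hy; rewrite -scaleN1r; apply: homogD => //; exact: homogZ. Qed.

Lemma homog_sum B (deg : B -> nat) n (I : eqType) (r : seq I) (P : pred I)
    (F : I -> {malg K[B]}) :
  (forall i, i \in r -> P i -> homog deg n (F i)) ->
  homog deg n (\sum_(i <- r | P i) F i).
Proof.
move=> hF; rewrite big_seq_cond; apply: big_ind => //.
- exact: homog0.
- by move=> x y; exact: homogD.
by move=> i /andP[]; exact: hF.
Qed.

Lemma homog_lext B C (deg : B -> nat) (deg' : C -> nat) m n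
    (f : B -> {malg K[C]}) x :
  (forall b, deg b = m -> homog deg' n (f b)) -> homog deg m x ->
  homog deg' n (lext f x).
Proof. by move=> hf hx; apply: homog_sum => b bx _; apply/homogZ/hf/hx. Qed.

Lemma homog_bext B C (E : choiceType) (deg : B -> nat) (deg' : C -> nat) (deg'' : E -> nat) m n p
    (f : B -> C -> {malg K[E]}) x y :
  (forall b c, deg b = m -> deg' c = n -> homog deg'' p (f b c)) ->
  homog deg m x -> homog deg' n y -> homog deg'' p (bext f x y).
Proof.
move=> hf hx hy; apply: homog_lext hx => b db.
by apply: homog_lext hy => c; exact: hf.
Qed.

(** Generalises [bdeg2] to two different bases, so that triple tensors are graded by iteration. *)
Definition deg_pair B C (deg : B -> nat) (deg' : C -> nat) (p : B * C) : nat :=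
  (deg p.1 + deg' p.2)%N.

Lemma homog_tens B C (deg : B -> nat) (deg' : C -> nat) m n
    (x : {malg K[B]}) (y : {malg K[C]}) :
  homog deg m x -> homog deg' n y -> homog (deg_pair deg deg') (m + n) (tens x y).
Proof. by apply: homog_bext => b c <- <-; apply: homogU. Qed.

Lemma homog_tmap B C B' C' (deg : B -> nat) (deg' : C -> nat)
    (edeg : B' -> nat) (edeg' : C' -> nat) n
    (f : {malg K[B]} -> {malg K[B']}) (g : {malg K[C]} -> {malg K[C']}) t :
  (forall b, homog edeg (deg b) (f << b >>)) ->
  (forall b, homog edeg' (deg' b) (g << b >>)) ->
  homog (deg_pair deg deg') n t -> homog (deg_pair edeg edeg') n (tmap f g t).
Proof.
move=> hf hg; apply: homog_lext => -[b c] <-.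
by apply: homog_tens.
Qed.

End Homogeneity.

(** * Bialgebras given by lists of words and cuts *)

(* T consists of indices of the basis and of an empty index e, with ve e = 0.
   An element (b, (l, r)) of cut s stands for the term l (x) r of the coproduct,
   in D_prec if b and in D_succ otherwise.  The trivial cuts (s, e) and (e, s)
   are included: with them the five-term compatibilities become the two uniform
   identities pr_mul_cut and pr_gr_cut.  In pr_coassoc, the three values of the
   first argument of H separate the three axioms of dendriform coalgebras. *)
Section Presentation.
Variables (K : fieldType) (A : based K) (T : choiceType) (e : T) (ok : pred T)
  (v : bas A -> T) (ve : T -> space A) (mul gr : T -> T -> seq T)
  (cut : T -> seq (bool * (T * T))) (dg : T -> nat).

Definition vcut (c : bool * (T * T)) : space2 A := tens (ve c.2.1) (ve c.2.2).

Definition proper (c : bool * (T * T)) : bool := (c.2.1 != e) && (c.2.2 != e).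

Record presentation : Prop := Presentation {
  pr_vec : forall b, ve (v b) = << b >>;
  pr_vec0 : ve e = 0;
  pr_ok0 : ok e;
  pr_ok : forall b, ok (v b);
  pr_okP : forall s, ok s -> s != e -> exists b, v b = s;
  pr_dot : forall b c, bdot b c = \sum_(w <- mul (v b) (v c)) ve w;
  pr_nw : forall b c, bnw b c = \sum_(w <- gr (v b) (v c)) ve w;
  pr_prec : forall b, bprec b = \sum_(c <- cut (v b) | c.1) vcut c;
  pr_succ : forall b, bsucc b = \sum_(c <- cut (v b) | ~~ c.1) vcut c;
  pr_mul_ok : forall s t, ok s -> ok t -> s != e -> t != e ->
    {in mul s t, forall w, ok w && (w != e)};
  pr_gr_ok : forall s t, ok s -> ok t -> s != e -> t != e ->
    {in gr s t, forall w, ok w && (w != e)};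
  pr_cut_ok : forall s, ok s -> {in cut s, forall c, ok c.2.1 && ok c.2.2};
  pr_mul1 : forall t, ok t -> mul e t = [:: t];
  pr_mulr1 : forall s, ok s -> mul s e = [:: s];
  pr_gr1 : forall s, ok s -> gr s e = [:: s];
  pr_cutE : forall s, ok s -> s != e ->
    perm_eq (cut s) [:: (true, (s, e)), (false, (e, s)) & filter proper (cut s)];
  pr_mul_cut : forall (V : zmodType) (H : bool -> T -> T -> V) s t,
    ok s -> ok t -> s != e -> t != e ->
    \sum_(w <- mul s t) \sum_(c <- cut w) H c.1 c.2.1 c.2.2 =
    \sum_(c <- cut s) \sum_(d <- cut t) \sum_(l <- mul c.2.1 d.2.1)
       \sum_(r <- mul c.2.2 d.2.2) H d.1 l r;
  pr_gr_cut : forall (V : zmodType) (H : bool -> T -> T -> V) s t,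
    ok s -> ok t -> s != e -> t != e ->
    \sum_(w <- gr s t) \sum_(c <- cut w) H c.1 c.2.1 c.2.2 =
    \sum_(c <- cut s | c.1) \sum_(l <- gr c.2.1 t) H true l c.2.2 +
    \sum_(c <- cut s | ~~ c.1) \sum_(d <- cut t) \sum_(l <- mul c.2.1 d.2.1)
       \sum_(r <- gr c.2.2 d.2.2) H d.1 l r;
  pr_cut0 : {in cut e, forall c, ~~ proper c};
  pr_coassoc : forall (V : zmodType) (H : nat -> T -> T -> T -> V) s, ok s -> s != e ->
    \sum_(c <- cut s) \sum_(d <- cut c.2.1)
       H (if c.1 then (if d.1 then 0 else 1) else 2)%N d.2.1 d.2.2 c.2.2 =
    \sum_(c <- cut s) \sum_(d <- cut c.2.2)
       H (if c.1 then 0 else (if d.1 then 1 else 2))%N c.2.1 d.2.1 d.2.2;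
  pr_mulA : forall (V : zmodType) (F : T -> V) s t u, ok s -> ok t -> ok u ->
    s != e -> t != e -> u != e ->
    \sum_(w <- mul s t) \sum_(x <- mul w u) F x =
    \sum_(w <- mul t u) \sum_(x <- mul s w) F x;
  pr_grA : forall (V : zmodType) (F : T -> V) s t u, ok s -> ok t -> ok u ->
    s != e -> t != e -> u != e ->
    \sum_(w <- gr s t) \sum_(x <- gr w u) F x =
    \sum_(w <- gr t u) \sum_(x <- gr s w) F x;
  pr_mul_grA : forall (V : zmodType) (F : T -> V) s t u, ok s -> ok t -> ok u ->
    s != e -> t != e -> u != e ->
    \sum_(w <- mul s t) \sum_(x <- gr w u) F x =
    \sum_(w <- gr t u) \sum_(x <- mul s w) F x;
  pr_deg : forall b, bdeg b = dg (v b);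
  pr_mul_deg : forall s t, ok s -> ok t -> s != e -> t != e ->
    {in mul s t, forall w, dg w = dg s + dg t}%N;
  pr_gr_deg : forall s t, ok s -> ok t -> s != e -> t != e ->
    {in gr s t, forall w, dg w = dg s + dg t}%N;
  pr_cut_deg : forall s, ok s -> {in cut s, forall c, dg c.2.1 + dg c.2.2 = dg s}%N
}.

Hypothesis pr : presentation.

Lemma v_neq b : v b != e.
Proof.
apply/eqP => vb; have := pr_vec pr b; rewrite vb (pr_vec0 pr) => /esym/eqP.
by rewrite monalgU_eq0 oner_eq0.
Qed.

Definition vmul s t : space A := \sum_(w <- mul s t) ve w.
Definition vgr s t : space A := \sum_(w <- gr s t) ve w.

Lemma dotUU b c : dot (<< b >> : space A) << c >> = vmul (v b) (v c).
Proof. by rewrite /dot bextUU (pr_dot pr). Qed.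

Lemma nwUU b c : nw (<< b >> : space A) << c >> = vgr (v b) (v c).
Proof. by rewrite /nw bextUU (pr_nw pr). Qed.

Lemma dot_ve s t : ok s -> ok t -> s != e -> t != e -> dot (ve s) (ve t) = vmul s t.
Proof.
move=> os ot sn tn; have [b <-] := pr_okP pr os sn; have [c <-] := pr_okP pr ot tn.
by rewrite !(pr_vec pr) dotUU.
Qed.

Lemma nw_ve s t : ok s -> ok t -> s != e -> t != e -> nw (ve s) (ve t) = vgr s t.
Proof.
move=> os ot sn tn; have [b <-] := pr_okP pr os sn; have [c <-] := pr_okP pr ot tn.
by rewrite !(pr_vec pr) nwUU.
Qed.

Lemma vmul1 t : ok t -> vmul e t = ve t.
Proof. by move=> ot; rewrite /vmul (pr_mul1 pr) // big_seq1. Qed.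
Lemma vmulr1 t : ok t -> vmul t e = ve t.
Proof. by move=> ot; rewrite /vmul (pr_mulr1 pr) // big_seq1. Qed.
Lemma vgr1 t : ok t -> vgr t e = ve t.
Proof. by move=> ot; rewrite /vgr (pr_gr1 pr) // big_seq1. Qed.

Let pcut s := filter proper (cut s).

(** As [ve e = 0], improper cuts contribute nothing, so listing them in [cut] is harmless for the
    coproducts. *)
Lemma sum_vcut_proper (P : pred (bool * (T * T))) s :
  \sum_(c <- cut s | P c) vcut c = \sum_(c <- pcut s | P c) vcut c.
Proof.
rewrite big_filter_cond (bigID proper) /= [X in _ + X]big1 ?addr0.
  by apply: eq_bigl => c; rewrite andbC.
move=> c /andP[_]; rewrite /vcut negb_and !negbK.
by case/orP => /eqP->; rewrite (pr_vec0 pr) ?tens0l ?tens0r.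
Qed.

Lemma dprec_ve s : ok s -> s != e -> dprec (ve s) = \sum_(c <- cut s | c.1) vcut c.
Proof.
move=> os sn; have [b <-] := pr_okP pr os sn.
by rewrite (pr_vec pr) /dprec lextU (pr_prec pr).
Qed.

Lemma dsucc_ve s : ok s -> s != e -> dsucc (ve s) = \sum_(c <- cut s | ~~ c.1) vcut c.
Proof.
move=> os sn; have [b <-] := pr_okP pr os sn.
by rewrite (pr_vec pr) /dsucc lextU (pr_succ pr).
Qed.

Lemma dred_ve s : ok s -> s != e -> dred (ve s) = \sum_(c <- cut s) vcut c.
Proof.
move=> os sn; rewrite /dred dprec_ve // dsucc_ve //.
by rewrite [RHS](bigID fst).
Qed.

Lemma sum_cutE (V : zmodType) (H : bool -> T -> T -> V) s : ok s -> s != e ->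
  \sum_(c <- cut s) H c.1 c.2.1 c.2.2 =
  H true s e + (H false e s + \sum_(c <- pcut s) H c.1 c.2.1 c.2.2).
Proof.
by move=> os sn; rewrite (perm_big _ (pr_cutE pr os sn)) /= !big_cons.
Qed.

(** Each of the two cuts is total, empty or proper, which gives nine groups of terms. They are
    gathered into five, in the order of the five terms of the compatibility between coproducts and
    dot product. *)
Lemma sum_cut2E (V : zmodType) (H : T -> T -> bool -> T -> T -> V) s t :
  ok s -> ok t -> s != e -> t != e ->
  \sum_(c <- cut s) \sum_(d <- cut t) H c.2.1 c.2.2 d.1 d.2.1 d.2.2 =
  (H s e true t e + H s e false e t + (H e s true t e + H e s false e t))
  + (\sum_(c <- pcut s) H c.2.1 c.2.2 true t e +
     \sum_(c <- pcut s) H c.2.1 c.2.2 false e t)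
  + \sum_(d <- pcut t) H s e d.1 d.2.1 d.2.2
  + \sum_(d <- pcut t) H e s d.1 d.2.1 d.2.2
  + \sum_(c <- pcut s) \sum_(d <- pcut t) H c.2.1 c.2.2 d.1 d.2.1 d.2.2.
Proof.
move=> os ot sn tn.
rewrite (sum_cutE (fun _ l r => \sum_(d <- cut t) H l r d.1 d.2.1 d.2.2)) //=.
under [\sum_(k <- pcut s) _]eq_bigr do rewrite (sum_cutE (H _ _)) //.
rewrite !(sum_cutE (H _ _)) // !big_split /=.
by rewrite (AC ((1*2)*((1*2)*(1*2))) ((1*2*(4*5))*(7*8)*3*6*9)).
Qed.

(** Same splitting for the right-hand side of [pr_gr_cut]. The total cut of s has flag [true] and
    only occurs in the first sum, the empty one only in the second. *)
Lemma sum_gr2E (V : zmodType) (G : T -> T -> V) (H : T -> T -> bool -> T -> T -> V)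
    s t : ok s -> ok t -> s != e -> t != e ->
  \sum_(c <- cut s | c.1) G c.2.1 c.2.2 +
  \sum_(c <- cut s | ~~ c.1) \sum_(d <- cut t) H c.2.1 c.2.2 d.1 d.2.1 d.2.2 =
  (G s e + (H e s true t e + H e s false e t))
  + \sum_(d <- pcut t) H e s d.1 d.2.1 d.2.2
  + \sum_(c <- pcut s | c.1) G c.2.1 c.2.2
  + (\sum_(c <- pcut s | ~~ c.1) H c.2.1 c.2.2 true t e +
     \sum_(c <- pcut s | ~~ c.1) H c.2.1 c.2.2 false e t)
  + \sum_(c <- pcut s | ~~ c.1) \sum_(d <- pcut t) H c.2.1 c.2.2 d.1 d.2.1 d.2.2.
Proof.
move=> os ot sn tn.
rewrite !(perm_big _ (pr_cutE pr os sn)) /= !big_cons /=.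
under [\sum_(k <- pcut s | _) \sum_(d <- _) _]eq_bigr do rewrite (sum_cutE (H _ _)) //.
rewrite !(sum_cutE (H _ _)) // !big_split /=.
by rewrite (AC (2*((1*2)*(1*2))) ((1*(3*4))*5*2*(6*7)*8)).
Qed.

Lemma pcut_ok s c : ok s -> c \in pcut s ->
  [/\ ok c.2.1, ok c.2.2, c.2.1 != e & c.2.2 != e].
Proof.
move=> os; rewrite mem_filter => /andP[/andP[-> ->]] /(pr_cut_ok pr os).
by case/andP.
Qed.

Local Notation U b := (<< b >> : space A).

Local Opaque tens tmap tmap2 dot nw lext bext.

(** The boolean x treats D_prec and D_succ at once: the test function keeps the cuts with flag x. *)
Lemma compat_dot (x : bool) b c : 
  \sum_(w <- mul (v b) (v c)) \sum_(k <- cut w | k.1 == x) vcut k =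
  (if x then tens (U c) (U b) else tens (U b) (U c))
  + (if x then tmap ((@dot K A)^~ (U c)) id (\sum_(k <- cut (v b)) vcut k)
     else tmap id ((@dot K A)^~ (U c)) (\sum_(k <- cut (v b)) vcut k))
  + tmap (@dot K A (U b)) id (\sum_(k <- cut (v c) | k.1 == x) vcut k)
  + tmap id (@dot K A (U b)) (\sum_(k <- cut (v c) | k.1 == x) vcut k)
  + tmap2 (@dot K A) (@dot K A) (\sum_(k <- cut (v b)) vcut k)
      (\sum_(k <- cut (v c) | k.1 == x) vcut k).
Proof.
pose H y l r := if y == x then tens (ve l) (ve r) : space2 A else 0.
have ob := pr_ok pr b; have oc := pr_ok pr c.
have nb := v_neq b; have nc := v_neq c.
rewrite !sum_vcut_proper.
transitivity (\sum_(w <- mul (v b) (v c)) \sum_(k <- cut w) H k.1 k.2.1 k.2.2).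
  by apply: eq_bigr => w _; rewrite big_mkcond.
rewrite (pr_mul_cut pr) //.
pose H' lx rx y ly ry := if y == x then tens (vmul lx ly) (vmul rx ry) : space2 A else 0.
transitivity (\sum_(k <- cut (v b)) \sum_(d <- cut (v c))
    H' k.2.1 k.2.2 d.1 d.2.1 d.2.2).
  apply: eq_bigr => k _; apply: eq_bigr => d _; rewrite /H /H'.
  case: (d.1 == x); last by rewrite big1 // => l _; rewrite big1.
  by rewrite tens_sum.
rewrite (sum_cut2E H') //.
have okE s d : s \in pcut (v d) -> [/\ ok s.2.1, ok s.2.2, s.2.1 != e & s.2.2 != e].
  by apply: pcut_ok; exact: (pr_ok pr).
apply: add5.
(* Two of the four products of trivial cuts have flag x. One of them puts both words in the same
   factor and [ve e = 0] in the other; the second one is the announced tensor. *)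
- rewrite /H'; case: (x) => /=; rewrite ?vmul1 ?vmulr1 ?(pr_vec pr) ?(pr_vec0 pr);
    by rewrite ?tens0l ?tens0r ?addr0 ?add0r // (pr_ok0 pr).
- rewrite -big_split /H'; case: (x) => /=; rewrite linear_sum;
    apply: eq_big_seq => k /okE[k1 k2 n1 n2] /=; rewrite ?addr0 ?add0r vmulr1 //.
  + by rewrite /vcut tmap_tens -?(pr_vec pr) ?dot_ve //; by [exact: lin_id | exact: dot_linl].
  + by rewrite /vcut tmap_tens -?(pr_vec pr) ?dot_ve //; by [exact: lin_id | exact: dot_linl].
- rewrite linear_sum [RHS]big_mkcond /=; apply: eq_big_seq => k /okE[k1 k2 n1 n2].
  rewrite /H'; case: ifP => // _; rewrite (vmul1 k2) /vcut tmap_tens; first last.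
  + by [exact: dot_linr|exact: lin_id].
  + by [exact: dot_linr|exact: lin_id].
  by rewrite -(pr_vec pr) dot_ve.
- rewrite linear_sum [RHS]big_mkcond /=; apply: eq_big_seq => k /okE[k1 k2 n1 n2].
  rewrite /H'; case: ifP => // _; rewrite (vmul1 k1) /vcut tmap_tens; first last.
  + by [exact: dot_linr|exact: lin_id].
  + by [exact: dot_linr|exact: lin_id].
  by rewrite -(pr_vec pr) dot_ve.
rewrite (lin_sum (tmap2_linl _ _ _)); apply: eq_big_seq => k /okE[k1 k2 n1 n2].
rewrite (lin_sum (tmap2_linr _ _ _)) [RHS]big_mkcond; apply: eq_big_seq => d /okE[d1 d2 m1 m2].
rewrite /H'; case: ifP => // _; rewrite /vcut.
rewrite (tmap2_tens _ _ _ _ (@dot_linr K A) (@dot_linl K A) (@dot_linr K A) (@dot_linl K A)).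
by rewrite !dot_ve.
Qed.


(** Cuts of b with flag [true] only enter D_prec: the grafted c then follows the grafting point into
    the upper part uncut, and the flag stays [true]. *)
Lemma compat_nw (x : bool) b c :
  \sum_(w <- gr (v b) (v c)) \sum_(k <- cut w | k.1 == x) vcut k =
  (if x then tens (U c) (U b) else 0)
  + tmap id (@nw K A (U b)) (\sum_(k <- cut (v c) | k.1 == x) vcut k)
  + (if x then tmap ((@nw K A)^~ (U c)) id (\sum_(k <- cut (v b) | k.1) vcut k) else 0)
  + (if x then tmap ((@dot K A)^~ (U c)) id (\sum_(k <- cut (v b) | ~~ k.1) vcut k)
     else tmap id ((@nw K A)^~ (U c)) (\sum_(k <- cut (v b) | ~~ k.1) vcut k))
  + tmap2 (@dot K A) (@nw K A) (\sum_(k <- cut (v b) | ~~ k.1) vcut k)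
      (\sum_(k <- cut (v c) | k.1 == x) vcut k).
Proof.
pose H y l r := if y == x then tens (ve l) (ve r) : space2 A else 0.
have ob := pr_ok pr b; have oc := pr_ok pr c.
have nb := v_neq b; have nc := v_neq c.
rewrite !sum_vcut_proper.
transitivity (\sum_(w <- gr (v b) (v c)) \sum_(k <- cut w) H k.1 k.2.1 k.2.2).
  by apply: eq_bigr => w _; rewrite big_mkcond.
rewrite (pr_gr_cut pr) //.
pose G lx rx := if true == x then tens (vgr lx (v c)) (ve rx) : space2 A else 0.
pose H' lx rx y ly ry := if y == x then tens (vmul lx ly) (vgr rx ry) : space2 A else 0.
transitivity (\sum_(k <- cut (v b) | k.1) G k.2.1 k.2.2 +
    \sum_(k <- cut (v b) | ~~ k.1) \sum_(d <- cut (v c))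
      H' k.2.1 k.2.2 d.1 d.2.1 d.2.2).
  congr (_ + _).
    apply: eq_bigr => k _; rewrite /G /H.
    case: (true == x); last by rewrite big1.
    by rewrite (lin_sum (tens_linl _)).
  apply: eq_bigr => k _; apply: eq_bigr => d _; rewrite /H /H'.
  case: (d.1 == x); last by rewrite big1 // => l _; rewrite big1.
  by rewrite tens_sum.
rewrite (sum_gr2E G H') //.
have okE s d : s \in pcut (v d) -> [/\ ok s.2.1, ok s.2.2, s.2.1 != e & s.2.2 != e].
  by apply: pcut_ok; exact: (pr_ok pr).
apply: add5.
- rewrite /G /H'; case: (x) => /=; rewrite ?vmul1 ?vgr1 ?(pr_vec pr) ?(pr_vec0 pr);
    by rewrite ?tens0l ?tens0r ?addr0 ?add0r // (pr_ok0 pr).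
- rewrite linear_sum [RHS]big_mkcond /=; apply: eq_big_seq => k /okE[k1 k2 n1 n2].
  rewrite /H'; case: ifP => // _; rewrite (vmul1 k1) /vcut tmap_tens; first last.
  + by [exact: nw_linr|exact: lin_id].
  + by [exact: lin_id].
  by rewrite -(pr_vec pr) nw_ve.
- rewrite /G; case: (x) => /=; last by rewrite big1.
  rewrite linear_sum big_seq_cond [RHS]big_seq_cond /=.
  apply: eq_bigr => k /andP[/okE[k1 k2 n1 n2] _].
  rewrite /vcut tmap_tens; first last.
  + by [exact: lin_id].
  + by [exact: nw_linl].
  by rewrite -(pr_vec pr) nw_ve.
- rewrite -big_split /H'; case: (x) => /=; rewrite linear_sum;
    rewrite big_seq_cond [RHS]big_seq_cond;
    apply: eq_bigr => k /andP[/okE[k1 k2 n1 n2] _] /=.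
  + rewrite addr0 vgr1 // /vcut tmap_tens; first last.
    * exact: lin_id.
    * exact: dot_linl.
    by rewrite -(pr_vec pr) dot_ve.
  + rewrite add0r vmulr1 // /vcut tmap_tens; first last.
    * exact: nw_linl.
    * exact: lin_id.
    by rewrite -(pr_vec pr) nw_ve.
rewrite (lin_sum (tmap2_linl _ _ _)) big_seq_cond [RHS]big_seq_cond.
apply: eq_bigr => k /andP[/okE[k1 k2 n1 n2] _].
rewrite (lin_sum (tmap2_linr _ _ _)) [RHS]big_mkcond; apply: eq_big_seq => d /okE[d1 d2 m1 m2].
rewrite /H'; case: ifP => // _; rewrite /vcut.
rewrite (tmap2_tens _ _ _ _ (@dot_linr K A) (@dot_linl K A) (@nw_linr K A) (@nw_linl K A)).
by rewrite (dot_ve k1 d1 n1 m1) (nw_ve k2 d2 n2 m2).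
Qed.


Lemma sum_vcut0 (P : pred (bool * (T * T))) : \sum_(c <- cut e | P c) vcut c = 0.
Proof.
rewrite sum_vcut_proper big_seq_cond big1 // => c /andP[].
by rewrite mem_filter => /andP[pc /(pr_cut0 pr)]; rewrite pc.
Qed.

Lemma presentation_duplicial : duplicial A.
Proof.
have mul_ok b c : {in mul (v b) (v c), forall w, ok w /\ w != e}.
  move=> w; have H := pr_mul_ok pr (pr_ok pr b) (pr_ok pr c) (v_neq b) (v_neq c).
  by move/H/andP.
have gr_ok b c : {in gr (v b) (v c), forall w, ok w /\ w != e}.
  move=> w; have H := pr_gr_ok pr (pr_ok pr b) (pr_ok pr c) (v_neq b) (v_neq c).
  by move/H/andP.
have vb b : ok (v b) /\ v b != e by rewrite v_neq (pr_ok pr).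
move=> x y z; split.
- apply: (@eq_lin_basis _ _ _ (fun x => dot (dot x y) z) (fun x => dot x (dot y z))).
  + by move=> a u w; rewrite !dot_linl.
  + by move=> a u w; rewrite !dot_linl.
  move=> b; apply: (@eq_tens_basis _ _ _ _ (fun y z => dot (dot (U b) y) z)
    (fun y z => dot (U b) (dot y z))).
  + by move=> t a u w; rewrite !linearP.
  + by move=> t a u w; rewrite linearP dot_linl.
  + by move=> t a u w; rewrite !linearP.
  + by move=> t a u w; rewrite dot_linl !linearP.
  move=> c d; rewrite !dotUU (lin_sum (dot_linl _)) (lin_sum (dot_linr _)).
  have [[ob nb] [[oc nc] [od nd]]] := (vb b, (vb c, vb d)).
  transitivity (\sum_(w <- mul (v b) (v c)) vmul w (v d)).
    by apply: eq_big_seq => w /mul_ok[ow nw]; rewrite -(pr_vec pr) dot_ve.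
  rewrite (pr_mulA pr) //; apply: eq_big_seq => w /mul_ok[ow nw].
  by rewrite -(pr_vec pr) dot_ve.
- apply: (@eq_lin_basis _ _ _ (fun x => nw (nw x y) z) (fun x => nw x (nw y z))).
  + by move=> a u w; rewrite !nw_linl.
  + by move=> a u w; rewrite !nw_linl.
  move=> b; apply: (@eq_tens_basis _ _ _ _ (fun y z => nw (nw (U b) y) z)
    (fun y z => nw (U b) (nw y z))).
  + by move=> t a u w; rewrite !linearP.
  + by move=> t a u w; rewrite linearP nw_linl.
  + by move=> t a u w; rewrite !linearP.
  + by move=> t a u w; rewrite nw_linl !linearP.
  move=> c d; rewrite !nwUU (lin_sum (nw_linl _)) (lin_sum (nw_linr _)).
  have [[ob nb] [[oc nc] [od nd]]] := (vb b, (vb c, vb d)).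
  transitivity (\sum_(w <- gr (v b) (v c)) vgr w (v d)).
    by apply: eq_big_seq => w /gr_ok[ow nw]; rewrite -(pr_vec pr) nw_ve.
  rewrite (pr_grA pr) //; apply: eq_big_seq => w /gr_ok[ow nw].
  by rewrite -(pr_vec pr) nw_ve.
apply: (@eq_lin_basis _ _ _ (fun x => nw (dot x y) z) (fun x => dot x (nw y z))).
+ by move=> a u w; rewrite dot_linl nw_linl.
+ by move=> a u w; rewrite dot_linl.
move=> b; apply: (@eq_tens_basis _ _ _ _ (fun y z => nw (dot (U b) y) z)
  (fun y z => dot (U b) (nw y z))).
+ by move=> t a u w; rewrite !linearP.
+ by move=> t a u w; rewrite linearP nw_linl.
+ by move=> t a u w; rewrite !linearP.
+ by move=> t a u w; rewrite nw_linl !linearP.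
move=> c d; rewrite nwUU dotUU (lin_sum (nw_linl _)) (lin_sum (dot_linr _)).
have [[ob nb] [[oc nc] [od nd]]] := (vb b, (vb c, vb d)).
transitivity (\sum_(w <- mul (v b) (v c)) vgr w (v d)).
  by apply: eq_big_seq => w /mul_ok[ow nw]; rewrite -(pr_vec pr) nw_ve.
rewrite (pr_mul_grA pr) //; apply: eq_big_seq => w /gr_ok[ow nw].
by rewrite -(pr_vec pr) dot_ve.
Qed.

Lemma vdeg s : ok s -> homog (@bdeg K A) (dg s) (ve s).
Proof.
move=> os; have [->|sn] := eqVneq s e; first by rewrite (pr_vec0 pr); exact: homog0.
have [b <-] := pr_okP pr os sn; rewrite (pr_vec pr); apply: homogU; exact: (pr_deg pr).
Qed.

Lemma presentation_graded : DupDend_graded A.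
Proof.
have cut_homog (P : pred (bool * (T * T))) b :
    homog (@bdeg2 K A) (bdeg b) (\sum_(c <- cut (v b) | P c) vcut c).
  apply: homog_sum => c cb _; have ob := pr_ok pr b.
  rewrite (pr_deg pr) -(pr_cut_deg pr ob cb).
  have /andP[] := pr_cut_ok pr ob cb.
  by move=> /vdeg h1 /vdeg h2; apply: homog_tens.
split=> [m n x y|m n x y|n x|n x].
- apply: homog_bext => b c <- <-; rewrite (pr_dot pr); apply: homog_sum => w wbc _.
  have hb := pr_ok pr b; have hc := pr_ok pr c.
  rewrite !(pr_deg pr) -(pr_mul_deg pr hb hc _ _ wbc) ?v_neq //; apply: vdeg.
  by have /andP[] := pr_mul_ok pr hb hc (v_neq b) (v_neq c) wbc.
- apply: homog_bext => b c <- <-; rewrite (pr_nw pr); apply: homog_sum => w wbc _.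
  have hb := pr_ok pr b; have hc := pr_ok pr c.
  rewrite !(pr_deg pr) -(pr_gr_deg pr hb hc _ _ wbc) ?v_neq //; apply: vdeg.
  by have /andP[] := pr_gr_ok pr hb hc (v_neq b) (v_neq c) wbc.
- by apply: homog_lext => b <-; rewrite (pr_prec pr).
by apply: homog_lext => b <-; rewrite (pr_succ pr).
Qed.

Lemma presentation_compat : DupDend_compat A.
Proof.
have lt (t : space2 A) g : linear (fun y => tmap ((@dot K A)^~ y) g t).
  by apply: tmap_parl => u; exact: dot_linr.
have ltr (t : space2 A) g : linear (fun y => tmap g ((@dot K A)^~ y) t).
  by apply: tmap_parr => u; exact: dot_linr.
have lt' (t : space2 A) g : linear (fun x => tmap (@dot K A x) g t).
  by apply: tmap_parl => u; exact: dot_linl.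
have ltr' (t : space2 A) g : linear (fun x => tmap g (@dot K A x) t).
  by apply: tmap_parr => u; exact: dot_linl.
have lg (t : space2 A) g : linear (fun y => tmap ((@nw K A)^~ y) g t).
  by apply: tmap_parl => u; exact: nw_linr.
have lgr (t : space2 A) g : linear (fun y => tmap g ((@nw K A)^~ y) t).
  by apply: tmap_parr => u; exact: nw_linr.
have lgr' (t : space2 A) g : linear (fun x => tmap g (@nw K A x) t).
  by apply: tmap_parr => u; exact: nw_linl.
have lc (V W X : lmodType K) (f : W -> X) (g : V -> W) :
    linear f -> linear g -> linear (fun x => f (g x)) by exact: lin_comp.
have lp : linear (@dprec K A) by exact: linearP.
have ls : linear (@dsucc K A) by exact: linearP.
have lr : linear (@dred K A) by exact: linearP.
have t2l f g s (h : space A -> space2 A) :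
    linear h -> linear (fun x => @tmap2 K (bas A) f g (h x) s).
  exact: (lc _ _ _ (fun t => tmap2 f g t s) h (tmap2_linl f g s)).
have t2r f g t (h : space A -> space2 A) :
    linear h -> linear (fun x => @tmap2 K (bas A) f g t (h x)).
  exact: (lc _ _ _ (tmap2 f g t) h (tmap2_linr f g t)).
have tl f g (h : space A -> space2 A) :
    linear h -> linear (fun x => @tmap K (bas A) (bas A) (bas A) (bas A) f g (h x)).
  exact: (lc _ _ _ (tmap f g) h (tmap_lin f g)).
have dE (D : space A -> space2 A) (P : pred bool) b c : linear D ->
    (forall w, ok w -> w != e -> D (ve w) = \sum_(k <- cut w | P k.1) vcut k) ->
    D (dot (U b) (U c)) = \sum_(w <- mul (v b) (v c)) \sum_(k <- cut w | P k.1) vcut k.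
  move=> lD hD; rewrite dotUU (lin_sum lD); apply: eq_big_seq => w wbc.
  have /andP[ow nw] := pr_mul_ok pr (pr_ok pr b) (pr_ok pr c) (v_neq b) (v_neq c) wbc.
  by rewrite hD.
have gE (D : space A -> space2 A) (P : pred bool) b c : linear D ->
    (forall w, ok w -> w != e -> D (ve w) = \sum_(k <- cut w | P k.1) vcut k) ->
    D (nw (U b) (U c)) = \sum_(w <- gr (v b) (v c)) \sum_(k <- cut w | P k.1) vcut k.
  move=> lD hD; rewrite nwUU (lin_sum lD); apply: eq_big_seq => w wbc.
  have /andP[ow nw] := pr_gr_ok pr (pr_ok pr b) (pr_ok pr c) (v_neq b) (v_neq c) wbc.
  by rewrite hD.
have precE w : ok w -> w != e -> dprec (ve w) = \sum_(k <- cut w | k.1 == true) vcut k.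
  by move=> ow nw; rewrite dprec_ve //; apply: eq_bigl => k; case: k.1.
have succE w : ok w -> w != e -> dsucc (ve w) = \sum_(k <- cut w | k.1 == false) vcut k.
  by move=> ow nw; rewrite dsucc_ve //; apply: eq_bigl => k; case: k.1.
have bE b : ok (v b) /\ v b != e by rewrite v_neq (pr_ok pr).
have dprecU b : dprec (U b) = \sum_(k <- cut (v b) | k.1 == true) vcut k.
  by have [ob nb] := bE b; rewrite -(pr_vec pr) precE.
have dsuccU b : dsucc (U b) = \sum_(k <- cut (v b) | k.1 == false) vcut k.
  by have [ob nb] := bE b; rewrite -(pr_vec pr) succE.
have dredU b : dred (U b) = \sum_(k <- cut (v b)) vcut k.
  by have [ob nb] := bE b; rewrite -(pr_vec pr) dred_ve.
have dprecU' b : dprec (U b) = \sum_(k <- cut (v b) | k.1) vcut k.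
  by have [ob nb] := bE b; rewrite -(pr_vec pr) dprec_ve.
have dsuccU' b : dsucc (U b) = \sum_(k <- cut (v b) | ~~ k.1) vcut k.
  by have [ob nb] := bE b; rewrite -(pr_vec pr) dsucc_ve.
move=> x y; split.
- refine (@eq_tens_basis K (bas A) (bas A) (space2 A) (fun x y : space A => dprec (dot x y))
    (fun x y : space A => tens y x + tmap ((@dot K A)^~ y) id (dred x) + tmap (dot x) id (dprec y)
        + tmap id (dot x) (dprec y) + tmap2 (@dot K A) (@dot K A) (dred x) (dprec y)) x y _ _ _ _ _).
  + by move=> u; exact: lc _ _ _ _ _ lp (dot_linr u).
  + by move=> u; exact: lc _ _ _ _ _ lp (dot_linl u).
  + by move=> u; exact: lin_add5 (tens_linl u) (lt _ _ _) (tl _ _ _ lp) (tl _ _ _ lp) (t2r _ _ _ _ lp).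
  + by move=> u; exact: lin_add5 (tens_linr u) (tl _ _ _ lr) (lt' _ _ _) (ltr' _ _ _) (t2l _ _ _ _ lr).
  move=> b c; apply: etrans (dE _ (pred1 true) b c lp precE) _.
  by rewrite (compat_dot true) dredU dprecU.
- refine (@eq_tens_basis K (bas A) (bas A) (space2 A) (fun x y : space A => dsucc (dot x y))
    (fun x y : space A => tens x y + tmap id ((@dot K A)^~ y) (dred x) + tmap (dot x) id (dsucc y)
        + tmap id (dot x) (dsucc y) + tmap2 (@dot K A) (@dot K A) (dred x) (dsucc y)) x y _ _ _ _ _).
  + by move=> u; exact: lc _ _ _ _ _ ls (dot_linr u).
  + by move=> u; exact: lc _ _ _ _ _ ls (dot_linl u).
  + by move=> u; exact: lin_add5 (tens_linr u) (ltr _ _ _) (tl _ _ _ ls) (tl _ _ _ ls) (t2r _ _ _ _ ls).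
  + by move=> u; exact: lin_add5 (tens_linl u) (tl _ _ _ lr) (lt' _ _ _) (ltr' _ _ _) (t2l _ _ _ _ lr).
  move=> b c; apply: etrans (dE _ (pred1 false) b c ls succE) _.
  by rewrite (compat_dot false) dredU dsuccU.
- refine (@eq_tens_basis K (bas A) (bas A) (space2 A) (fun x y : space A => dprec (nw x y))
    (fun x y : space A => tens y x + tmap id (nw x) (dprec y) + tmap ((@nw K A)^~ y) id (dprec x)
        + tmap ((@dot K A)^~ y) id (dsucc x) + tmap2 (@dot K A) (@nw K A) (dsucc x) (dprec y)) x y _ _ _ _ _).
  + by move=> u; exact: lc _ _ _ _ _ lp (nw_linr u).
  + by move=> u; exact: lc _ _ _ _ _ lp (nw_linl u).
  + by move=> u; exact: lin_add5 (tens_linl u) (tl _ _ _ lp) (lg _ _ _) (lt _ _ _) (t2r _ _ _ _ lp).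
  + by move=> u; exact: lin_add5 (tens_linr u) (lgr' _ _ _) (tl _ _ _ lp) (tl _ _ _ ls) (t2l _ _ _ _ ls).
  move=> b c; apply: etrans (gE _ (pred1 true) b c lp precE) _.
  rewrite (compat_nw true) /= -dprecU -dprecU' -dsuccU'.
  by [].
refine (@eq_tens_basis K (bas A) (bas A) (space2 A) (fun x y : space A => dsucc (nw x y))
  (fun x y : space A => tmap id (nw x) (dsucc y) + tmap id ((@nw K A)^~ y) (dsucc x)
        + tmap2 (@dot K A) (@nw K A) (dsucc x) (dsucc y)) x y _ _ _ _ _).
+ by move=> u; exact: lc _ _ _ _ _ ls (nw_linr u).
+ by move=> u; exact: lc _ _ _ _ _ ls (nw_linl u).
+ by move=> u; exact: lin_add3 (tl _ _ _ ls) (lgr _ _ _) (t2r _ _ _ _ ls).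
+ by move=> u; exact: lin_add3 (lgr' _ _ _) (tl _ _ _ ls) (t2l _ _ _ _ ls).
move=> b c; apply: etrans (gE _ (pred1 false) b c ls succE) _.
  rewrite (compat_nw false) /= add0r addr0.
by rewrite -dsuccU' -dsuccU.
Qed.

Lemma presentation_coalgebra : dendriform_coalgebra A.
Proof.
pose w3 l m r := tens (ve l) (tens (ve m) (ve r)).
have lp : linear (@dprec K A) by exact: linearP.
have ls : linear (@dsucc K A) by exact: linearP.
have lr : linear (@dred K A) by exact: linearP.
have precE w : ok w -> dprec (ve w) = \sum_(k <- cut w | k.1) vcut k.
  move=> ow; have [->|nw] := eqVneq w e; last exact: dprec_ve.
  by rewrite sum_vcut0 (pr_vec0 pr) (lin0 lp).
have succE w : ok w -> dsucc (ve w) = \sum_(k <- cut w | ~~ k.1) vcut k.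
  move=> ow; have [->|nw] := eqVneq w e; last exact: dsucc_ve.
  by rewrite sum_vcut0 (pr_vec0 pr) (lin0 ls).
have redE w : ok w -> dred (ve w) = \sum_(k <- cut w | xpredT k.1) vcut k.
  move=> ow; have [->|nw] := eqVneq w e; last exact: dred_ve.
  by rewrite sum_vcut0 (pr_vec0 pr) (lin0 lr).
have left (D : space A -> space2 A) (P Q : pred bool) b : linear D ->
    (forall w, ok w -> D (ve w) = \sum_(k <- cut w | Q k.1) vcut k) ->
    tassoc (tmap D id (\sum_(c <- cut (v b) | P c.1) vcut c)) =
    \sum_(c <- cut (v b) | P c.1) \sum_(d <- cut c.2.1 | Q d.1) w3 d.2.1 d.2.2 c.2.2.
  move=> lD hD; rewrite (lin_sum (tmap_lin _ _)) (lin_sum (@tassoc_lin _ _)).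
  rewrite big_seq_cond [RHS]big_seq_cond.
  apply: eq_bigr => c /andP[/(pr_cut_ok pr (pr_ok pr b))/andP[c1 c2] _].
  rewrite /vcut (tmap_tens _ _ lD (@lin_id _ _)) (hD _ c1) (lin_sum (tens_linl _)).
  by rewrite (lin_sum (@tassoc_lin _ _)); apply: eq_bigr => d _; exact: tassoc_tens.
have right (D : space A -> space2 A) (P Q : pred bool) b : linear D ->
    (forall w, ok w -> D (ve w) = \sum_(k <- cut w | Q k.1) vcut k) ->
    tmap id D (\sum_(c <- cut (v b) | P c.1) vcut c) =
    \sum_(c <- cut (v b) | P c.1) \sum_(d <- cut c.2.2 | Q d.1) w3 c.2.1 d.2.1 d.2.2.
  move=> lD hD; rewrite (lin_sum (tmap_lin _ _)) big_seq_cond [RHS]big_seq_cond.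
  apply: eq_bigr => c /andP[/(pr_cut_ok pr (pr_ok pr b))/andP[c1 c2] _].
  by rewrite /vcut /= (tmap_tens _ _ (@lin_id _ _) lD) (hD _ c2) linear_sum.
(* The test function which keeps the terms of index i extracts one of the three axioms from
   [pr_coassoc]; P, Q and P', Q' describe the pairs of flags with this index on either side. *)
have coass i (P Q P' Q' : pred bool) b :
    (forall x y, P x && Q y = (i == (if x then (if y then 0 else 1) else 2)%N)) ->
    (forall x y, P' x && Q' y = (i == (if x then 0 else (if y then 1 else 2))%N)) ->
    \sum_(c <- cut (v b) | P c.1) \sum_(d <- cut c.2.1 | Q d.1) w3 d.2.1 d.2.2 c.2.2 =
    \sum_(c <- cut (v b) | P' c.1) \sum_(d <- cut c.2.2 | Q' d.1) w3 c.2.1 d.2.1 d.2.2.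
  move=> hP hP'.
  have := @pr_coassoc pr _ (fun j l m r => if i == j then w3 l m r else 0)
    _ (pr_ok pr b) (v_neq b).
  rewrite [X in X = _ -> _](eq_bigr (fun c => if P c.1 then
     \sum_(d <- cut c.2.1 | Q d.1) w3 d.2.1 d.2.2 c.2.2 else 0)); last first.
    move=> c _; case Pc: (P c.1); last first.
      by rewrite big1 // => d _; rewrite -hP Pc.
    by rewrite [RHS]big_mkcond; apply: eq_bigr => d _; rewrite -hP Pc.
  rewrite [X in _ = X -> _](eq_bigr (fun c => if P' c.1 then
     \sum_(d <- cut c.2.2 | Q' d.1) w3 c.2.1 d.2.1 d.2.2 else 0)); last first.
    move=> c _; case Pc: (P' c.1); last first.
      by rewrite big1 // => d _; rewrite -hP' Pc.
    by rewrite [RHS]big_mkcond; apply: eq_bigr => d _; rewrite -hP' Pc.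
  by rewrite -!big_mkcond.
have dprecU b : dprec (U b) = \sum_(k <- cut (v b) | k.1) vcut k.
  by rewrite -(pr_vec pr) precE ?(pr_ok pr).
have dsuccU b : dsucc (U b) = \sum_(k <- cut (v b) | ~~ k.1) vcut k.
  by rewrite -(pr_vec pr) succE ?(pr_ok pr).
move=> x; split.
- apply: (@eq_lin_basis _ _ _ (fun x : space A => tassoc (tmap (@dprec K A) id (dprec x)))
    (fun x : space A => tmap id (@dred K A) (dprec x))) => [a y z|a y z|b].
  + by rewrite !linearP.
  + by rewrite !linearP.
  rewrite dprecU (left _ id id b lp precE) (right _ id xpredT b lr redE).
  by apply: (coass 0%N id id id xpredT) => -[] [].
- apply: (@eq_lin_basis _ _ _ (fun x : space A => tassoc (tmap (@dsucc K A) id (dprec x)))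
    (fun x : space A => tmap id (@dprec K A) (dsucc x))) => [a y z|a y z|b].
  + by rewrite !linearP.
  + by rewrite !linearP.
  rewrite dprecU dsuccU (left _ id negb b ls succE) (right _ negb id b lp precE).
  by apply: (coass 1%N id negb negb id) => -[] [].
apply: (@eq_lin_basis _ _ _ (fun x : space A => tassoc (tmap (@dred K A) id (dsucc x)))
  (fun x : space A => tmap id (@dsucc K A) (dsucc x))) => [a y z|a y z|b].
+ by rewrite !linearP.
+ by rewrite !linearP.
rewrite dsuccU (left _ negb xpredT b lr redE) (right _ negb negb b ls succE).
by apply: (coass 2%N negb xpredT negb negb) => -[] [].
Qed.

Theorem presentation_bialgebra : graded_DupDend_bialgebra A.
Proof.
split; [exact: presentation_duplicial | exact: presentation_coalgebra
  | exact: presentation_compat | exact: presentation_graded].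
Qed.

End Presentation.

(** * Cuts of planar forests *)

Section Forests.
Variable D : choiceType.
Notation tree := (ptree D).
Notation forest := (seq (ptree D)).

(** The children of the first root form a forest again, so a single induction on forests replaces a
    mutual one on trees and forests. As the type is nested, it is obtained from a [fix] on trees
    with an inner induction on the list of children. *)
Lemma forest_ind (P : forest -> Prop) : P [::] ->
  (forall d ts F, P ts -> P F -> P (Node d ts :: F)) -> forall F, P F.
Proof.
move=> P0 PS.
have Pt : forall t F, P F -> P (t :: F).
  fix IH 1 => -[d ts] F PF; apply: PS PF.
  by elim: ts => [|t ts]; [exact: P0 | exact: IH].
by elim=> [|t F]; [exact: P0 | exact: Pt].
Qed.

Lemma graft1 d ts (G : forest) :
  graft [:: Node d ts] G = [:: Node d (if ts is [::] then G else graft ts G)].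
Proof.
rewrite /=; congr [:: Node d _].
case: ts => [//|t ts]; elim: ts t => [//|u ts IH] t.
by rewrite IH.
Qed.

Lemma graft_cons t u (F G : forest) : graft (t :: u :: F) G = t :: graft (u :: F) G.
Proof. by []. Qed.

Lemma graft_cat (F G H : forest) : G != [::] -> graft (F ++ G) H = F ++ graft G H.
Proof.
elim: F => // t F IH nG; rewrite !cat_cons -IH //.
by case: F {IH} => [|u F] //; case: G nG.
Qed.

Lemma graft_nil_r (F : forest) : graft F [::] = F.
Proof.
elim/forest_ind: F => // d ts [|u F] IHt IHF; last by rewrite graft_cons IHF.
by rewrite graft1; case: ts IHt => // t ts ->.
Qed.

Lemma graft_neq0 (F G : forest) : (graft F G == [::]) = (F == [::]).
Proof. by case: F => // t [|u F]. Qed.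

Lemma graftA (F G H : forest) : G != [::] -> graft (graft F G) H = graft F (graft G H).
Proof.
move=> nG; elim/forest_ind: F => // d ts [|u F] IHt IHF.
  rewrite !graft1; congr [:: Node d _]; case: ts IHt => [_|t ts <-].
    by case: (G) nG.
  by case E: graft (graft_neq0 (t :: ts) G) => [|? ?] //.
rewrite !graft_cons -IHF.
by case E: (graft (u :: F) G) (graft_neq0 (u :: F) G) => [|? ?].
Qed.

(** The rightmost leaf lies in the last tree, hence the flag comes from the first factor only if
    nothing follows it, which b records. *)
Definition cut_prod (b : bool) (C1 C2 : seq (bool * (forest * forest))) :=
  [seq (if b then c1.1 else c2.1, (c1.2.1 ++ c2.2.1, c1.2.2 ++ c2.2.2))
     | c1 <- C1, c2 <- C2].

Definition cut_node d (c : bool * (forest * forest)) :=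
  (c.1, (c.2.1, [:: Node d c.2.2])).

Fixpoint tree_cut (t : tree) : seq (bool * (forest * forest)) :=
  let: Node d ts := t in
  (true, ([:: t], [::])) :: [seq cut_node d c | c <-
    (fix go ts := match ts with
     | [::] => [:: (false, ([::], [::]))]
     | t' :: ts' => cut_prod (nilp ts') (tree_cut t') (go ts')
     end) ts].

(* All admissible cuts c of F, including the empty and the total one, as
   (r_F \in Lea_c F, (Lea_c F, Roo_c F)). *)
Fixpoint forest_cut (F : forest) : seq (bool * (forest * forest)) :=
  if F is t :: F' then cut_prod (nilp F') (tree_cut t) (forest_cut F')
  else [:: (false, ([::], [::]))].

Lemma tree_cutE d ts : tree_cut (Node d ts) =
  (true, ([:: Node d ts], [::])) :: [seq cut_node d c | c <- forest_cut ts].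
Proof. by rewrite /=; congr cons; congr map; elim: ts => //= t ts ->. Qed.

(** Either the first root belongs to the cut and its whole tree goes up, or this root stays below
    and only its children are cut. *)
Lemma sum_forest_cut (V : nmodType) (H : bool -> forest -> forest -> V) d ts F :
  \sum_(c <- forest_cut (Node d ts :: F)) H c.1 c.2.1 c.2.2 =
  \sum_(c <- forest_cut F)
    (H (nilp F || c.1) (Node d ts :: c.2.1) c.2.2 +
     \sum_(a <- forest_cut ts)
       H (if nilp F then a.1 else c.1) (a.2.1 ++ c.2.1) (Node d a.2.2 :: c.2.2)).
Proof.
rewrite -[forest_cut _]/(cut_prod _ (tree_cut _) _) big_allpairs_dep exchange_big.
apply: eq_bigr => c _.
by rewrite tree_cutE big_cons big_map /=; case: nilp.
Qed.

Lemma sub_from_cons (X : pred (seq nat)) i d ts (F : forest) :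
  sub_from X i (Node d ts :: F) =
  (if X [:: i] then [:: Node d (sub_from (fun p => X (i :: p)) 0 ts)]
   else sub_from (fun p => X (i :: p)) 0 ts) ++ sub_from X i.+1 F.
Proof.
rewrite /=; case: (X [:: i]); congr cat; first congr (cons (Node d _) nil).
  by move: (0%N) => j; elim: ts j => //= t ts IH j; rewrite IH.
by move: (0%N) => j; elim: ts j => //= t ts IH j; rewrite IH.
Qed.

Lemma verts_from_cons i d ts (F : forest) :
  verts_from i (Node d ts :: F) =
  [:: i] :: map (cons i) (verts_from 0 ts) ++ verts_from i.+1 F.
Proof.
by [].
Qed.

Lemma eq_sub_from (X Y : pred (seq nat)) i (F : forest) :
  {in verts_from i F, X =1 Y} -> sub_from X i F = sub_from Y i F.
Proof.
elim/forest_ind: F X Y i => // d ts F IHt IHF X Y i.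
rewrite verts_from_cons => XY.
rewrite !sub_from_cons (IHt _ (fun p => Y (i :: p)) 0%N); last first.
  by move=> p pt; apply: XY; rewrite inE mem_cat map_f ?orbT.
rewrite XY ?inE ?eqxx // (IHF _ Y) // => p pF.
by apply: XY; rewrite inE mem_cat pF !orbT.
Qed.

Lemma verts_from_head i (F : forest) p : p \in verts_from i F -> exists2 j, (i <= j)%N & exists q, p = j :: q.
Proof.
elim/forest_ind: F i => // d ts F _ IHF i.
rewrite verts_from_cons inE mem_cat => /or3P[/eqP->|/mapP[q _ ->]|/IHF[j ij [q ->]]].
- by exists i => //; exists [::].
- by exists i => //; exists q.
by exists j; [exact: ltnW | exists q].
Qed.

Lemma uniq_verts_from i (F : forest) : uniq (verts_from i F).
Proof.
elim/forest_ind: F i => // d ts F IHt IHF i.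
rewrite verts_from_cons /= mem_cat negb_or cat_uniq map_inj_uniq ?IHt ?IHF; last by move=> ? ? [].
rewrite andbT /=; apply/andP; split.
  apply/andP; split.
    apply/negP => /mapP[q qt [q0]].
    by have [j _ [r]] := verts_from_head qt; rewrite -q0.
  by apply/negP => /verts_from_head[j ij [q [ji _]]]; rewrite ji ltnn in ij.
apply/hasPn => p /verts_from_head[j ij [q ->]].
by apply/negP => /mapP[r _ [ji _]]; rewrite ji ltnn in ij.
Qed.

Lemma sub_from_true i (F : forest) : sub_from xpredT i F = F.
Proof. by elim/forest_ind: F i => // d ts F IHt IHF i; rewrite sub_from_cons /= IHt IHF. Qed.

Lemma sub_from_false i (F : forest) : sub_from xpred0 i F = [::].
Proof. by elim/forest_ind: F i => // d ts F IHt IHF i; rewrite sub_from_cons /= IHt IHF. Qed.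

Definition rleaf_from i (F : forest) : seq nat :=
  if F is t :: F' then (i + size F')%N :: tree_rleaf (last t F') else [::].

Lemma rleaf_from_cons i d ts (F : forest) : rleaf_from i (Node d ts :: F) =
  if F is [::] then i :: rleaf_from 0 ts else rleaf_from i.+1 F.
Proof.
case: F => [|u F] /=; last by rewrite addSnnS.
rewrite addn0; congr cons; rewrite /rleaf_from.
case: ts => // t ts; rewrite add0n -[size ts]add0n; move: (0%N) => j.
elim: ts t j => [|u ts IH] t j; first by rewrite addn0.
by rewrite /= addnS -addSn -IH.
Qed.

Lemma rleaf_verts i (F : forest) : F != [::] -> rleaf_from i F \in verts_from i F.
Proof.
elim/forest_ind: F i => // d ts F IHt IHF i _.
rewrite rleaf_from_cons verts_from_cons inE mem_cat.
case: F IHF => [|u F] IHF; last by rewrite IHF ?orbT.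
by case: ts IHt => [|t ts] IHt; rewrite ?eqxx // map_f ?orbT ?IHt.
Qed.

Fixpoint subs (T : Type) (s : seq T) : seq (seq T) :=
  if s is x :: s' then map (cons x) (subs s') ++ subs s' else [:: [::]].

Lemma subs_map (T U : Type) (f : T -> U) s : subs (map f s) = map (map f) (subs s).
Proof. by elim: s => //= x s ->; rewrite map_cat -!map_comp. Qed.

Lemma sum_subs_cat (T : Type) (V : nmodType) (G : seq T -> V) s t :
  \sum_(a <- subs (s ++ t)) G a = \sum_(a <- subs s) \sum_(b <- subs t) G (a ++ b).
Proof.
elim: s G => [|x s IH] G /=; first by rewrite big_seq1.
by rewrite !big_cat !big_map !IH.
Qed.

Lemma mem_subs (T : eqType) (s a : seq T) : (a \in subs s) = subseq a s.
Proof.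
elim: s a => [|x s IH] a /=; first by rewrite inE; case: a.
rewrite mem_cat IH; case: a => [|y a] /=.
  by rewrite sub0seq orbT.
case: eqP => [->|nxy].
  rewrite mem_map ?IH; last by move=> ? ? [].
  apply/orP/idP => [[//|] sa|]; last by left.
  by apply: subseq_trans sa; exact: subseq_cons.
by case: mapP => // -[z _ [/nxy]].
Qed.

Lemma uniq_subs (T : eqType) (s : seq T) : uniq s -> uniq (subs s).
Proof.
elim: s => //= x s IH /andP[xs /IH us].
rewrite cat_uniq map_inj_uniq ?us ?andbT; last by move=> ? ? [].
apply/hasPn => a; rewrite mem_subs => /mem_subseq sa.
by apply/negP => /mapP[b _ ab]; move: xs; rewrite sa // ab inE eqxx.
Qed.

(** A set of elements corresponds to the sublist that it extracts; this is a bijection because s has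
    no repetition. *)
Lemma sum_set_subs (T : choiceType) (s : seq T) (V : nmodType) (G : seq T -> V) : uniq s ->
  \sum_(c : {set seq_sub s}) G [seq x <- s | x \in [seq val y | y in c]] =
  \sum_(a <- subs s) G a.
Proof.
move=> us; pose f (c : {set seq_sub s}) := [seq x <- s | x \in [seq val y | y in c]].
rewrite -[LHS](big_map f xpredT) /index_enum -enumT.
apply: perm_big; apply: uniq_perm; rewrite ?uniq_subs //.
  rewrite map_inj_in_uniq ?enum_uniq // => c c' _ _ cc; apply/setP => x.
  have inE' (d : {set seq_sub s}) : (x \in d) = (val x \in f d).
    rewrite mem_filter (valP x) andbT; apply/idP/mapP => [xd|[y]].
      by exists x; rewrite ?mem_enum.
    by rewrite mem_enum => yd /val_inj->.
  by rewrite !inE' cc.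
move=> a; rewrite mem_subs; apply/mapP/idP => [[c _ ->]|]; first exact: filter_subseq.
case/(subseq_uniqP us) => ->; pose c := [set x : seq_sub s | val x \in a].
exists c; rewrite ?mem_enum //; apply: eq_in_filter => x xs.
apply/idP/mapP => [xa|[y]]; last by rewrite mem_enum inE => ya ->.
by exists (SeqSub xs); rewrite // mem_enum inE.
Qed.

(** [antichain] and [below] are the counterparts of [admissible] and [lea_set] for lists of
    addresses; see [admissibleE] and [addresses_lea]. *)
Definition antichain (a : seq (seq nat)) : bool :=
  all (fun v => all (fun w => (v == w) || ~~ prefix w v) a) a.

Definition below (a : seq (seq nat)) (p : seq nat) : bool := has (fun v => prefix v p) a.

Lemma antichain_cat a b : {in a & b, forall v w, ~~ prefix v w && ~~ prefix w v} ->
  antichain (a ++ b) = antichain a && antichain b.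
Proof.
move=> ab; rewrite /antichain all_cat; congr andb; apply: eq_in_all => v va;
  rewrite all_cat; [rewrite [X in _ && X](_ : _ = true) ?andbT | rewrite [X in X && _](_ : _ = true)] => //.
  by apply/allP => w /(ab _ _ va)/andP[_ ->]; rewrite orbT.
by apply/allP => w wa; have /andP[-> _] := ab _ _ wa va; rewrite orbT.
Qed.

Lemma antichain_map i a : antichain (map (cons i) a) = antichain a.
Proof.
rewrite /antichain all_map; apply: eq_all => v /=; rewrite all_map.
by apply: eq_all => w /=; rewrite eqseq_cons eqxx.
Qed.

(** All other vertices of a tree lie above its root, so an antichain containing the root contains
    none of them. *)
Lemma antichain_cons i a b : all (fun v => v != [::]) a ->
  antichain ([:: i] :: map (cons i) a ++ b) = nilp a && antichain ([:: i] :: b).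
Proof.
case: a => [|v a] //= /andP[vn _]; apply/negbTE/allPn; exists (i :: v).
  by rewrite !inE eqxx orbT.
apply/allPn; exists [:: i]; first by rewrite inE eqxx.
by rewrite eqseq_cons eqxx (negPf vn) /= eqxx prefix0s.
Qed.

Lemma below_cat a b p : below (a ++ b) p = below a p || below b p.
Proof. exact: has_cat. Qed.

Lemma below_map i a j p : below (map (cons i) a) (j :: p) = (i == j) && below a p.
Proof. by elim: a => [|v a IH] /=; [rewrite andbF | rewrite IH andb_orr]. Qed.

Lemma sum_subs_nil (T : Type) (s : seq T) (V : nmodType) (x : V) :
  \sum_(a <- subs s | nilp a) x = x.
Proof.
elim: s => [|y s IH] /=; first by rewrite big_cons big_nil addr0.
by rewrite big_cat big_map /= big_pred0_eq add0r IH.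
Qed.

Lemma sum_subs_node (V : nmodType) (G : seq (seq nat) -> V) i s t :
  \sum_(a <- subs ([:: i] :: map (cons i) s ++ t)) G a =
  \sum_(b <- subs t) \sum_(a <- subs s)
     (G ([:: i] :: map (cons i) a ++ b) + G (map (cons i) a ++ b)).
Proof.
rewrite [subs _]/= big_cat big_map !sum_subs_cat subs_map !big_map /= -big_split.
by rewrite [RHS]exchange_big; apply: eq_bigr => a _; rewrite big_split.
Qed.

Lemma below_outside i b p : {subset b <= [pred v | head 0%N v > i]%N} ->
  below b (i :: p) = false.
Proof.
move=> bi; apply/negbTE/hasPn => v /bi; rewrite inE.
by case: v => [//|j v] /= ij; rewrite (gtn_eqF ij).
Qed.

(** This identifies the recursive list [forest_cut] with the admissible cuts. By [sum_subs_node], a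
    set of vertices of [Node d ts :: F] consists of a part b of F, a part a of ts and possibly the
    first root. The numbering starts at i because F sits at the roots from i + 1 on. *)
Lemma sum_antichains (V : nmodType) (H : bool -> forest -> forest -> V) i F :
  \sum_(a <- subs (verts_from i F) | antichain a)
     H (below a (rleaf_from i F)) (sub_from (below a) i F)
       (sub_from (predC (below a)) i F) =
  \sum_(c <- forest_cut F) H c.1 c.2.1 c.2.2.
Proof.
elim/forest_ind: F H i => [|d ts F IHt IHF] H i.
  by rewrite /= big_cons big_nil addr0 big_seq1.
rewrite sum_forest_cut -(IHF (fun b l r => H (nilp F || b) (Node d ts :: l) r +
  \sum_(a <- forest_cut ts)
     H (if nilp F then a.1 else b) (a.2.1 ++ l) (Node d a.2.2 :: r)) i.+1).
pose G a := if antichain a then H (below a (rleaf_from i (Node d ts :: F)))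
     (sub_from (below a) i (Node d ts :: F))
     (sub_from (predC (below a)) i (Node d ts :: F)) else 0.
transitivity (\sum_(a <- subs (verts_from i (Node d ts :: F))) G a).
  exact: big_mkcond.
rewrite verts_from_cons (sum_subs_node G) [RHS]big_mkcond /=; apply: eq_big_seq => b.
rewrite mem_subs => /mem_subseq bF.
have bi : {subset b <= [pred v | head 0%N v > i]%N}.
  by move=> v /bF/verts_from_head[j ij [q ->]].
have bj : {in verts_from i.+1 F, forall p, exists2 j, (i == j) = false & exists q, p = j :: q}.
  by move=> q /verts_from_head[j ij jq]; exists j; rewrite ?(ltn_eqF ij).
have rF : nilp F = false -> rleaf_from i.+1 F \in verts_from i.+1 F.
  by move=> nF; apply: rleaf_verts; case: (F) nF.
have outF a : {in verts_from i.+1 F, below (map (cons i) a ++ b) =1 below b}.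
  by move=> p /bj[j ij [q ->]]; rewrite below_cat below_map ij.
have outF1 a : {in verts_from i.+1 F, below ([:: i] :: map (cons i) a ++ b) =1 below b}.
  by move=> p pF; rewrite -(outF a p pF); have [j ij [q ->]] := bj p pF; rewrite /= ij.
have inF a p : below (map (cons i) a ++ b) (i :: p) = below a p.
  by rewrite below_cat below_map eqxx (below_outside _ bi) orbF.
have inF1 a p : below ([:: i] :: map (cons i) a ++ b) (i :: p) by rewrite /= eqxx prefix0s.
have anti_ib a : {in map (cons i) a & b, forall v w, ~~ prefix v w && ~~ prefix w v}.
  move=> v w /mapP[u _ ->] /bi; rewrite inE.
  by case: w => //= j w ij; rewrite (ltn_eqF ij) (gtn_eqF ij).
rewrite big_split /=.
(* With the first root in the cut, only the empty a gives an antichain, and the whole tree goes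
   up. *)
have -> : \sum_(a <- subs (verts_from 0 ts)) G ([:: i] :: map (cons i) a ++ b) =
    if antichain b then H (nilp F || below b (rleaf_from i.+1 F))
      (Node d ts :: sub_from (below b) i.+1 F) (sub_from (predC (below b)) i.+1 F) else 0.
  rewrite -[RHS](sum_subs_nil (verts_from 0 ts)) [RHS]big_mkcond.
  apply: eq_big_seq => a; rewrite mem_subs => /mem_subseq aT.
  have an : all (fun v => v != [::]) a.
    by apply/allP => v /aT/verts_from_head[j _ [q ->]].
  rewrite /G antichain_cons // (antichain_cat (a := [:: [:: i]])); last first.
    exact: (anti_ib [:: [::]]).
  have -> : antichain [:: [:: i]] by rewrite /antichain /= eqxx.
  rewrite andTb; case: (nilp a); rewrite ?andTb //; case: (antichain b) => //.
  rewrite !sub_from_cons rleaf_from_cons; set X := below _.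
  have X1 p : X (i :: p) by exact: inF1.
  rewrite /= !X1 /=.
  congr (H _ _ _).
  - case: (F) rF outF1 => [|t F'] rF outF1; first exact: inF1.
    by rewrite /X outF1 ?rF.
  - congr (Node d _ :: _); last exact: eq_sub_from (outF1 a).
    by rewrite -[RHS](sub_from_true 0); apply: eq_sub_from => p _; exact: X1.
  rewrite -[RHS]cat0s; congr (_ ++ _).
    by rewrite -[RHS](sub_from_false 0 ts); apply: eq_sub_from => p _ /=; rewrite X1.
  by apply: eq_sub_from => p /(outF1 a) /= pb; congr negb; exact: pb.
(* Without the first root, a and b are independent antichains and the root stays below. *)
have -> : \sum_(a <- subs (verts_from 0 ts)) G (map (cons i) a ++ b) =
    if antichain b then \sum_(a <- forest_cut ts)
     H (if nilp F then a.1 else below b (rleaf_from i.+1 F))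
       (a.2.1 ++ sub_from (below b) i.+1 F)
       (Node d a.2.2 :: sub_from (predC (below b)) i.+1 F) else 0.
  case: ifP => ab; last first.
    by rewrite big1 // => a _; rewrite /G antichain_cat ?ab ?andbF.
  rewrite -(IHt (fun x l r => H (if nilp F then x else below b (rleaf_from i.+1 F))
    (l ++ sub_from (below b) i.+1 F)
    (Node d r :: sub_from (predC (below b)) i.+1 F)) 0%N) [RHS]big_mkcond.
  apply: eq_big_seq => a; rewrite mem_subs => /mem_subseq aT.
  rewrite /G antichain_cat // ab andbT antichain_map; case: ifP => // _.
  have a0 : below a [::] = false.
    by apply/negbTE/hasPn => v /aT/verts_from_head[j _ [q ->]].
  rewrite !sub_from_cons rleaf_from_cons /= !inF a0 /=.
  congr (H _ _ _).
  - case: (F) rF outF => [|t F'] rF outF; first exact: inF.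
    by rewrite outF ?rF.
  - congr (_ ++ _); last exact: eq_sub_from (outF a).
    by apply: eq_sub_from => p _; exact: inF.
  congr (Node d _ :: _).
    by apply: eq_sub_from => p _ /=; rewrite inF.
  by apply: eq_sub_from => p /(outF a) /= pb; congr negb; exact: pb.
by case: (antichain b); rewrite ?addr0.
Qed.

(** * From sets of vertices to lists of addresses *)

Section Bridge.
Variables (F : forest) (c : {set V F}).
Let a := [seq x <- verts F | x \in addresses c].

Lemma mem_addresses (X : {set V F}) (x : V F) : (val x \in addresses X) = (x \in X).
Proof. by rewrite mem_map ?mem_enum //; exact: val_inj. Qed.

Lemma addresses_verts (X : {set V F}) p : p \in addresses X -> p \in verts F.
Proof. by case/mapP => x _ ->; exact: valP. Qed.

Lemma mem_a p : (p \in a) = (p \in addresses c).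
Proof. by rewrite mem_filter andb_idr //; exact: addresses_verts. Qed.

Lemma addresses_lea p : p \in verts F -> (p \in addresses (lea_set c)) = below a p.
Proof.
move=> pF; rewrite -[p]/(val (SeqSub pF)) mem_addresses inE.
apply/exists_inP/hasP => [[v vc pv]|[v]].
  by exists (val v); rewrite ?mem_a ?mem_addresses.
by rewrite mem_a => /mapP[x]; rewrite mem_enum => xc -> px; exists x.
Qed.

Lemma addresses_roo p : p \in verts F -> (p \in addresses (roo_set c)) = ~~ below a p.
Proof.
move=> pF; rewrite -addresses_lea // -[p]/(val (SeqSub pF)) !mem_addresses.
exact: in_setC.
Qed.

Lemma LeaE : Lea c = sub_from (below a) 0 F.
Proof. by apply: eq_sub_from => p; exact: addresses_lea. Qed.

Lemma RooE : Roo c = sub_from (predC (below a)) 0 F.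
Proof. by apply: eq_sub_from => p; exact: addresses_roo. Qed.

Lemma admissibleE : admissible c = antichain a.
Proof.
apply/forall_inP/allP => [H v|H v vc].
  rewrite mem_a => /mapP[x]; rewrite mem_enum => xc ->.
  apply/allP => w; rewrite mem_a => /mapP[y]; rewrite mem_enum => yc ->.
  have /forall_inP/(_ y yc)/implyP := H x xc; rewrite -val_eqE /=.
  by case: eqP => //= _; apply.
apply/forall_inP => w wc; apply/implyP => vw.
have va : val v \in a by rewrite mem_a mem_addresses.
have wa : val w \in a by rewrite mem_a mem_addresses.
by have /allP/(_ _ wa) := H _ va; rewrite val_eqE (negPf vw).
Qed.

End Bridge.

Variable K : fieldType.
Variable deg : D -> nat.

(** The improper cuts can be added to the sum because H vanishes as soon as one component is
    empty. *)
Lemma hp_sum (H : bool -> forest -> forest -> {malg K[(bas (Hp deg K) * bas (Hp deg K))%type]})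
    (F : forest) : F != [::] -> (forall b l, H b l [::] = 0) -> (forall b r, H b [::] r = 0) ->
  \sum_(c : {set V F} | proper_cut c)
    H (rleaf F \in addresses (lea_set c)) (Lea c) (Roo c) =
  \sum_(c <- forest_cut F) H c.1 c.2.1 c.2.2.
Proof.
move=> nF Hr Hl; rewrite -(sum_antichains _ 0) big_mkcond.
pose G a := if antichain a then H (below a (rleaf_from 0 F))
  (sub_from (below a) 0 F) (sub_from (predC (below a)) 0 F) else 0.
rewrite [RHS]big_mkcond -[RHS](sum_set_subs G) ?uniq_verts_from //.
apply: eq_bigr => c _; rewrite /proper_cut admissibleE /G LeaE RooE.
rewrite (addresses_lea _ (rleaf_verts 0 nF)); case: antichain => //=.
case: eqP => [->|_] /=; first by rewrite Hl.
by case: eqP => [->|_] /=; rewrite ?Hr.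
Qed.

End Forests.

(** Indicator functions, as test functions with values in [nat], recover the multiplicities. *)
Lemma perm_of_sums (T : eqType) (s t : seq T) :
  (forall H : T -> nat, \sum_(x <- s) H x = \sum_(x <- t) H x) -> perm_eq s t.
Proof.
move=> st; apply/seq.permP => a; have := st (fun x => nat_of_bool (a x)).
suff sE (u : seq T) : \sum_(x <- u) nat_of_bool (a x) = count a u by rewrite !sE.
by elim: u => [|x u IH]; rewrite ?big_nil ?big_cons //= IH.
Qed.

(** * Cuts of products of forests, and coassociativity *)

Section Forests.
Variable D : choiceType.
Notation tree := (ptree D).
Notation forest := (seq (ptree D)).

(** Only the empty cut has an empty upper part; it occurs once, with flag [false]. Stated with a
    test function, this can be substituted inside other sums. *)
Lemma sum_cut_l0 (V : nmodType) (H : bool -> forest -> V) F :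
  \sum_(c <- forest_cut F) (if nilp c.2.1 then H c.1 c.2.2 else 0) = H false F.
Proof.
elim/forest_ind: F H => [|d ts F IHt IHF] H; first by rewrite /= big_seq1.
rewrite (sum_forest_cut (fun b l r => if nilp l then H b r else 0)).
transitivity (\sum_(c <- forest_cut F)
  (if nilp c.2.1 then H (if nilp F then false else c.1) (Node d ts :: c.2.2) else 0)).
  apply: eq_bigr => c _; rewrite add0r; case: (c.2.1) => [|u l].
    under eq_bigr do rewrite cats0.
    by rewrite (IHt (fun b r => H (if nilp F then b else c.1) (Node d r :: c.2.2))).
  by rewrite big1 // => a _; case: (a.2.1).
rewrite (IHF (fun b r => H (if nilp F then false else b) (Node d ts :: r))).
by case: nilp.
Qed.

(** Only the total cut has an empty lower part. Its flag is [true], except for the empty forest,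
    whose unique cut has flag [false] by convention. *)
Lemma sum_cut_r0 (V : nmodType) (H : bool -> forest -> V) F :
  \sum_(c <- forest_cut F) (if nilp c.2.2 then H c.1 c.2.1 else 0) = H (~~ nilp F) F.
Proof.
elim/forest_ind: F H => [|d ts F IHt IHF] H; first by rewrite /= big_seq1.
rewrite (sum_forest_cut (fun b l r => if nilp r then H b l else 0)).
transitivity (\sum_(c <- forest_cut F)
  (if nilp c.2.2 then H (nilp F || c.1) (Node d ts :: c.2.1) else 0)).
  by apply: eq_bigr => c _; rewrite big1 ?addr0.
rewrite (IHF (fun b l => H (nilp F || b) (Node d ts :: l))).
by rewrite orbN.
Qed.

Lemma forest_cut_l0 (F : forest) c : c \in forest_cut F -> c.2.1 = [::] -> c.1 = false.
Proof.
move=> cF l0; have := sum_cut_l0 (fun b _ => nat_of_bool b) F.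
move/eqP; rewrite sum_nat_seq_eq0 => /allP/(_ _ cF).
by rewrite l0 /=; case: c.1.
Qed.

Lemma forest_cut_r0 (F : forest) c : F != [::] -> c \in forest_cut F -> c.2.2 = [::] -> c.1.
Proof.
move=> nF cF r0; have := sum_cut_r0 (fun b _ => nat_of_bool (~~ b)) F.
have -> : nilp F = false by case: (F) nF.
move/eqP; rewrite sum_nat_seq_eq0 => /allP/(_ _ cF).
by rewrite r0 /=; case: c.1.
Qed.

Lemma sum_cut_proper (V : nmodType) (H : bool -> forest -> forest -> V) F : F != [::] ->
  \sum_(c <- forest_cut F) H c.1 c.2.1 c.2.2 =
  H true F [::] + (H false [::] F +
  \sum_(c <- forest_cut F | @proper (seq (ptree D)) [::] c) H c.1 c.2.1 c.2.2).
Proof.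
move=> nF; have nnF : nilp F = false by case: (F) nF.
rewrite -[X in X + _](_ : (fun b l => if nilp l then 0 else H b l [::]) (~~ nilp F) F = _);
  last by rewrite nnF.
rewrite -(sum_cut_r0 (fun b l => if nilp l then 0 else H b l [::])).
rewrite -[H false _ _](sum_cut_l0 (fun b r => H b [::] r)) [X in _ = _ + (_ + X)]big_mkcond.
rewrite -!big_split /=; apply: eq_bigr => -[b [l r]] _; rewrite /proper /=.
by case: l => [|? ?]; case: r => [|? ?]; rewrite /= ?add0r ?addr0.
Qed.

Lemma sum_cut_cat (V : nmodType) (H : bool -> forest -> forest -> V) F G :
  \sum_(c <- forest_cut (F ++ G)) H c.1 c.2.1 c.2.2 =
  \sum_(c <- forest_cut F) \sum_(d <- forest_cut G)
    H (if nilp G then c.1 else d.1) (c.2.1 ++ d.2.1) (c.2.2 ++ d.2.2).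
Proof.
elim/forest_ind: F H => [|d ts F IHt IHF] H.
  rewrite /= big_seq1; apply: eq_big_seq => c; case: G => [|t G] //.
  by rewrite inE => /eqP->.
rewrite cat_cons sum_forest_cut (IHF (fun b l r => H (nilp (F ++ G) || b) (Node d ts :: l) r +
  \sum_(a <- forest_cut ts)
     H (if nilp (F ++ G) then a.1 else b) (a.2.1 ++ l) (Node d a.2.2 :: r))).
rewrite (sum_forest_cut (fun b l r => \sum_(d0 <- forest_cut G)
    H (if nilp G then b else d0.1) (l ++ d0.2.1) (r ++ d0.2.2))).
apply: eq_bigr => c _; rewrite [X in _ = _ + X]exchange_big -big_split /=.
have -> : nilp (F ++ G) = nilp F && nilp G by case: (F).
apply: eq_big_seq => e eG; congr (_ + _).
  by case: (nilp G); rewrite ?andbT ?andbF ?orbT.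
by apply: eq_bigr => a _; rewrite catA; case: (nilp F); case: (nilp G).
Qed.

Lemma sum_cut1 (V : nmodType) (H : bool -> forest -> forest -> V) d ts :
  \sum_(c <- forest_cut [:: Node d ts]) H c.1 c.2.1 c.2.2 =
  H true [:: Node d ts] [::] +
  \sum_(a <- forest_cut ts) H a.1 a.2.1 [:: Node d a.2.2].
Proof.
rewrite sum_forest_cut /= big_seq1 /=; congr (_ + _).
by apply: eq_bigr => a _; rewrite cats0.
Qed.

(** If r_F goes up, the grafted G follows it uncut. Otherwise G is cut freely, its lower part
    remains attached to r_F, and its own rightmost leaf provides the flag. *)
Lemma sum_cut_graft (V : nmodType) (H : bool -> forest -> forest -> V) F G :
  F != [::] -> G != [::] ->
  \sum_(c <- forest_cut (graft F G)) H c.1 c.2.1 c.2.2 =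
  \sum_(c <- forest_cut F)
    (if c.1 then H true (graft c.2.1 G) c.2.2 else
     \sum_(d <- forest_cut G) H d.1 (c.2.1 ++ d.2.1) (graft c.2.2 d.2.2)).
Proof.
move=> + nG; elim/forest_ind: F H => // d ts F IHt IHF H _.
set KK := fun b l r => if b then H true (graft l G) r else
     \sum_(d <- forest_cut G) H d.1 (l ++ d.2.1) (graft r d.2.2).
have rn (E : forest) c : E != [::] -> c \in forest_cut E -> ~~ c.1 -> c.2.2 != [::].
  by move=> nE cE; apply: contraNneq; exact: forest_cut_r0 nE cE.
have ln (E : forest) c : c \in forest_cut E -> c.1 -> c.2.1 != [::].
  by move=> cE; apply: contraTneq => /(forest_cut_l0 cE)->.
case: F IHF => [|u F] IHF.
  rewrite graft1 sum_cut1 (sum_cut1 KK) /KK graft1; congr (_ + _).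
  case: ts IHt => [_|t ts /(_ (fun b l r => H b l [:: Node d r]) isT)->].
    by rewrite /= big_seq1.
  apply: eq_big_seq => c cF; case: ifPn => c1 //.
  apply: eq_bigr => e _; rewrite graft1.
  by have := rn (t :: ts) c isT cF c1; case: (c.2.2).
rewrite (sum_forest_cut KK).
rewrite graft_cons sum_forest_cut.
have -> : nilp (graft (u :: F) G) = false.
  by have := graft_neq0 (u :: F) G; case: graft.
rewrite (IHF (fun b l r => H (false || b) (Node d ts :: l) r +
  \sum_(a <- forest_cut ts) H b (a.2.1 ++ l) (Node d a.2.2 :: r))) //.
apply: eq_big_seq => c cF; rewrite /KK /=; case: ifPn => c1.
  have := ln _ _ cF c1; case E: (c.2.1) => [|x l] // _.
  congr (_ + _); apply: eq_bigr => a _; by rewrite graft_cat.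
rewrite big_split exchange_big /=; congr (_ + _).
have := rn (u :: F) c isT cF c1; case E: (c.2.2) => [|x r] // _.
by apply: eq_bigr => a _; apply: eq_bigr => e _; rewrite catA.
Qed.

(** Both sides enumerate the ways of slicing F into an upper, a middle and a lower forest; the index
    0, 1 or 2 tells which slice contains the rightmost leaf. *)
Lemma sum_cut_coassoc (V : nmodType) (H : nat -> forest -> forest -> forest -> V) F :
  \sum_(c <- forest_cut F) \sum_(e <- forest_cut c.2.1)
     H (if c.1 then (if e.1 then 0 else 1) else 2)%N e.2.1 e.2.2 c.2.2 =
  \sum_(c <- forest_cut F) \sum_(e <- forest_cut c.2.2)
     H (if c.1 then 0 else (if e.1 then 1 else 2))%N c.2.1 e.2.1 e.2.2.
Proof.
elim/forest_ind: F H => [|d ts F IHt IHF] H; first by rewrite /= !big_seq1 /= ?big_seq1.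
pose HL b l r := \sum_(e <- forest_cut l)
  H (if b then (if e.1 then 0 else 1) else 2)%N e.2.1 e.2.2 r.
pose HR b l r := \sum_(e <- forest_cut r)
     H (if b then 0 else (if e.1 then 1 else 2))%N l e.2.1 e.2.2.
(* For F empty the rightmost leaf lies in the first tree, whose children then determine the index;
   otherwise F alone determines it. *)
have [->|nF] := eqVneq F [::].
  rewrite (sum_cut1 HL) (sum_cut1 HR) /HL /HR.
  rewrite (sum_cut1 (fun b l r => H (if b then 0 else 1)%N l r [::])) [X in _ = X + _]big_seq1 -addrA.
  congr (_ + _).
  transitivity (\sum_(a <- forest_cut ts)
    (H (if a.1 then 0 else 1)%N a.2.1 [:: Node d a.2.2] [::] +
     \sum_(e <- forest_cut a.2.2)
       H (if a.1 then 0 else (if e.1 then 1 else 2))%N a.2.1 e.2.1 [:: Node d e.2.2])).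
    by rewrite big_split -(IHt (fun i l m r => H i l m [:: Node d r])).
  apply: eq_bigr => a _.
  by rewrite (sum_cut1 (fun b l r => H (if a.1 then 0 else if b then 1 else 2)%N _ l r)).
rewrite (sum_forest_cut HL) (sum_forest_cut HR) /HL /HR.
have nnF : nilp F = false by case: (F) nF.
rewrite nnF /=.
(* The first root is in the upper, middle or lower slice. In the first case its whole tree is there,
   in the second its children are cut once, in the third twice. *)
pose T1 i l m r := H i (Node d ts :: l) m r.
pose T2 i l m r := \sum_(a <- forest_cut ts) H i (a.2.1 ++ l) (Node d a.2.2 :: m) r.
pose T3 i l m r := \sum_(a <- forest_cut ts) \sum_(x <- forest_cut a.2.1)
  H i (x.2.1 ++ l) (x.2.2 ++ m) (Node d a.2.2 :: r).
have T3E i l m r : T3 i l m r = \sum_(a <- forest_cut ts) \sum_(x <- forest_cut a.2.2)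
    H i (a.2.1 ++ l) (x.2.1 ++ m) (Node d x.2.2 :: r).
  exact: (IHt (fun _ l' m' r' => H i (l' ++ l) (m' ++ m) (Node d r' :: r))).
have := IHF (fun i l m r => T1 i l m r + T2 i l m r + T3 i l m r).
move=> E; apply: etrans (etrans _ E) _; apply: eq_big_seq => c cF.
  rewrite (sum_forest_cut (fun b l m => H (if c.1 then if b then 0 else 1 else 2)%N l m _)).
  rewrite [RHS]big_split /=; congr (_ + _).
    apply: eq_bigr => e _; rewrite /T1 /T2.
    have -> : (if c.1 then if nilp c.2.1 || e.1 then 0 else 1 else 2)%N =
              (if c.1 then if e.1 then 0 else 1 else 2)%N.
      case: nilP => //= l0; by rewrite (forest_cut_l0 cF l0).
    congr (_ + _); apply: eq_bigr => a _.
    by case: nilP => //= l0; rewrite (forest_cut_l0 cF l0).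
  rewrite /T3 [RHS]exchange_big; apply: eq_bigr => a _.
  rewrite (sum_cut_cat (fun b l m => H (if c.1 then if b then 0 else 1 else 2)%N l m _)).
  rewrite exchange_big; apply: eq_bigr => e _; apply: eq_bigr => x _.
  by case: nilP => //= l0; rewrite (forest_cut_l0 cF l0).
transitivity (\sum_(e <- forest_cut c.2.2)
   (T1 (if c.1 then 0 else if e.1 then 1 else 2)%N c.2.1 e.2.1 e.2.2 +
   \sum_(a <- forest_cut ts)
     (H (if c.1 then 0 else if e.1 then 1 else 2)%N (a.2.1 ++ c.2.1)
        (Node d a.2.2 :: e.2.1) e.2.2 + 
      \sum_(x <- forest_cut a.2.2)
        H (if c.1 then 0 else if e.1 then 1 else 2)%N (a.2.1 ++ c.2.1)
          (x.2.1 ++ e.2.1) (Node d x.2.2 :: e.2.2)))).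
  apply: eq_bigr => e _; rewrite -addrA; congr (_ + _).
  by rewrite T3E big_split.
rewrite big_split /=; congr (_ + _); rewrite exchange_big; apply: eq_bigr => a _.
rewrite (sum_forest_cut (fun b l r => H (if c.1 then 0 else if b then 1 else 2)%N _ l r)).
apply: eq_bigr => e _.
have h x y : (if c.1 then 0 else if (if nilp c.2.2 then x else y) then 1 else 2)%N =
    (if c.1 then 0 else if y then 1 else 2)%N.
  by case: nilP => //= r0; rewrite (forest_cut_r0 nF cF r0).
congr (_ + _); last by apply: eq_bigr => x _; rewrite h.
by congr (H _ _ _ _); exact: esym (h true _).
Qed.

Variables (deg : D -> nat) (K : fieldType).
Let A := Hp deg K.

Lemma forest_deg_cat F G : forest_deg deg (F ++ G) = (forest_deg deg F + forest_deg deg G)%N.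
Proof. by rewrite /forest_deg map_cat sumn_cat. Qed.

Lemma forest_deg_cons d ts F :
  forest_deg deg (Node d ts :: F) = (deg d + forest_deg deg ts + forest_deg deg F)%N.
Proof. by []. Qed.

Lemma forest_deg_graft F G : F != [::] ->
  forest_deg deg (graft F G) = (forest_deg deg F + forest_deg deg G)%N.
Proof.
elim/forest_ind: F => // d ts [|u F] IHt IHF _.
  rewrite graft1 !forest_deg_cons -!addnA add0n [(_ + forest_deg deg [::])%N]addn0.
  by congr addn; case: ts IHt => [|t ts] // ->.
by rewrite graft_cons -cat1s forest_deg_cat IHF // addnA -forest_deg_cat.
Qed.

Lemma forest_deg_cut F :
  {in forest_cut F, forall c, forest_deg deg c.2.1 + forest_deg deg c.2.2 = forest_deg deg F}%N.
Proof.
elim/forest_ind: F => [|d ts F IHt IHF] c; first by rewrite inE => /eqP->.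
case/allpairsP => -[c1 c2] [c1t /IHF cE ->] /=; rewrite !forest_deg_cat forest_deg_cons.
have {}c1t : c1 \in tree_cut (Node d ts) := c1t.
rewrite -cE addnACA; congr addn; move: c1t; rewrite tree_cutE inE.
case/orP => [/eqP-> /=|/mapP[a /IHt aE ->] /=]; rewrite forest_deg_cons ?addn0 //.
by rewrite -aE addnCA.
Qed.

Let vF := vec K (@hp_basis D).

Lemma vecE (F : forest) (nF : hp_basis F) : vF F = << exist _ F nF >>.
Proof. by rewrite /vF /vec insubT /=; congr mkmalgU; apply: val_inj. Qed.

Lemma vec_val (b : bas A) : vF (val b) = << b >>.
Proof. by rewrite /vF /vec valK. Qed.

Lemma vec_nil : vF [::] = 0.
Proof. by rewrite /vF /vec insubF. Qed.

(** Products of forests are forests, hence the one-element lists; the empty forest serves as the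
    empty index. *)
Lemma Hp_presentation : @presentation K A (seq (ptree D)) [::] predT val vF
  (fun s t => [:: s ++ t]) (fun s t => [:: graft s t]) (@forest_cut D) (forest_deg deg).
Proof.
split => //.
- exact: vec_val.
- exact: vec_nil.
- by move=> s _ ns; exists (exist _ s ns).
- by move=> b c; rewrite big_seq1.
- by move=> b c; rewrite big_seq1.
- move=> b; pose H (x : bool) l r := if x then tens (vF l) (vF r) else 0 : space2 A.
  rewrite [RHS]big_mkcond -(hp_sum (H := H)).
  + by rewrite -big_mkcondr.
  + exact: (valP b).
  + by move=> x l; rewrite /H vec_nil tens0r if_same.
  + by move=> x l; rewrite /H vec_nil tens0l if_same.
- move=> b; pose H (x : bool) l r := if ~~ x then tens (vF l) (vF r) else 0 : space2 A.
  rewrite [RHS]big_mkcond -(hp_sum (H := H)).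
  + rewrite -big_mkcondr; apply: eq_bigl => c; congr andb.
    have vb : val b != [::] by exact: (valP b).
    by rewrite (addresses_roo _ (rleaf_verts 0 vb)) (addresses_lea _ (rleaf_verts 0 vb)).
  + exact: (valP b).
  + by move=> x l; rewrite /H vec_nil tens0r if_same.
  + by move=> x l; rewrite /H vec_nil tens0l if_same.
- by move=> [|t s] u _ _ // _ _ w; rewrite inE => /eqP->.
- by move=> s t _ _ ns _ w; rewrite inE => /eqP->; rewrite /= graft_neq0.
- by move=> s _; rewrite cats0.
- by move=> s _; rewrite graft_nil_r.
- move=> s _ ns; apply: perm_of_sums => H.
  have := sum_cut_proper (fun b l r => H (b, (l, r))) ns.
  rewrite (eq_bigr H) => [->|[b [l r]] //].
  rewrite !big_cons big_filter; congr (_ + (_ + _)).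
  by apply: eq_bigr => -[b [l r]].
- move=> V H s t _ _ ns nt; rewrite big_seq1 sum_cut_cat.
  apply: eq_bigr => c _; apply: eq_bigr => d _; rewrite !big_seq1.
  by case: (t) nt.
- move=> V H s t _ _ ns nt; rewrite big_seq1 sum_cut_graft //.
  rewrite [RHS]addrC (bigID (fun c => ~~ c.1)) /=; congr (_ + _).
    apply: eq_bigr => c; case: ifP => // _ _; apply: eq_bigr => d _.
    by rewrite !big_seq1.
  rewrite (eq_bigl (fun c => c.1)) => [|c]; last by rewrite negbK.
  by apply: eq_bigr => c ->; rewrite big_seq1.
- by move=> c; rewrite inE => /eqP->.
- by move=> V H s _ _; exact: sum_cut_coassoc.
- by move=> V F s t u _ _ _ _ _ _; rewrite !big_seq1 catA.
- by move=> V F s t u _ _ _ _ nt _; rewrite !big_seq1 graftA.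
- by move=> V F s t u _ _ _ _ nt _; rewrite !big_seq1 graft_cat.
- by move=> s t _ _ _ _ w; rewrite inE => /eqP->; rewrite forest_deg_cat.
- by move=> s t _ _ ns _ w; rewrite inE => /eqP->; rewrite forest_deg_graft.
by move=> s _; exact: forest_deg_cut.
Qed.

Theorem Hp_bialgebra : graded_DupDend_bialgebra (Hp deg K).
Proof. exact: presentation_bialgebra Hp_presentation. Qed.

End Forests.

(** * The decomposition of a forest at its rightmost leaf *)

Section Forests.
Variable D : choiceType.
Notation tree := (ptree D).
Notation forest := (seq (ptree D)).

Definition leaf (d : D) : tree := Node d [::].

(** Makes the empty forest a left unit of [graft], so that F = R nw (L r) also covers the case where
    r is a root. *)
Definition graft0 (F G : forest) : forest := if nilp F then G else graft F G.

(** [del F] is F without its rightmost leaf and [rt F] is this leaf alone: together they are the cut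
    of F at its rightmost leaf. *)
Fixpoint tree_del (t : tree) : forest :=
  let: Node d ts := t in
  if nilp ts then [::] else
  [:: Node d ((fix go ts := match ts with
    | [::] => [::]
    | [:: t'] => tree_del t'
    | t' :: ts' => t' :: go ts'
    end) ts)].

Fixpoint del (F : forest) : forest :=
  match F with
  | [::] => [::]
  | [:: t] => tree_del t
  | t :: F' => t :: del F'
  end.

Fixpoint tree_rt (t : tree) : forest :=
  let: Node d ts := t in
  if nilp ts then [:: leaf d] else
  (fix go ts := match ts with
    | [::] => [::]
    | [:: t'] => tree_rt t'
    | t' :: ts' => go ts'
    end) ts.

Fixpoint rt (F : forest) : forest :=
  match F with
  | [::] => [::]
  | [:: t] => tree_rt t
  | t :: F' => rt F'
  end.

Definition is_leaf (t : tree) : bool := if t is Node _ [::] then true else false.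

Definition single (F : forest) : bool := if F is [:: t] then is_leaf t else false.

Lemma del1 d ts : del [:: Node d ts] = if nilp ts then [::] else [:: Node d (del ts)].
Proof. by []. Qed.

Lemma rt1 d ts : rt [:: Node d ts] = if nilp ts then [:: leaf d] else rt ts.
Proof. by []. Qed.

Lemma graft0_graft F G : F != [::] -> graft0 F G = graft F G.
Proof. by case: F. Qed.

Lemma graft0_nil F : graft0 F [::] = F.
Proof. by rewrite /graft0; case: nilP => [->//|_]; exact: graft_nil_r. Qed.

Lemma graft0_eq0 F G : (graft0 F G == [::]) = (F == [::]) && (G == [::]).
Proof.
rewrite /graft0; case: F => [|t F] /=; first by [].
exact: graft_neq0 (t :: F) G.
Qed.

Lemma graft01 d ts G : graft [:: Node d ts] G = [:: Node d (graft0 ts G)].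
Proof. by rewrite graft1; case: ts. Qed.

Lemma del_rcons L d : del (rcons L (leaf d)) = L.
Proof. by elim: L => //= t [|u L] // ->. Qed.

Lemma rt_rcons L d : rt (rcons L (leaf d)) = [:: leaf d].
Proof. by elim: L => //= t [|u L] // ->. Qed.

Lemma del_graft F G : F != [::] -> G != [::] -> del (graft F G) = graft F (del G).
Proof.
move=> + nG; elim/forest_ind: F => // d ts [|u F] IHt IHF _.
  rewrite graft1 del1 graft1; case: ts IHt => [|t ts] IHt.
    by case: (G) nG.
  by rewrite -IHt //; case: graft (graft_neq0 (t :: ts) G).
rewrite !graft_cons -IHF //.
by case: graft (graft_neq0 (u :: F) G).
Qed.

Lemma rt_graft F G : F != [::] -> G != [::] -> rt (graft F G) = rt G.
Proof.
move=> + nG; elim/forest_ind: F => // d ts [|u F] IHt IHF _.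
  rewrite graft1 rt1; case: ts IHt => [|t ts] IHt.
    by case: (G) nG.
  by rewrite -IHt //; case: graft (graft_neq0 (t :: ts) G).
rewrite !graft_cons -IHF //.
by case: graft (graft_neq0 (u :: F) G).
Qed.

Lemma rcons_neq0 (T : eqType) (s : seq T) x : rcons s x != [::].
Proof. by case: s. Qed.

Lemma del_graft0 R L d : del (graft0 R (rcons L (leaf d))) = graft0 R L.
Proof.
rewrite /graft0; case: nilP => [_|/eqP nR]; first exact: del_rcons.
by rewrite del_graft ?rcons_neq0 // del_rcons.
Qed.

Lemma rt_graft0 R L d : rt (graft0 R (rcons L (leaf d))) = [:: leaf d].
Proof.
rewrite /graft0; case: nilP => [_|/eqP nR]; first exact: rt_rcons.
by rewrite rt_graft ?rcons_neq0 // rt_rcons.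
Qed.

(** The leaf labelled d is the rightmost one and L consists of the trees at its left siblings. Once
    these children are removed, their parent is the rightmost leaf of R; if there is no parent, R is
    empty. *)
Lemma graft0_decomp F : F != [::] ->
  exists R L d, F = graft0 R (rcons L (leaf d)).
Proof.
elim/forest_ind: F => // d ts [|u F] IHt IHF _.
  case: ts IHt => [|t ts] IHt; first by exists [::], [::], d.
  have [R [L [e ->]]] := IHt isT.
  by exists [:: Node d R], L, e; rewrite [RHS]graft0_graft // graft01.
have [[|r R] [L [e ->]]] := IHF isT.
  by exists [::], (Node d ts :: L), e.
by exists (Node d ts :: r :: R), L, e.
Qed.

Lemma single_del F : F != [::] -> single F = nilp (del F).
Proof.
case: F => // t [|u F] _; last by [].
by case: t => d [|u ts].
Qed.

Lemma single_rt F : single F -> rt F = F.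
Proof. by case: F => // -[d [|? ?]] [|? ?]. Qed.

Lemma rt_single F : F != [::] -> single (rt F).
Proof. by move=> /graft0_decomp[R [L [d ->]]]; rewrite rt_graft0. Qed.

Lemma graft0_del_rt F : F != [::] -> single F -> graft0 (del F) (rt F) = F.
Proof. by move=> nF sF; move: (sF); rewrite single_del // /graft0 => ->; rewrite single_rt. Qed.

(* Cutting off the rightmost leaf is the only cut with a one-vertex upper part
   containing this leaf. *)
Lemma sum_cut_single (V : nmodType) (H : forest -> forest -> V) F : F != [::] ->
  \sum_(c <- forest_cut F) (if c.1 && single c.2.1 then H c.2.1 c.2.2 else 0) =
  H (rt F) (del F).
Proof.
elim/forest_ind: F H => // d ts F IHt IHF H _.
pose HH b l r := if b && single l then H l r else 0.
case: F IHF => [|u F] IHF.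
  rewrite (sum_cut1 HH) /HH del1 rt1; case: ts IHt => [|t ts] IHt.
    by rewrite /= big_seq1 addr0.
  by rewrite add0r (IHt (fun l r => H l [:: Node d r])).
rewrite (sum_forest_cut HH) -(IHF (fun l r => H l (Node d ts :: r))) //.
apply: eq_big_seq => c cF; rewrite /HH /=.
case c1: c.1 => /=; last by rewrite big1 ?addr0.
case E: (c.2.1) => [|x l]; first by rewrite (forest_cut_l0 cF E) in c1.
rewrite add0r.
rewrite -[RHS](sum_cut_l0 (fun _ r => if single (x :: l) then H (x :: l) (Node d r :: c.2.2) else 0)).
apply: eq_bigr => a _; case: (a.2.1) => [|y m] //=.
by case: m.
Qed.

(** Meant for a cut (L, R) which leaves r_F in R: this leaf is detached, and put back with L on its
    left at the rightmost leaf of what remains. *)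
Definition regraft (L R : forest) : forest := graft0 (del R) (L ++ rt R).

Lemma regraft_graft0 L0 R L d :
  regraft L0 (graft0 R (rcons L (leaf d))) = graft0 (graft0 R L) (rcons L0 (leaf d)).
Proof. by rewrite /regraft del_graft0 rt_graft0 cats1. Qed.

(** If r is in the lower part, so is its path to the root, and with it the rightmost leaf of R. What
    remains is a cut of R with flag [false] and an arbitrary cut of L. *)
Lemma sum_cut_graft0 (V : nmodType) (H : forest -> forest -> V) R L d :
  \sum_(c <- forest_cut (graft0 R (rcons L (leaf d))) | ~~ c.1) H c.2.1 c.2.2 =
  \sum_(c <- forest_cut R | ~~ c.1) \sum_(e <- forest_cut L)
    H (c.2.1 ++ e.2.1) (graft0 c.2.2 (rcons e.2.2 (leaf d))).
Proof.
pose HH (b : bool) l r := if ~~ b then H l r else 0.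
have catE (K : forest -> forest -> V) :
    \sum_(c <- forest_cut (rcons L (leaf d))) (if ~~ c.1 then K c.2.1 c.2.2 else 0) =
    \sum_(e <- forest_cut L) K e.2.1 (rcons e.2.2 (leaf d)).
  rewrite -cats1 (sum_cut_cat (fun b l r => if ~~ b then K l r else 0)).
  by apply: eq_bigr => c _; rewrite /= !big_cons big_nil /= add0r addr0 cats0 cats1.
case: R => [|t R].
  by rewrite /graft0 /= big_cons big_nil addr0 /= big_mkcond catE.
rewrite graft0_graft // big_mkcond (sum_cut_graft HH) ?rcons_neq0 // [RHS]big_mkcond.
apply: eq_big_seq => c cR; rewrite {1}/HH; case: ifP => //= c1.
rewrite /HH (catE (fun l r => H (c.2.1 ++ l) (graft c.2.2 r))).
apply: eq_bigr => e _; rewrite graft0_graft //.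
by apply: contraFneq c1; exact: forest_cut_r0 cR.
Qed.

Definition nv : forest -> nat := forest_deg (fun _ => 1%N).

(** Depth of the rightmost leaf: 1 if it is a root, and 0 for the empty forest. *)
Definition dep (F : forest) : nat := size (rleaf_from 0 F).

Lemma dep_cons d ts F : dep (Node d ts :: F) = if F is [::] then (dep ts).+1 else dep F.
Proof. by rewrite /dep rleaf_from_cons; case: F. Qed.

Lemma dep_graft0 F G : G != [::] -> dep (graft0 F G) = (dep F + dep G)%N.
Proof.
move=> nG; elim/forest_ind: F => // d ts [|u F] IHt IHF.
  by rewrite graft0_graft // graft01 !dep_cons IHt.
rewrite graft0_graft // graft_cons dep_cons -graft0_graft //.
by rewrite -IHF; case: graft0 (graft0_eq0 (u :: F) G).
Qed.

Lemma dep_rcons L d : dep (rcons L (leaf d)) = 1%N.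
Proof. by elim: L => //= -[e ts] [|u L] IH; rewrite dep_cons. Qed.

Lemma dep_gt0 F : F != [::] -> (0 < dep F)%N.
Proof. by case: F. Qed.

Lemma dep_le_nv F : (dep F <= nv F)%N.
Proof.
elim/forest_ind: F => // d ts F IHt IHF; rewrite dep_cons /nv forest_deg_cons.
by case: F IHF => [_|u F IHF]; move: IHt; rewrite -/nv /=; lia.
Qed.

Lemma forest_cut_nil (F : forest) : (false, ([::], F)) \in forest_cut F.
Proof.
elim/forest_ind: F => // d ts F IHt IHF; apply/allpairsP.
exists (cut_node d (false, ([::], ts)), (false, ([::], F))); split=> //=.
  by rewrite -/(tree_cut (Node d ts)) tree_cutE inE map_f ?orbT.
by rewrite if_same.
Qed.

Lemma dep_cat F G : G != [::] -> dep (F ++ G) = dep G.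
Proof.
move=> nG; elim: F => // -[d ts] F IH; rewrite cat_cons dep_cons IH.
by case: F {IH} => [|//]; case: (G) nG.
Qed.

(** A cut with flag [false] keeps the whole path from the rightmost leaf to its root in the lower
    part. *)
Lemma dep_cut F : {in forest_cut F, forall c, ~~ c.1 -> dep c.2.2 = dep F}.
Proof.
elim/forest_ind: F => [|d ts F IHt IHF] c; first by rewrite inE => /eqP->.
case/allpairsP => -[c1 c2] [c1t c2F ->] /=; rewrite dep_cons.
have {}c1t : c1 \in tree_cut (Node d ts) := c1t.
have {}c2F : c2 \in forest_cut F := c2F.
case: F IHF c2F => [|u F] IHF c2F.
  move: c2F; rewrite inE => /eqP-> /=; rewrite cats0.
  move: c1t; rewrite tree_cutE inE => /orP[/eqP->//|/mapP[a at_ ->] /=].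
  by move=> a1; rewrite dep_cons (IHt a at_).
move=> c21; rewrite dep_cat ?(IHF c2) //.
by apply: contraNneq c21; exact: forest_cut_r0 c2F.
Qed.

(* For F = R nw (L r) with r = r_F the rightmost leaf, dec F = (L, R). *)
Fixpoint tree_dec (t : tree) : forest * forest :=
  let: Node d ts := t in
  if nilp ts then ([::], [::]) else
  let: (L, R) := (fix go ts := match ts with
    | [::] => ([::], [::])
    | [:: t'] => tree_dec t'
    | t' :: ts' => let: (L, R) := go ts' in
                   if nilp R then (t' :: L, [::]) else (L, t' :: R)
    end) ts in (L, [:: Node d R]).

Fixpoint dec (F : forest) : forest * forest :=
  match F with
  | [::] => ([::], [::])
  | [:: t] => tree_dec t
  | t :: F' => let: (L, R) := dec F' in
               if nilp R then (t :: L, [::]) else (L, t :: R)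
  end.

Lemma dec1 d ts : dec [:: Node d ts] =
  if nilp ts then ([::], [::]) else let: (L, R) := dec ts in (L, [:: Node d R]).
Proof. by []. Qed.

Lemma dec_cons t F : F != [::] ->
  dec (t :: F) = let: (L, R) := dec F in if nilp R then (t :: L, [::]) else (L, t :: R).
Proof. by case: F. Qed.

Lemma dec_graft0 R L d : dec (graft0 R (rcons L (leaf d))) = (L, R).
Proof.
have dr : dec (rcons L (leaf d)) = (L, [::]).
  by elim: L => // t L IH; rewrite rcons_cons dec_cons ?rcons_neq0 // IH.
move: (rcons _ _) (rcons_neq0 L (leaf d)) dr => G nG dG.
elim/forest_ind: R => // e ts [|u F] IHt IHF.
  rewrite graft0_graft // graft01 dec1; case: nilP => [/eqP|_]; last by rewrite IHt.
  by rewrite graft0_eq0 (negPf nG) andbF.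
rewrite graft0_graft // graft_cons -graft0_graft // dec_cons ?IHF //.
by rewrite graft0_eq0.
Qed.

Lemma forest_deg_graft0 f F G :
  forest_deg f (graft0 F G) = (forest_deg f F + forest_deg f G)%N.
Proof.
by rewrite /graft0; case: nilP => [->|/eqP nF] //; rewrite forest_deg_graft.
Qed.

Lemma nv_graft0 F G : nv (graft0 F G) = (nv F + nv G)%N.
Proof. exact: forest_deg_graft0. Qed.

(* Reverses the lexicographic order on (depth of r_F, size of the left part L of F),
   both being at most nv F. *)
Definition meas (F : forest) : nat :=
  ((nv F).+1 * (nv F).+1 - (dep F * (nv F).+1 + nv (dec F).1))%N.

(** As second components are at most n, d * (n + 1) + s encodes the pair in base n + 1; the code is
    below (n + 1)^2, so the truncated subtraction reverses the order strictly. *)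
Lemma lexi_sub (n d s d' s' : nat) : (d' <= n -> s <= n -> s' <= n ->
  d < d' \/ (d = d' /\ s < s') ->
  n.+1 * n.+1 - (d' * n.+1 + s') < n.+1 * n.+1 - (d * n.+1 + s))%N.
Proof.
move=> dn sn sn' dd.
have lt1 : (d * n.+1 + s < d' * n.+1 + s')%N.
  case: dd => [lt|[-> lt]]; last by rewrite ltn_add2l.
  by have : (d.+1 * n.+1 <= d' * n.+1)%N; [rewrite leq_pmul2r | rewrite mulSn; lia].
have : (d' * n.+1 + s' < n.+1 * n.+1)%N.
  by have : (d' * n.+1 <= n * n.+1)%N; [rewrite leq_pmul2r | rewrite mulSn; lia].
by lia.
Qed.

Variable deg : D -> nat.

(** The empty cut of R with the total cut of L reassembles to F. Any other pair of cuts leaves a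
    part of L below, which increases the depth of r, or moves a part of R to L at the same depth at
    least. *)
Lemma sum_regraft F : F != [::] -> exists rest : seq forest,
  (forall (V : nmodType) (H : forest -> V),
     \sum_(c <- forest_cut F | ~~ c.1) H (regraft c.2.1 c.2.2) =
     H F + \sum_(G <- rest) H G) /\
  {in rest, forall G, [/\ G != [::], forest_deg deg G = forest_deg deg F
                        & (meas G < meas F)%N]}.
Proof.
move=> /graft0_decomp[R [L [d ->]]].
pose G (c e : bool * (forest * forest)) :=
  graft0 (graft0 c.2.2 e.2.2) (rcons (c.2.1 ++ e.2.1) (leaf d)).
(* First list: R is not cut and L does not go up entirely. Second list: some of R goes up and L is
   cut arbitrarily. *)
exists ([seq G (false, ([::], R)) e | e <- [seq e <- forest_cut L | ~~ nilp e.2.2]] ++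
  [seq G c e | c <- [seq c <- forest_cut R | ~~ c.1 && ~~ nilp c.2.1], e <- forest_cut L]).
split.
  move=> V H; rewrite big_cat big_map big_allpairs_dep !big_filter /=.
  rewrite (sum_cut_graft0 (fun l r => H (regraft l r))).
  transitivity (\sum_(c <- forest_cut R | ~~ c.1) \sum_(e <- forest_cut L) H (G c e)).
    by apply: eq_bigr => c _; apply: eq_bigr => e _; rewrite regraft_graft0.
  pose X (c : bool * (forest * forest)) := \sum_(e <- forest_cut L) H (G c e).
  have -> : \sum_(c <- forest_cut R | ~~ c.1) X c = X (false, ([::], R)) +
      \sum_(c <- forest_cut R | ~~ c.1 && ~~ nilp c.2.1) X c.
    rewrite -[X (false, _)](sum_cut_l0 (fun b r => X (b, ([::], r)))).
    rewrite big_mkcond [X in _ = _ + X]big_mkcond -big_split; apply: eq_big_seq => c cR /=.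
    case: c cR => [b [l r]] cR /=; case: nilP => [l0|_].
      by have /= -> := forest_cut_l0 cR l0; rewrite l0 addr0.
    by rewrite andbT add0r.
  rewrite addrA; congr (_ + _).
  rewrite {1}/X (_ : H (graft0 R _) = H (G (false, ([::], R)) (true, (L, [::])))); last first.
    by rewrite /G /= graft0_nil.
  rewrite -[H (G _ (true, _))](sum_cut_r0 (fun b l => H (G (false, ([::], R)) (b, (l, [::]))))).
  rewrite [X in _ = _ + X]big_mkcond -big_split; apply: eq_bigr => -[b [l r]] _ /=.
  by case: nilP => [->|_]; rewrite ?addr0 ?add0r.
have dg f c e : c \in forest_cut R -> e \in forest_cut L ->
    forest_deg f (G c e) = forest_deg f (graft0 R (rcons L (leaf d))).
  move=> /(forest_deg_cut f) cE /(forest_deg_cut f) eE.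
  rewrite /G !forest_deg_graft0 -!cats1 !forest_deg_cat -cE -eE.
  by rewrite addnA [RHS]addnA; congr addn; rewrite [RHS]addnACA addnC.
have mlt c e : c \in forest_cut R -> e \in forest_cut L -> ~~ c.1 ->
    ~~ nilp e.2.2 || ~~ nilp c.2.1 -> (meas (G c e) < meas (graft0 R (rcons L (leaf d))))%N.
  move=> cR eL c1 ce; have cE := forest_deg_cut (fun=> 1%N) cR.
  have eE := forest_deg_cut (fun=> 1%N) eL; rewrite -!/(nv _) in cE eE.
  rewrite /meas; have -> : nv (G c e) = nv (graft0 R (rcons L (leaf d))) by exact: dg.
  have nvE : nv (graft0 R (rcons L (leaf d))) = (nv R + nv L).+1.
    by rewrite nv_graft0 -cats1 /nv forest_deg_cat addnA addn1.
  have dE : (dep (G c e) = dep R + dep e.2.2 + 1)%N.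
    rewrite dep_graft0 ?rcons_neq0 // dep_rcons -(dep_cut cR c1).
    have [->|/dep_graft0-> //] := eqVneq e.2.2 [::].
    by rewrite graft0_nil addn0.
  have := dep_le_nv (G c e); have -> : nv (G c e) = nv (graft0 R (rcons L (leaf d))) by exact: dg.
  rewrite {}dE !dec_graft0 dep_graft0 ?rcons_neq0 // dep_rcons nvE.
  have -> : nv (c.2.1 ++ e.2.1) = (nv c.2.1 + nv e.2.1)%N by exact: forest_deg_cat.
  have c0 : ~~ nilp c.2.1 -> (0 < nv c.2.1)%N.
    by move=> /nilP/eqP nc; apply: leq_trans (dep_gt0 nc) (dep_le_nv _).
  have e0 : ~~ nilp e.2.2 -> (0 < dep e.2.2)%N by move=> /nilP/eqP; exact: dep_gt0.
  have e1 : nilp e.2.2 -> dep e.2.2 = 0%N /\ nv e.2.2 = 0%N by move=> /nilP->.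
  move: c0 e0 e1 ce cE eE; move: (nilp _) (nilp _) => x y.
  move: (nv c.2.1) (nv c.2.2) (nv e.2.1) (nv e.2.2) (nv R) (nv L) (dep R) (dep e.2.2).
  move=> n1 n2 n3 n4 n5 n6 d1 d2 c0 e0 e1 ce cE eE dN.
  apply: lexi_sub; [lia..|]; case: x y c0 e0 e1 ce => -[] c0 e0 e1 // _; lia.
move=> X; rewrite mem_cat => /orP[/mapP[e]|/allpairsP[[c e]]].
  rewrite mem_filter => /andP[e0 eL] ->.
  have cR := forest_cut_nil R.
  by rewrite dg // mlt ?e0 // graft0_eq0 (negPf (rcons_neq0 _ _)) andbF.
rewrite /= mem_filter => -[/andP[/andP[c1 c0] cR] eL ->].
by rewrite dg // mlt ?c0 ?orbT // graft0_eq0 (negPf (rcons_neq0 _ _)) andbF.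
Qed.

End Forests.

Lemma max_seq (T : eqType) (f : T -> nat) (s : seq T) : s != [::] ->
  exists2 x, x \in s & {in s, forall y, f y <= f x}%N.
Proof.
elim: s => // x s IH _; have [->|/IH[y ys ym]] := eqVneq s [::].
  by exists x; rewrite ?mem_head // => y; rewrite inE => /eqP->.
have [xy|/ltnW yx] := leqP (f x) (f y).
  by exists y; rewrite ?inE ?ys ?orbT // => z; rewrite inE => /predU1P[->|/ym].
exists x; rewrite ?mem_head // => z; rewrite inE => /predU1P[->//|/ym zy].
exact: leq_trans yx.
Qed.

Lemma malg_sumE (K : fieldType) (B : choiceType) (x : {malg K[B]}) :
  x = \sum_(b <- msupp x) x@_b *: << b >>.
Proof. by rewrite -[LHS]lextU_id. Qed.

(** * The operator Psi and its inverse *)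

Section Psi.
Variables (D : choiceType) (deg : D -> nat) (K : fieldType).
Notation forest := (seq (ptree D)).
Let H := Hp deg K.
Let B := bas H.
Let vF : forest -> space H := vec K (@hp_basis D).
Let pr := Hp_presentation deg K.

Local Opaque tens tmap tmap2 dot nw lext bext dprec dsucc.

Lemma Hp_dot s t : s != [::] -> t != [::] -> dot (vF s) (vF t) = vF (s ++ t).
Proof. by move=> ns nt; rewrite (dot_ve pr) // /vmul big_seq1. Qed.

Lemma Hp_nw s t : s != [::] -> t != [::] -> nw (vF s) (vF t) = vF (graft s t).
Proof. by move=> ns nt; rewrite (nw_ve pr) // /vgr big_seq1. Qed.

Lemma Hp_valP (b : B) : val b != [::].
Proof. exact: (valP b). Qed.

Definition pi_vertex : space H -> space H :=
  lext (fun b : B => if single (val b) then << b >> : space H else 0).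

Definition J2 : space2 H -> space H :=
  lext (fun p : B * B => nw (<< p.2 >> : space H) << p.1 >>).
Definition J3 : space2 H -> space H :=
  lext (fun p : B * B => dot (<< p.1 >> : space H) << p.2 >>).
Definition J4 : {malg K[(B * (B * B))%type]} -> space H :=
  lext (fun p : B * (B * B) =>
    nw (<< p.2.2 >> : space H) (dot (<< p.1 >> : space H) << p.2.1 >>)).

Definition rho (x : space H) : space2 H := tmap pi_vertex id (dprec x).

(* The terms of Psi F are the forests obtained from a decomposition
   (L, r_F, R) of F by cuts above and below r_F, reassembled as R nw (L r_F). *)
Definition Psi (x : space H) : space H :=
  pi_vertex x + J2 (rho x) + J3 (tmap id pi_vertex (dsucc x)) + J4 (tmap id rho (dsucc x)).

Lemma pi_lin : linear pi_vertex. Proof. exact: linearP. Qed.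
Lemma J2_lin : linear J2. Proof. exact: linearP. Qed.
Lemma J3_lin : linear J3. Proof. exact: linearP. Qed.
Lemma J4_lin : linear J4. Proof. exact: linearP. Qed.

Lemma rho_lin : linear rho.
Proof. by move=> a x y; rewrite /rho linearP (tmap_lin _ _ _ _ _). Qed.

Lemma Psi_lin : linear Psi.
Proof.
have ls : linear (@dsucc K H) by exact: linearP.
have l3 := lin_comp J3_lin (lin_comp (tmap_lin id pi_vertex) ls).
have l4 := lin_comp J4_lin (lin_comp (tmap_lin id rho) ls).
exact: lin_add (lin_add (lin_add pi_lin (lin_comp J2_lin rho_lin)) l3) l4.
Qed.

Lemma J2_tens x y : J2 (tens x y) = nw y x.
Proof.
apply: (@eq_tens_basis _ _ _ _ (fun x y => J2 (tens x y)) (fun x y : space H => nw y x)).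
- by move=> z a u w; rewrite linearP J2_lin.
- by move=> z a u w; rewrite tens_linl J2_lin.
- by move=> z a u w; rewrite nw_linl.
- by move=> z a u w; rewrite linearP.
by move=> b c; rewrite tensUU /J2 lextU.
Qed.

Lemma J3_tens x y : J3 (tens x y) = dot x y.
Proof.
apply: (@eq_tens_basis _ _ _ _ (fun x y => J3 (tens x y)) (fun x y : space H => dot x y)).
- by move=> z a u w; rewrite linearP J3_lin.
- by move=> z a u w; rewrite tens_linl J3_lin.
- by move=> z a u w; rewrite linearP.
- by move=> z a u w; rewrite dot_linl.
by move=> b c; rewrite tensUU /J3 lextU.
Qed.

Lemma J4_tens x y z : J4 (tens x (tens y z)) = nw z (dot x y).
Proof.
apply: (@eq_lin_basis _ _ _ (fun x => J4 (tens x (tens y z))) (fun x : space H => nw z (dot x y))).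
- by move=> a u w; rewrite tens_linl J4_lin.
- by move=> a u w; rewrite dot_linl linearP.
move=> b; apply: (@eq_tens_basis _ _ _ _ (fun y z => J4 (tens << b >> (tens y z)))
  (fun y z : space H => nw z (dot (<< b >> : space H) y))).
- by move=> v a u w; rewrite !linearP J4_lin.
- by move=> v a u w; rewrite tens_linl linearP J4_lin.
- by move=> v a u w; rewrite nw_linl.
- by move=> v a u w; rewrite !linearP.
by move=> c d; rewrite !tensUU /J4 lextU.
Qed.

Lemma pi_vec F : pi_vertex (vF F) = if single F then vF F else 0.
Proof.
have [->|nF] := eqVneq F [::]; first by rewrite /vF vec_nil (lin0 pi_lin).
by rewrite /vF (vecE _ nF) /pi_vertex lextU.
Qed.

(** By [sum_cut_single] a single cut survives the projection of the first factor, the one at the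
    rightmost leaf. *)
Lemma rho_vec F : rho (vF F) = tens (vF (rt F)) (vF (del F)).
Proof.
have [->|nF] := eqVneq F [::].
  by rewrite /vF vec_nil (lin0 rho_lin) tens0l.
rewrite /rho (dprec_ve pr) // (lin_sum (tmap_lin _ _)).
rewrite -(sum_cut_single (fun l r => tens (vF l) (vF r)) nF) big_mkcond.
apply: eq_bigr => c _; case: c.1 => //=.
rewrite /vcut (tmap_tens _ _ pi_lin (@lin_id _ _)) pi_vec.
by case: single; rewrite ?tens0l.
Qed.

(** A cut (l, r) with flag [false] is accounted for by one term: by pi or J2 if l is empty, by J3 or
    J4 otherwise, according to whether r (which is F in the first case) is a single vertex or not.
    The other term of the pair vanishes. *)
Lemma Psi_vec F : F != [::] ->
  Psi (vF F) = \sum_(c <- forest_cut F | ~~ c.1) vF (regraft c.2.1 c.2.2).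
Proof.
move=> nF.
pose X (b : bool) l r := if ~~ b then vF (regraft l r) else 0.
rewrite big_mkcond (sum_cut_proper X nF) {1 2}/X /= add0r.
rewrite /Psi -addrA; congr (_ + _).
  rewrite pi_vec rho_vec J2_tens /regraft cat0s; case: ifP => sF.
    have := sF; rewrite single_del // => /nilP d0.
    by rewrite graft0_del_rt // d0 /vF vec_nil (lin0 (nw_linl _)) addr0.
  rewrite add0r Hp_nw; last by case: rt (rt_single nF).
    by rewrite graft0_graft //; move: sF; rewrite single_del //; case: del.
  by move: sF; rewrite single_del //; case: del.
rewrite (dsucc_ve pr) // !(lin_sum (tmap_lin _ _)) (lin_sum J3_lin) (lin_sum J4_lin).
rewrite -big_split /= big_mkcond [RHS]big_mkcond; apply: eq_big_seq => c cF.
rewrite /X; case c1: c.1 => /=; first by rewrite if_same.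
rewrite /vcut (tmap_tens _ _ (@lin_id _ _) pi_lin) (tmap_tens _ _ (@lin_id _ _) rho_lin).
rewrite J3_tens rho_vec J4_tens pi_vec /proper.
have r0 : c.2.2 != [::].
  by apply: contraFneq c1; exact: forest_cut_r0 cF.
rewrite r0 andbT.
have [l0|l0] := eqVneq c.2.1 [::].
  by rewrite l0 /vF vec_nil !(lin0 (dot_linl _)) linear0 addr0.
have nrt : rt c.2.2 != [::] by case: rt (rt_single r0).
rewrite Hp_dot // /regraft; case: ifP => s2.
  have := s2; rewrite single_del // => /nilP d0.
  by rewrite d0 /vF vec_nil (lin0 (nw_linl _)) addr0 single_rt // Hp_dot.
have nd : del c.2.2 != [::] by move: s2; rewrite single_del //; case: del.
rewrite linear0 add0r Hp_nw ?graft0_graft //.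
by case: (c.2.1) l0.
Qed.

(** Strong induction on the measure: F minus a preimage of the remaining terms of Psi F is a
    preimage of F. *)
Lemma Psi_surj F : F != [::] ->
  exists2 x, Psi x = vF F & homog (@bdeg K H) (forest_deg deg F) x.
Proof.
have [m] := ubnP (meas F); elim: m F => // m IH F mF nF.
have [rest [restE restP]] := sum_regraft deg nF.
have [y yE hy] : exists2 y, Psi y = \sum_(G <- rest) vF G &
    homog (@bdeg K H) (forest_deg deg F) y.
  elim: rest {restE} restP => [|G s IHs] sP.
    by exists 0; rewrite ?big_nil ?(lin0 Psi_lin) //; exact: homog0.
  have [|y yE hy] := IHs; first by move=> E Es; apply: sP; rewrite inE Es orbT.
  have [nG dG mG] := sP G (mem_head _ _).
  have [|x xE hx] := IH G _ nG; first exact: leq_trans mG _.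
  exists (x + y); first by rewrite (linD Psi_lin) xE yE big_cons.
  by apply: homogD => //; rewrite -dG.
exists (vF F - y); last by apply: homogB => //; exact: (vdeg pr).
by rewrite (linB Psi_lin) yE Psi_vec // (restE _ vF) addrK.
Qed.

(** Let b have the greatest measure in the support of x. Every other forest that Psi produces from
    the support has smaller measure than the one it comes from, so Psi x and x have the same
    coefficient at b. *)
Lemma Psi_inj x : Psi x = 0 -> x = 0.
Proof.
move=> P0; have [x0|] := eqVneq (msupp x : seq B) [::].
  by rewrite [LHS]malg_sumE x0 big_nil.
case/(max_seq (fun b : B => meas (val b))) => b bx bmax.
have : (Psi x)@_b = 0 by rewrite P0 mcoeff0.
rewrite [X in Psi X]malg_sumE (lin_sum Psi_lin) raddf_sum /=.
have PsiE c : exists2 s : seq forest, Psi (<< c >> : space H) = << c >> + \sum_(G <- s) vF G &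
    {in s, forall G, G != [::] /\ (meas G < meas (val c))%N}.
  have [s [sE sP]] := sum_regraft deg (Hp_valP c).
  exists s; last by move=> G /sP[].
  by rewrite -[in LHS](vec_val c) Psi_vec ?Hp_valP // (sE _ vF) /vF vec_val.
have coefE c : c \in (msupp x : seq B) -> (Psi (<< c >> : space H))@_b = (c == b)%:R.
  move=> cx; have [s -> sP] := PsiE c; rewrite mcoeffD mcoeffU raddf_sum /=.
  rewrite big_seq big1 ?addr0 // => G /sP[nG mG].
  rewrite /vF (vecE _ nG) mcoeffU; case: eqP => // Gb.
  by have := bmax c cx; rewrite -Gb /= leqNgt mG.
rewrite (bigD1_seq b) //= big1_seq ?addr0 => [|c /andP[cb cx]].
  rewrite (linZ Psi_lin) mcoeffZ coefE // eqxx mulr1 => xb.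
  by move: bx; rewrite -[_ \in _]/(b \in msupp x) -mcoeff_neq0 xb eqxx.
by rewrite (linZ Psi_lin) mcoeffZ coefE // (negPf cb) mulr0.
Qed.

Lemma Psi_inverse : exists g : space H -> space H,
  [/\ linear g, cancel g Psi, cancel Psi g &
    forall n x, homog (@bdeg K H) n x -> homog (@bdeg K H) n (g x)].
Proof.
have Pb (b : B) : exists x, Psi x = (<< b >> : space H) /\ homog (@bdeg K H) (bdeg b) x.
  have [x xE hx] := Psi_surj (Hp_valP b); exists x; split=> //.
  by rewrite xE; exact: (pr_vec pr).
pose g0 b := proj1_sig (constructive_indefinite_description _ (Pb b)).
have g0P b : Psi (g0 b) = (<< b >> : space H) /\ homog (@bdeg K H) (bdeg b) (g0 b).
  exact: proj2_sig (constructive_indefinite_description _ (Pb b)).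
have gK : cancel (lext g0) Psi.
  apply: (@eq_lin_basis _ _ _ (fun x : space H => Psi (lext g0 x)) id) => [a x y|//|b].
    by rewrite linearP Psi_lin.
  by rewrite lextU; have [] := g0P b.
exists (lext g0); split=> //.
- exact: linearP.
- move=> x; apply/eqP; rewrite -subr_eq0; apply/eqP/Psi_inj.
  by rewrite (linB Psi_lin) gK subrr.
by move=> n x; apply: homog_lext => b <-; have [] := g0P b.
Qed.

End Psi.

Lemma dprec_lin (K : fieldType) (A : based K) : linear (@dprec K A).
Proof. exact: linearP. Qed.

Lemma dsucc_lin (K : fieldType) (A : based K) : linear (@dsucc K A).
Proof. exact: linearP. Qed.

Lemma add3 (V : zmodType) (x y x' y' z z' : V) :
  x = x' -> y = y' -> z = z' -> x + y + z = x' + y' + z'.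
Proof. by do 3!move->. Qed.

Lemma linD5 (K : fieldType) (V W : lmodType K) (f : V -> W) a b c d e : linear f ->
  f (a + b + c + d + e) = f a + f b + f c + f d + f e.
Proof. by move=> lf; rewrite !(linD lf). Qed.

Lemma linD3 (K : fieldType) (V W : lmodType K) (f : V -> W) a b c : linear f ->
  f (a + b + c) = f a + f b + f c.
Proof. by move=> lf; rewrite !(linD lf). Qed.

(** * Rigidity *)

Section Naturality.
Variables (K : fieldType) (B C : choiceType) (phi : {malg K[B]} -> {malg K[C]}).
Hypothesis phi_lin : linear phi.

Lemma tmap_natural (f g : {malg K[B]} -> {malg K[B]}) (f' g' : {malg K[C]} -> {malg K[C]}) t :
  linear f' -> linear g' ->
  (forall x, phi (f x) = f' (phi x)) -> (forall x, phi (g x) = g' (phi x)) ->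
  tmap phi phi (tmap f g t) = tmap f' g' (tmap phi phi t).
Proof.
move=> lf lg ff gg; rewrite (tmap_comp _ _ _ phi_lin phi_lin) (tmap_comp _ _ _ lf lg).
by apply: eq_tmap => b; [exact: ff | exact: gg].
Qed.

Lemma tmap2_natural (f g : {malg K[B]} -> {malg K[B]} -> {malg K[B]})
    (f' g' : {malg K[C]} -> {malg K[C]} -> {malg K[C]}) t s :
  (forall x, linear (f' x)) -> (forall y, linear (f'^~ y)) ->
  (forall x, linear (g' x)) -> (forall y, linear (g'^~ y)) ->
  (forall x y, phi (f x y) = f' (phi x) (phi y)) ->
  (forall x y, phi (g x y) = g' (phi x) (phi y)) ->
  tmap phi phi (tmap2 f g t s) = tmap2 f' g' (tmap phi phi t) (tmap phi phi s).
Proof.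
move=> fr fl gr gl ff gg; have lt := tmap_lin phi phi.
apply: (@eq_tens_basis _ _ _ _ (fun t s => tmap phi phi (tmap2 f g t s))
  (fun t s => tmap2 f' g' (tmap phi phi t) (tmap phi phi s))).
- by move=> z a u w; rewrite tmap2_linr lt.
- by move=> z a u w; rewrite tmap2_linl lt.
- by move=> z a u w; rewrite lt tmap2_linr.
- by move=> z a u w; rewrite lt tmap2_linl.
move=> p q; rewrite tmap2UU (tmapU phi phi p) (tmapU phi phi q) (tmap_tens _ _ phi_lin phi_lin).
by rewrite (tmap2_tens _ _ _ _ fr fl gr gl) ff gg.
Qed.

End Naturality.

Section Coalgebra.
Variables (K : fieldType) (H A : based K) (phi : space H -> space A).
Hypothesis phi_lin : linear phi.
Hypothesis compatH : DupDend_compat H.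
Hypothesis compatA : DupDend_compat A.
Hypothesis phi_dot : forall x y, phi (dot x y) = dot (phi x) (phi y).
Hypothesis phi_nw : forall x y, phi (nw x y) = nw (phi x) (phi y).

Local Opaque tens tmap tmap2 dot nw lext bext dprec dsucc.

Definition coalg (x : space H) : Prop :=
  tmap phi phi (dprec x) = dprec (phi x) /\ tmap phi phi (dsucc x) = dsucc (phi x).

Lemma coalg_red x : coalg x -> tmap phi phi (dred x) = dred (phi x).
Proof. by case=> hp hs; rewrite /dred (linD (tmap_lin _ _)) hp hs. Qed.

(** The compatibility axioms express the coproducts of a product by those of the factors with the
    same formulas in H and in A, and phi carries one to the other term by term. *)
Lemma coalg_ops x y : coalg x -> coalg y -> coalg (dot x y) /\ coalg (nw x y).
Proof.
move=> cx cy; have [px sx] := cx; have [py sy] := cy; have rx := coalg_red cx.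
have li := @lin_id K (space A).
have [E1 E2 E3 E4] := compatA (phi x) (phi y).
have [F1 F2 F3 F4] := compatH x y.
have dl y1 := @tmap_natural _ _ _ _ phi_lin ((@dot K H)^~ y1) id _ _ _ (dot_linl (phi y1)) li
  (fun z => phi_dot z y1) (fun z => erefl).
have dl' y1 := @tmap_natural _ _ _ _ phi_lin id ((@dot K H)^~ y1) _ _ _ li (dot_linl (phi y1))
  (fun z => erefl) (fun z => phi_dot z y1).
have dr x1 := @tmap_natural _ _ _ _ phi_lin (@dot K H x1) id _ _ _ (dot_linr (phi x1)) li
  (phi_dot x1) (fun z => erefl).
have dr' x1 := @tmap_natural _ _ _ _ phi_lin id (@dot K H x1) _ _ _ li (dot_linr (phi x1))
  (fun z => erefl) (phi_dot x1).
have nl y1 := @tmap_natural _ _ _ _ phi_lin ((@nw K H)^~ y1) id _ _ _ (nw_linl (phi y1)) li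
  (fun z => phi_nw z y1) (fun z => erefl).
have nl' y1 := @tmap_natural _ _ _ _ phi_lin id ((@nw K H)^~ y1) _ _ _ li (nw_linl (phi y1))
  (fun z => erefl) (fun z => phi_nw z y1).
have nr' x1 := @tmap_natural _ _ _ _ phi_lin id (@nw K H x1) _ _ _ li (nw_linr (phi x1))
  (fun z => erefl) (phi_nw x1).
have dd := @tmap2_natural _ _ _ _ phi_lin (@dot K H) (@dot K H) (@dot K A) (@dot K A) _ _
  (@dot_linr K A) (@dot_linl K A) (@dot_linr K A) (@dot_linl K A) phi_dot phi_dot.
have dn := @tmap2_natural _ _ _ _ phi_lin (@dot K H) (@nw K H) (@dot K A) (@nw K A) _ _
  (@dot_linr K A) (@dot_linl K A) (@nw_linr K A) (@nw_linl K A) phi_dot phi_nw.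
have lt := tmap_lin phi phi; split; split.
- rewrite F1 phi_dot E1 (linD5 _ _ _ _ _ lt); apply: add5.
  + exact: tmap_tens _ _ phi_lin phi_lin.
  + by rewrite dl rx.
  + by rewrite dr py.
  + by rewrite dr' py.
  by rewrite dd rx py.
- rewrite F2 phi_dot E2 (linD5 _ _ _ _ _ lt); apply: add5.
  + exact: tmap_tens _ _ phi_lin phi_lin.
  + by rewrite dl' rx.
  + by rewrite dr sy.
  + by rewrite dr' sy.
  by rewrite dd rx sy.
- rewrite F3 phi_nw E3 (linD5 _ _ _ _ _ lt); apply: add5.
  + exact: tmap_tens _ _ phi_lin phi_lin.
  + by rewrite nr' py.
  + by rewrite nl px.
  + by rewrite dl sx.
  by rewrite dn sx py.
rewrite F4 phi_nw E4 (linD3 _ _ _ lt); apply: add3.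
- by rewrite nr' sy.
- by rewrite nl' sx.
by rewrite dn sx sy.
Qed.


End Coalgebra.

(** * Primitive elements and the morphism from forests *)

Section Rigidity.
Variables (K : fieldType) (A : based K) (rk : bas A -> nat).
Hypothesis hA : graded_DupDend_bialgebra A.
Hypothesis rk_inj : injective rk.

Local Opaque tens tmap tmap2 dot nw lext bext dprec dsucc.

Let dupA : duplicial A. Proof. by case: hA. Qed.
Let gradedA : DupDend_graded A. Proof. by case: hA. Qed.

Definition prim (x : space A) : Prop := dprec x = 0 /\ dsucc x = 0.

Definition leading (b : bas A) (x : space A) : Prop :=
  [/\ prim x, homog (@bdeg K A) (bdeg b) x, x@_b = 1 &
      forall c, c \in msupp x -> (rk c <= rk b)%N].

(** The informative excluded middle yields a boolean, which makes [gens] a subtype of the basis and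
    hence a [choiceType]. *)
Definition is_lead (b : bas A) : bool :=
  if excluded_middle_informative (exists x, leading b x) then true else false.

(* A basis of the space of primitive elements is indexed by the leading terms
   of its homogeneous elements, for the order given by rk. *)
Definition gens : choiceType := {b : bas A | is_lead b}.
Definition gdeg (d : gens) : nat := bdeg (val d).

Lemma gen_ex (d : gens) : exists x, leading (val d) x.
Proof.
by have := valP d; rewrite /is_lead; case: excluded_middle_informative.
Qed.

Definition gen (d : gens) : space A :=
  proj1_sig (constructive_indefinite_description _ (gen_ex d)).

Lemma genP d : leading (val d) (gen d).
Proof. exact: proj2_sig (constructive_indefinite_description _ (gen_ex d)). Qed.

Lemma prim_lin a x y : prim x -> prim y -> prim (a *: x + y).
Proof.
case=> px sx [py sy]; split; rewrite (dprec_lin, dsucc_lin) ?px ?sx ?py ?sy;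
  by rewrite scaler0 addr0.
Qed.

(** Gaussian elimination. The leading term b of x lies in [gens], x itself being a witness once
    divided by its coefficient at b; subtracting the matching multiple of the generator at b lowers
    the rank of the leading term. *)
Lemma gen_span n x : prim x -> homog (@bdeg K A) n x ->
  exists2 y : {malg K[gens]}, homog gdeg n y & x = lext gen y.
Proof.
have [m] : exists m, forall c, c \in msupp x -> (rk c < m)%N.
  have [x0|] := eqVneq (msupp x : seq (bas A)) [::].
    by exists 0%N => c; rewrite -[_ \in _]/(c \in (msupp x : seq (bas A))) x0.
  by case/(max_seq rk) => b bx bm; exists (rk b).+1 => c cx; rewrite ltnS; exact: bm.
elim: m x => [|m IH] x xm px hx.
  exists 0; first exact: homog0.
  rewrite linear0 [LHS]malg_sumE big_seq big1 // => c cx.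
  by have := xm c cx.
have [x0|] := eqVneq (msupp x : seq (bas A)) [::].
  exists 0; first exact: homog0.
  by rewrite linear0 [LHS]malg_sumE x0 big_nil.
case/(max_seq rk) => b bx bm; have db : bdeg b = n by exact: hx.
have xb : x@_b != 0 by rewrite mcoeff_neq0.
have lb : is_lead b.
  rewrite /is_lead; case: excluded_middle_informative => // -[].
  exists ((x@_b)^-1 *: x); split.
  - by rewrite -[_ *: x]addr0; apply: prim_lin => //; split; rewrite linear0.
  - by rewrite db; exact: homogZ.
  - by rewrite mcoeffZ mulVf.
  by move=> c /(fsubsetP (msuppZ_le _ _)); exact: bm.
pose d : gens := exist _ b lb; have [pd hd cd md] := genP d.
have [||| y hy yE] := IH (- x@_b *: gen d + x).
- move=> c cx; have cle : (rk c <= rk b)%N.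
    move: cx => /(fsubsetP (msuppD_le _ _)); rewrite inE => /orP[|]; last exact: bm.
    by move=> /(fsubsetP (msuppZ_le _ _)); exact: md.
  apply: (@leq_trans (rk b)); last by rewrite -ltnS; exact: xm.
  rewrite ltn_neqAle cle andbT.
  apply: contraTneq cx => /rk_inj->.
  by rewrite -mcoeff_neq0 mcoeffD mcoeffZ -[b in (gen d)@_b]/(val d) cd mulr1 addNr eqxx.
- exact: prim_lin.
- by apply: homogD => //; apply: homogZ; rewrite -db.
exists (y + x@_b *: << d >>).
  by apply: homogD => //; apply: homogZ; exact: homogU.
by rewrite linearD linearZ /= lextU -yE scaleNr addrAC addNr add0r.
Qed.

(** The generators have distinct leading terms with coefficient 1. At the greatest one that occurs
    in y, no other generator contributes. *)
Lemma gen_free (y : {malg K[gens]}) : lext gen y = 0 -> y = 0.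
Proof.
move=> y0; have [E|] := eqVneq (msupp y : seq gens) [::].
  by rewrite [LHS]malg_sumE E big_nil.
case/(max_seq (fun d : gens => rk (val d))) => d dy dm.
have : (lext gen y)@_(val d) = 0 by rewrite y0 mcoeff0.
rewrite [X in lext _ X]malg_sumE linear_sum raddf_sum /=.
rewrite (bigD1_seq d) //= big1_seq ?addr0 => [|c /andP[cd cy]].
  rewrite linearZ /= lextU mcoeffZ; have [_ _ -> _] := genP d; rewrite mulr1 => yd.
  by move: dy; rewrite -[_ \in _]/(d \in msupp y) -mcoeff_neq0 yd eqxx.
rewrite linearZ /= lextU mcoeffZ; have [_ _ _ mc] := genP c.
rewrite [X in _ * X]mcoeff_outdom ?mulr0 //; apply/negP => /mc dc.
have /rk_inj/val_inj E : rk (val c) = rk (val d) by apply/eqP; rewrite eqn_leq dm.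
by rewrite E eqxx in cd.
Qed.

Let H := Hp gdeg K.
Let B := bas H.
Notation forest := (seq (ptree gens)).
Let vF : forest -> space H := vec K (@hp_basis gens).
Let pr := Hp_presentation gdeg K.

(** A tree is its root nw the forest of its children, which forces this definition. The value 0 at
    the empty forest agrees with [vec_nil]. *)
Fixpoint tree_phi (t : ptree gens) : space A :=
  let: Node d ts := t in
  if nilp ts then gen d else
  nw (gen d) ((fix go ts := match ts with
    | [::] => 0
    | [:: t'] => tree_phi t'
    | t' :: ts' => dot (tree_phi t') (go ts')
    end) ts).

Fixpoint forest_phi (F : forest) : space A :=
  match F with
  | [::] => 0
  | [:: t'] => tree_phi t'
  | t' :: F' => dot (tree_phi t') (forest_phi F')
  end.

Lemma forest_phi1 d ts : forest_phi [:: Node d ts] =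
  if nilp ts then gen d else nw (gen d) (forest_phi ts).
Proof. by []. Qed.

Lemma forest_phi_cons t u F :
  forest_phi [:: t, u & F] = dot (forest_phi [:: t]) (forest_phi (u :: F)).
Proof. by []. Qed.

Local Opaque forest_phi tree_phi.

Lemma forest_phi_cat F G : F != [::] -> G != [::] ->
  forest_phi (F ++ G) = dot (forest_phi F) (forest_phi G).
Proof.
move=> + nG; elim: F => // t [|u F] IH _; first by case: (G) nG.
rewrite 2!cat_cons 2!forest_phi_cons -cat_cons (IH isT).
by have [-> _ _] := dupA (forest_phi [:: t]) (forest_phi (u :: F)) (forest_phi G).
Qed.

(** For a single tree this is the associativity of nw; the mixed duplicial axiom then moves nw past
    the trees on the left. *)
Lemma forest_phi_graft F G : F != [::] -> G != [::] ->
  forest_phi (graft F G) = nw (forest_phi F) (forest_phi G).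
Proof.
move=> + nG; elim/forest_ind: F => // d ts [|u F] IHt IHF _.
  rewrite graft1 !forest_phi1; case: ts IHt => [_|t ts IHt].
    by case: (G) nG.
  have [_ -> _] := dupA (gen d) (forest_phi (t :: ts)) (forest_phi G).
  by rewrite -IHt //; case: graft (graft_neq0 (t :: ts) G).
have [_ _ E] := dupA (forest_phi [:: Node d ts]) (forest_phi (u :: F)) (forest_phi G).
rewrite graft_cons forest_phi_cons E -IHF //.
by case: graft (graft_neq0 (u :: F) G).
Qed.

Definition phi : space H -> space A := lext (fun b : B => forest_phi (val b)).

Lemma phi_lin : linear phi. Proof. exact: linearP. Qed.

Lemma phi_vec F : phi (vF F) = forest_phi F.
Proof.
have [->|nF] := eqVneq F [::]; first by rewrite /vF vec_nil (lin0 phi_lin).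
by rewrite /vF (vecE _ nF) /phi lextU.
Qed.

Lemma phiU (b : B) : phi (<< b >> : space H) = forest_phi (val b).
Proof. by rewrite /phi lextU. Qed.

Lemma phi_dot x y : phi (dot x y) = dot (phi x) (phi y).
Proof.
apply: (@eq_tens_basis _ _ _ _ (fun x y : space H => phi (dot x y))
  (fun x y => dot (phi x) (phi y))).
- by move=> z a u w; rewrite linearP phi_lin.
- by move=> z a u w; rewrite dot_linl phi_lin.
- by move=> z a u w; rewrite phi_lin linearP.
- by move=> z a u w; rewrite phi_lin dot_linl.
move=> b c; rewrite !phiU -(forest_phi_cat (Hp_valP b) (Hp_valP c)) -phi_vec.
by rewrite -[X in dot X _](pr_vec pr) -[X in dot _ X](pr_vec pr) (@Hp_dot gens gdeg K) ?Hp_valP.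
Qed.

Lemma phi_nw x y : phi (nw x y) = nw (phi x) (phi y).
Proof.
apply: (@eq_tens_basis _ _ _ _ (fun x y : space H => phi (nw x y))
  (fun x y => nw (phi x) (phi y))).
- by move=> z a u w; rewrite linearP phi_lin.
- by move=> z a u w; rewrite nw_linl phi_lin.
- by move=> z a u w; rewrite phi_lin linearP.
- by move=> z a u w; rewrite phi_lin nw_linl.
move=> b c; rewrite !phiU -(forest_phi_graft (Hp_valP b) (Hp_valP c)) -phi_vec.
by rewrite -[X in nw X _](pr_vec pr) -[X in nw _ X](pr_vec pr) (@Hp_nw gens gdeg K) ?Hp_valP.
Qed.

Lemma forest_phi_homog F : homog (@bdeg K A) (forest_deg gdeg F) (forest_phi F).
Proof.
case: gradedA => hdot hnw _ _.
elim/forest_ind: F => [|d ts F IHt IHF]; first exact: homog0.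
have h1 : homog (@bdeg K A) (forest_deg gdeg [:: Node d ts]) (forest_phi [:: Node d ts]).
  have [_ hd _ _] := genP d; rewrite forest_phi1 forest_deg_cons.
  case: nilP => [->|_]; first by rewrite !addn0.
  by rewrite addn0; apply: hnw.
case: F IHF => // u F IHF; rewrite forest_phi_cons -cat1s forest_deg_cat.
exact: hdot.
Qed.

Lemma phi_homog n x : homog (@bdeg K H) n x -> homog (@bdeg K A) n (phi x).
Proof. by apply: homog_lext => b <-; exact: forest_phi_homog. Qed.

End Rigidity.

(** * Reassociation of triple tensors *)

Section Associator.
Variable K : fieldType.
Variables B C E : choiceType.

(** [tassoc] with three independent bases: in [kernel_cocycle] the middle factor is at one point
    itself a tensor product. *)
Definition gassoc : {malg K[(B * C * E)%type]} -> {malg K[(B * (C * E))%type]} :=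
  lext (fun p => << (p.1.1, (p.1.2, p.2)) >>).

Lemma gassoc_lin : linear gassoc.
Proof. exact: linearP. Qed.

Definition gassoc_inv : {malg K[(B * (C * E))%type]} -> {malg K[(B * C * E)%type]} :=
  lext (fun p => << (p.1, p.2.1, p.2.2) >>).

Lemma gassoc_inv_lin : linear gassoc_inv.
Proof. exact: linearP. Qed.

Lemma gassocK : cancel gassoc gassoc_inv.
Proof.
apply: (@eq_lin_basis _ _ _ (fun t => gassoc_inv (gassoc t)) id) => [a x y|//|[[a b] c]].
  by rewrite gassoc_lin gassoc_inv_lin.
by rewrite /gassoc_inv /gassoc !lextU.
Qed.

Lemma gassoc_tens (x : {malg K[B]}) (y : {malg K[C]}) (z : {malg K[E]}) :
  gassoc (tens (tens x y) z) = tens x (tens y z).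
Proof.
have lg := gassoc_lin.
apply: (@eq_lin_basis _ _ _ (fun x => gassoc (tens (tens x y) z))
  (fun x => tens x (tens y z))) => [a u v|a u v|b].
- by rewrite !tens_linl lg.
- by rewrite tens_linl.
apply: (@eq_tens_basis _ _ _ _ (fun y z => gassoc (tens (tens << b >> y) z))
  (fun y z => tens << b >> (tens y z))).
- by move=> c a u v; rewrite linearP lg.
- by move=> c a u v; rewrite linearP tens_linl lg.
- by move=> c a u v; rewrite !linearP.
- by move=> c a u v; rewrite tens_linl linearP.
by move=> c d; rewrite !tensUU /gassoc lextU.
Qed.

End Associator.

Lemma gassoc_tmap (K : fieldType) (B C E B' C' E' : choiceType)
    (f : {malg K[B]} -> {malg K[B']}) (g : {malg K[C]} -> {malg K[C']})
    (h : {malg K[E]} -> {malg K[E']}) t :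
  gassoc (tmap (tmap f g) h t) = tmap f (tmap g h) (gassoc t).
Proof.
apply: (@eq_lin_basis _ _ _ (fun t => gassoc (tmap (tmap f g) h t))
  (fun t => tmap f (tmap g h) (gassoc t))) => [a x y|a x y|[[a b] c]].
- by rewrite (tmap_lin _ _ _ _ _) gassoc_lin.
- by rewrite gassoc_lin (tmap_lin _ _ _ _ _).
by rewrite tmapU /= tmapU gassoc_tens /gassoc lextU !tmapU.
Qed.

Lemma tmap4_0l (K : fieldType) (B C B' C' : choiceType)
    (f1 f2 f3 f4 : {malg K[B]} -> {malg K[B']}) (g : {malg K[C]} -> {malg K[C']}) t :
  tmap f1 g t = 0 -> tmap f2 g t = 0 -> tmap f3 g t = 0 -> tmap f4 g t = 0 ->
  tmap (fun x => f1 x + f2 x + f3 x + f4 x) g t = 0.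
Proof. by move=> h1 h2 h3 h4; rewrite !tmapDl h1 h2 h3 h4 !addr0. Qed.

Lemma tmap4_0r (K : fieldType) (B C B' C' : choiceType)
    (f : {malg K[B]} -> {malg K[B']}) (g1 g2 g3 g4 : {malg K[C]} -> {malg K[C']}) t :
  tmap f g1 t = 0 -> tmap f g2 t = 0 -> tmap f g3 t = 0 -> tmap f g4 t = 0 ->
  tmap f (fun x => g1 x + g2 x + g3 x + g4 x) t = 0.
Proof. by move=> h1 h2 h3 h4; rewrite !tmapDr h1 h2 h3 h4 !addr0. Qed.

Lemma tassocE (K : fieldType) (B : choiceType) (t : {malg K[(B * B * B)%type]}) :
  tassoc t = gassoc t.
Proof. by []. Qed.

(* A dendriform coalgebra with coproducts p and s is cogenerated by pi as soon
   as Psi is injective: a pair (u, v) which satisfies the same relations as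
   (p x, s x) is determined by its components seen by Psi. *)
Section Kernel.
Variables (K : fieldType) (B : choiceType).
Let M := {malg K[B]}.
Let M2 := {malg K[(B * B)%type]}.
Variables (p s : M -> M2) (pi : M -> M) (J2 J3 : M2 -> M)
  (J4 : {malg K[(B * (B * B))%type]} -> M) (G : M -> M).
Hypotheses (pl : linear p) (sl : linear s) (pil : linear pi) (J2l : linear J2)
  (J3l : linear J3) (J4l : linear J4) (Gl : linear G).

Definition krho (x : M) : M2 := tmap pi id (p x).
Definition kred (x : M) : M2 := p x + s x.

Hypothesis coassoc_p : forall x, tassoc (tmap p id (p x)) = tmap id kred (p x).
Hypothesis PsiK : forall x,
  G (pi x + J2 (krho x) + J3 (tmap id pi (s x)) + J4 (tmap id krho (s x))) = x.

Let li : linear (@id M). Proof. exact: lin_id. Qed.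
Let rl : linear krho. Proof. by move=> a x y; rewrite /krho pl (tmap_lin _ _ _ _ _). Qed.
Let dl : linear kred. Proof. exact: lin_add. Qed.

Local Opaque tens tmap lext bext tassoc gassoc gassoc_inv.

(** Obtained by applying pi to the first factor of the first dendriform axiom. *)
Lemma krho_coassoc (x : M) : gassoc (tmap krho id (p x)) = tmap id kred (krho x).
Proof.
transitivity (gassoc (tmap (tmap pi id) id (tmap p id (p x)))).
  rewrite (tmap_comp _ _ _ (tmap_lin _ _) li); congr gassoc; apply: eq_tmap => b; reflexivity.
rewrite gassoc_tmap; transitivity (tmap pi (tmap id id) (tmap id kred (p x))).
  by rewrite -coassoc_p tassocE.
rewrite /krho (tmap_comp _ _ _ pil (tmap_lin _ _)) (tmap_comp _ _ _ li dl).
apply: eq_tmap => b; first [exact: tmap_id | reflexivity].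
Qed.

(** The relations move every component of Psi, applied to the left factor of u or to the right
    factor of v, to one of the three assumed zeros. Thus (Psi (x) id) u = 0 and (id (x) Psi) v = 0,
    and G inverts Psi. *)
Lemma kernel_cocycle (u v : M2) :
  tassoc (tmap p id u) = tmap id kred u ->
  tassoc (tmap s id u) = tmap id p v ->
  tassoc (tmap kred id v) = tmap id s v ->
  tmap pi id u = 0 -> tmap id pi v = 0 -> tmap id krho v = 0 -> u = 0 /\ v = 0.
Proof.
move=> c1 c2 c3 pu pv rv.
have tl (C E C' E' : choiceType) (f : {malg K[C]} -> {malg K[C']}) (g : {malg K[E]} -> {malg K[E']}) :
  linear (tmap f g) by exact: tmap_lin.
have ass := @tassocE K B.
(* (rho (x) id) u is (pi (x) id (x) id)(p (x) id) u, which the first relation turns into (id (x)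
   kred)(pi (x) id) u. *)
have u2 : tmap krho id u = 0.
  have -> : tmap krho id u = tmap (tmap pi id) id (tmap p id u).
    by rewrite (tmap_comp _ _ _ (tl _ _ _ _ _ _) li); apply: eq_tmap => b; reflexivity.
  apply: (can_inj (@gassocK _ _ _ _)); rewrite (lin0 (@gassoc_lin _ _ _ _)) gassoc_tmap -ass c1.
  rewrite (tmap_comp _ _ _ pil (tl _ _ _ _ _ _)).
  transitivity (tmap id kred (tmap pi id u)); last by rewrite pu (lin0 (tl _ _ _ _ _ _)).
  by rewrite (tmap_comp _ _ _ li dl); apply: eq_tmap => b; first [exact: tmap_id | reflexivity].
(* By the second relation this is (id (x) rho) v up to reassociation. *)
have u3 : tmap (tmap id pi \o s) id u = 0.
  have -> : tmap (tmap id pi \o s) id u = tmap (tmap id pi) id (tmap s id u).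
    by rewrite (tmap_comp s id u (tl _ _ _ _ id pi) li); apply: eq_tmap => b; reflexivity.
  apply: (can_inj (@gassocK _ _ _ _)); rewrite (lin0 (@gassoc_lin _ _ _ _)) gassoc_tmap -ass c2.
  rewrite (tmap_comp _ _ _ li (tl _ _ _ _ _ _)) -[RHS]rv; apply: eq_tmap => b; reflexivity.
(* The second relation leads to (id (x) (rho (x) id) p) v, and [krho_coassoc] then to (id (x) id (x)
   kred)(id (x) rho) v. *)
have u4 : tmap (tmap id krho \o s) id u = 0.
  have -> : tmap (tmap id krho \o s) id u = tmap (tmap id krho) id (tmap s id u).
    by rewrite (tmap_comp s id u (tl _ _ _ _ id krho) li); apply: eq_tmap => b; reflexivity.
  apply: (can_inj (@gassocK _ _ _ _)); rewrite (lin0 (@gassoc_lin _ _ _ _)) gassoc_tmap -ass c2.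
  rewrite (tmap_comp _ _ _ li (tl _ _ _ _ _ _)).
  transitivity (tmap id (@gassoc_inv K B B B) (tmap id (tmap id kred) (tmap id krho v))).
    rewrite (tmap_comp _ _ _ li (tl _ _ _ _ _ _)).
    rewrite (tmap_comp _ _ _ li (@gassoc_inv_lin _ _ _ _)).
    apply: eq_tmap => b; first reflexivity.
    by rewrite -[RHS]/(gassoc_inv (tmap id kred (krho _))) -krho_coassoc gassocK.
  by rewrite rv (lin0 (tl _ _ _ _ _ _)) (lin0 (tl _ _ _ _ _ _)).
(* The third relation gives (kred (x) pi) v, which factors through (id (x) pi) v; [v4] is the same
   with rho in place of pi. *)
have v3 : tmap id (tmap id pi \o s) v = 0.
  have -> : tmap id (tmap id pi \o s) v = tmap id (tmap id pi) (tmap id s v).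
    by rewrite (tmap_comp id s v li (tl _ _ _ _ id pi)); apply: eq_tmap => b; reflexivity.
  rewrite -c3 ass -gassoc_tmap (tmap_comp _ _ _ (tl _ _ _ _ _ _) pil).
  transitivity (gassoc (tmap kred id (tmap id pi v))).
    rewrite (tmap_comp id pi v dl li); apply: (congr1 (@gassoc _ _ _ _)).
    apply: eq_tmap => b; first [exact: tmap_id | reflexivity].
  by rewrite pv (lin0 (tl _ _ _ _ _ _)) (lin0 (@gassoc_lin _ _ _ _)).
have v4 : tmap id (tmap id krho \o s) v = 0.
  have -> : tmap id (tmap id krho \o s) v = tmap id (tmap id krho) (tmap id s v).
    by rewrite (tmap_comp id s v li (tl _ _ _ _ id krho)); apply: eq_tmap => b; reflexivity.
  rewrite -c3 ass -gassoc_tmap (tmap_comp _ _ _ (tl _ _ _ _ _ _) rl).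
  transitivity (gassoc (tmap kred id (tmap id krho v))).
    rewrite (tmap_comp id krho v dl (@lin_id _ _)); apply: (congr1 (@gassoc _ _ _ _)).
    apply: eq_tmap => b; [exact (tmap_id (kred << b >>)) | reflexivity].
  by rewrite rv (lin0 (tl _ _ _ _ _ _)) (lin0 (@gassoc_lin _ _ _ _)).
pose Ps (x : M) := pi x + J2 (krho x) + J3 (tmap id pi (s x)) + J4 (tmap id krho (s x)).
split.
  transitivity (tmap G id (tmap Ps id u)).
    rewrite (tmap_comp _ _ _ Gl li) -[LHS]tmap_id.
    apply: eq_tmap => b; [exact: esym (PsiK _) | reflexivity].
  have h2 : tmap (fun x => J2 (krho x)) id u = 0.
    transitivity (tmap J2 id (tmap krho id u)); last by rewrite u2 (lin0 (tl _ _ _ _ J2 id)).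
    by rewrite (tmap_comp krho id u J2l li); apply: eq_tmap => b; reflexivity.
  have h3 : tmap (fun x => J3 (tmap id pi (s x))) id u = 0.
    transitivity (tmap J3 id (tmap (tmap id pi \o s) id u)); last first.
      by rewrite u3 (lin0 (tl _ _ _ _ J3 id)).
    by rewrite (tmap_comp (tmap id pi \o s) id u J3l li); apply: eq_tmap => b; reflexivity.
  have h4 : tmap (fun x => J4 (tmap id krho (s x))) id u = 0.
    transitivity (tmap J4 id (tmap (tmap id krho \o s) id u)); last first.
      by rewrite u4 (lin0 (tl _ _ _ _ J4 id)).
    by rewrite (tmap_comp (tmap id krho \o s) id u J4l li); apply: eq_tmap => b; reflexivity.
  apply: etrans (congr1 (tmap G id) _) (lin0 (tl _ _ _ _ G id)).
  exact: tmap4_0l pu h2 h3 h4.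
transitivity (tmap id G (tmap id Ps v)).
  rewrite (tmap_comp _ _ _ li Gl) -[LHS]tmap_id.
  apply: eq_tmap => b; [reflexivity | exact: esym (PsiK _)].
have h2 : tmap id (fun x => J2 (krho x)) v = 0.
  transitivity (tmap id J2 (tmap id krho v)); last by rewrite rv (lin0 (tl _ _ _ _ id J2)).
  by rewrite (tmap_comp id krho v li J2l); apply: eq_tmap => b; reflexivity.
have h3 : tmap id (fun x => J3 (tmap id pi (s x))) v = 0.
  transitivity (tmap id J3 (tmap id (tmap id pi \o s) v)); last first.
    by rewrite v3 (lin0 (tl _ _ _ _ id J3)).
  by rewrite (tmap_comp id (tmap id pi \o s) v li J3l); apply: eq_tmap => b; reflexivity.
have h4 : tmap id (fun x => J4 (tmap id krho (s x))) v = 0.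
  transitivity (tmap id J4 (tmap id (tmap id krho \o s) v)); last first.
    by rewrite v4 (lin0 (tl _ _ _ _ id J4)).
  by rewrite (tmap_comp id (tmap id krho \o s) v li J4l); apply: eq_tmap => b; reflexivity.
apply: etrans (congr1 (tmap id G) _) (lin0 (tl _ _ _ _ id G)).
exact: tmap4_0r pv h2 h3 h4.
Qed.

End Kernel.

Lemma tmap_id_supp (K : fieldType) (B C : choiceType) (f : {malg K[B]} -> {malg K[B]})
    (g : {malg K[C]} -> {malg K[C]}) (t : {malg K[(B * C)%type]}) :
  (forall q, q \in msupp t -> f << q.1 >> = << q.1 >> /\ g << q.2 >> = << q.2 >>) ->
  tmap f g t = t.
Proof.
move=> fg; rewrite -[RHS]lextU_id /tmap /lext big_seq [RHS]big_seq.
by apply: eq_bigr => -[b c] /fg /= [-> ->]; rewrite tensUU.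
Qed.

Lemma ltn_addpr a b : (0 < b -> a < a + b)%N.
Proof. by move=> b0; rewrite -{1}[a]addn0 ltn_add2l. Qed.

Lemma ltn_addpl a b : (0 < b -> a < b + a)%N.
Proof. by rewrite addnC; exact: ltn_addpr. Qed.

(** * Bijectivity by induction on the degree *)

Section Bijection.
Variables (K : fieldType) (H A : based K) (phi : space H -> space A).
Notation degH := (@bdeg K H).
Notation degA := (@bdeg K A).
Hypotheses (phi_lin : linear phi)
  (phi_homog : forall n x, homog degH n x -> homog degA n (phi x))
  (phi_coalg : forall x, coalg phi x)
  (degH_gt0 : forall b, (0 < degH b)%N) (degA_gt0 : forall b, (0 < degA b)%N)
  (coalgH : dendriform_coalgebra H) (coalgA : dendriform_coalgebra A)
  (gradedH : DupDend_graded H) (gradedA : DupDend_graded A).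
Variables (pi : space H -> space H) (J2 J3 : space2 H -> space H)
  (J4 : {malg K[(bas H * (bas H * bas H))%type]} -> space H) (G : space H -> space H).
Notation rh := (krho (@dprec K H) pi).
Hypotheses (pi_lin : linear pi) (J2_lin : linear J2) (J3_lin : linear J3)
  (J4_lin : linear J4) (G_lin : linear G)
  (pi_homog : forall n x, homog degH n x -> homog degH n (pi x))
  (J2_homog : forall n x, homog (deg_pair degH degH) n x -> homog degH n (J2 x))
  (J3_homog : forall n x, homog (deg_pair degH degH) n x -> homog degH n (J3 x))
  (J4_homog : forall n x, homog (deg_pair degH (deg_pair degH degH)) n x ->
     homog degH n (J4 x))
  (G_homog : forall n x, homog degH n x -> homog degH n (G x)).

Let Psi x := pi x + J2 (rh x) + J3 (tmap id pi (dsucc x)) + J4 (tmap id rh (dsucc x)).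

Hypotheses (PsiK : cancel Psi G) (GK : cancel G Psi)
  (separation : forall x t s t' s',
     pi x + J2 (tmap pi id t) + J3 (tmap id pi s) + J4 (tmap id rh s) =
     J2 (tmap pi id t') + J3 (tmap id pi s') + J4 (tmap id rh s') ->
     [/\ tmap pi id t = tmap pi id t', tmap id pi s = tmap id pi s'
       & tmap id rh s = tmap id rh s'])
  (pi_prim : forall x, prim (pi x)) (pi_pi : forall x, pi (pi x) = pi x)
  (prim_span : forall n y, prim y -> homog degA n y ->
     exists2 x, homog degH n x & phi x = y)
  (vertex_inj : forall x, phi (pi x) = 0 -> pi x = 0).

Local Opaque tens tmap tmap2 dot nw lext bext dprec dsucc tassoc gassoc krho.

Let tl (C E C' E' : choiceType) (f : {malg K[C]} -> {malg K[C']})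
    (g : {malg K[E]} -> {malg K[E']}) : linear (tmap f g).
Proof. exact: tmap_lin. Qed.
Let dp : linear (@dprec K H). Proof. exact: linearP. Qed.
Let ds : linear (@dsucc K H). Proof. exact: linearP. Qed.
Let dpA : linear (@dprec K A). Proof. exact: linearP. Qed.
Let dsA : linear (@dsucc K A). Proof. exact: linearP. Qed.
Let drA : linear (@dred K A). Proof. exact: linearP. Qed.
Let li (B : choiceType) : linear (@id {malg K[B]}). Proof. exact: lin_id. Qed.

Lemma dprec_homog n x : homog degH n x -> homog (deg_pair degH degH) n (dprec x).
Proof. by case: gradedH => _ _ h _; exact: h. Qed.

Lemma dsucc_homog n x : homog degH n x -> homog (deg_pair degH degH) n (dsucc x).
Proof. by case: gradedH => _ _ _ h; exact: h. Qed.

Lemma dred_homog n x : homog degH n x -> homog (deg_pair degH degH) n (dred x).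
Proof. by move=> hx; apply: homogD; [exact: dprec_homog | exact: dsucc_homog]. Qed.

Lemma rho_homog n x : homog degH n x -> homog (deg_pair degH degH) n (rh x).
Proof.
move=> hx; apply: homog_tmap (dprec_homog hx) => b.
  by apply: pi_homog; exact: homogU.
exact: homogU.
Qed.

(** g is linear and homogeneous everywhere, but inverse to phi only below degree n. Since all
    degrees are positive, this covers the factors of any tensor of degree n, in particular of
    coproducts in degree n. *)
Definition partial_inverse n (g : space A -> space H) : Prop :=
  [/\ linear g, forall b, homog degH (degA b) (g << b >>),
      forall b, (degA b < n)%N -> phi (g << b >>) = << b >>
    & forall b, (degH b < n)%N -> g (phi << b >>) = << b >>].

Section Step.
Variables (n : nat) (g : space A -> space H).
Hypothesis gP : partial_inverse n g.

Let gl : linear g. Proof. by case: gP. Qed.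

Lemma tmap_phi_g t : homog (deg_pair degA degA) n t -> tmap phi phi (tmap g g t) = t.
Proof.
case: gP => _ _ h _ ht; rewrite (tmap_comp _ _ _ phi_lin phi_lin).
apply: tmap_id_supp => q /ht dq; have := degA_gt0 q.1; have := degA_gt0 q.2.
by move=> q2 q1; split; apply: h; rewrite -dq /deg_pair; [exact: ltn_addpr | exact: ltn_addpl].
Qed.

Lemma tmap_g_phi t : homog (deg_pair degH degH) n t -> tmap g g (tmap phi phi t) = t.
Proof.
case: gP => _ _ _ h ht; rewrite (tmap_comp _ _ _ gl gl).
apply: tmap_id_supp => q /ht dq; have := degH_gt0 q.1; have := degH_gt0 q.2.
by move=> q2 q1; split; apply: h; rewrite -dq /deg_pair; [exact: ltn_addpr | exact: ltn_addpl].
Qed.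

Lemma tmap3_g_phi t : homog (deg_pair degH (deg_pair degH degH)) n t ->
  tmap g (tmap g g) (tmap phi (tmap phi phi) t) = t.
Proof.
case: gP => _ _ _ h ht; rewrite (tmap_comp _ _ _ gl (tl _ _)).
apply: tmap_id_supp => q /ht; rewrite /deg_pair /= => dq.
have := degH_gt0 q.1; have := degH_gt0 q.2.1; have := degH_gt0 q.2.2 => q3 q2 q1.
split; first by apply: h; rewrite -dq; apply: ltn_addpr; rewrite addn_gt0 q2.
rewrite /= (tmapU phi phi q.2) (tmap_tens _ _ gl gl) !h ?tensUU; first by case: (q.2).
  by rewrite -dq addnA; apply: ltn_addpl; rewrite addn_gt0 q1.
by rewrite -dq addnCA; apply: ltn_addpr; rewrite addn_gt0 q1.
Qed.

(** With [pull_right], transports the two sides of a dendriform axiom from A to H: phi intertwines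
    the coproducts, and g undoes phi on triple tensors of degree n. *)
Lemma pull_left (DA : space A -> space2 A) (DH : space H -> space2 H) t :
  (forall x, tmap phi phi (DH x) = DA (phi x)) -> linear DA ->
  (forall m x, homog degH m x -> homog (deg_pair degH degH) m (DH x)) ->
  homog (deg_pair degH degH) n t ->
  tmap g (tmap g g) (tassoc (tmap DA id (tmap phi phi t))) = tassoc (tmap DH id t).
Proof.
move=> hD lD hh ht.
transitivity (tmap g (tmap g g) (tmap phi (tmap phi phi) (tassoc (tmap DH id t)))).
  apply: (congr1 (tmap g (tmap g g))).
  rewrite !tassocE -gassoc_tmap; apply: (congr1 (@gassoc _ _ _ _)).
  rewrite (tmap_comp _ _ _ lD (@li _)) (tmap_comp _ _ _ (tl _ _) phi_lin).
  by apply: eq_tmap => b; [exact: esym (hD _) | reflexivity].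
apply: tmap3_g_phi; rewrite tassocE.
have : homog (deg_pair (deg_pair degH degH) degH) n (tmap DH id t).
  by apply: homog_tmap ht => b; [apply: hh; exact: homogU | exact: homogU].
apply: homog_lext => -[[a b] c] <-; apply: homogU; exact: addnA.
Qed.

Lemma pull_right (DA : space A -> space2 A) (DH : space H -> space2 H) t :
  (forall x, tmap phi phi (DH x) = DA (phi x)) -> linear DA ->
  (forall m x, homog degH m x -> homog (deg_pair degH degH) m (DH x)) ->
  homog (deg_pair degH degH) n t ->
  tmap g (tmap g g) (tmap id DA (tmap phi phi t)) = tmap id DH t.
Proof.
move=> hD lD hh ht.
transitivity (tmap g (tmap g g) (tmap phi (tmap phi phi) (tmap id DH t))).
  apply: (congr1 (tmap g (tmap g g))).
  rewrite (tmap_comp _ _ _ (@li _) lD) (tmap_comp _ _ _ phi_lin (tl _ _)).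
  by apply: eq_tmap => b; [reflexivity | exact: esym (hD _)].
apply: tmap3_g_phi.
by apply: homog_tmap ht => b; [exact: homogU | apply: hh; exact: homogU].
Qed.

Lemma surj_step b : degA b = n -> exists2 x, homog degH n x & phi x = << b >>.
Proof.
move=> db; have [_ gh _ _] := gP; pose y : space A := << b >>.
have hy : homog degA n y by exact: homogU.
have [_ _ hpA hsA] := gradedA.
(* The coproducts that a preimage of y ought to have. *)
pose u0 := tmap g g (dprec y); pose v0 := tmap g g (dsucc y).
have hu0 : homog (deg_pair degH degH) n u0 by apply: homog_tmap (hpA n y hy).
have hv0 : homog (deg_pair degH degH) n v0 by apply: homog_tmap (hsA n y hy).
pose w := J2 (tmap pi id u0) + J3 (tmap id pi v0) + J4 (tmap id rh v0).
have hpi c : homog degH (degH c) (pi << c >>) by apply: pi_homog; exact: homogU.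
have hid c : homog degH (degH c) (<< c >> : space H) by exact: homogU.
have hrh c : homog (deg_pair degH degH) (degH c) (rh << c >>) by exact: rho_homog.
have hw : homog degH n w.
  apply: homogD; first apply: homogD.
  - by apply/J2_homog/(homog_tmap hpi hid).
  - by apply/J3_homog/(homog_tmap hid hpi).
  by apply/J4_homog/(homog_tmap hid hrh).
(* So Psi x = w. Whatever pi x may be, [separation] gives the coproducts of x the same components as
   u0 and v0. *)
pose x := G w; have hx : homog degH n x by exact: G_homog.
have [e2 e3 e4] : [/\ tmap pi id (dprec x) = tmap pi id u0, tmap id pi (dsucc x) = tmap id pi v0
       & tmap id rh (dsucc x) = tmap id rh v0].
  by apply: (separation (x := x)); exact: GK.
pose a := y - phi x; pose u := u0 - dprec x; pose v := v0 - dsucc x.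
have ha : homog degA n a by apply: homogB => //; exact: phi_homog.
have hu : homog (deg_pair degH degH) n u by apply: homogB => //; exact: dprec_homog.
have hv : homog (deg_pair degH degH) n v by apply: homogB => //; exact: dsucc_homog.
have cp z : tmap phi phi (dprec z) = dprec (phi z) by case: (phi_coalg z).
have cs z : tmap phi phi (dsucc z) = dsucc (phi z) by case: (phi_coalg z).
have cr z : tmap phi phi (dred z) = dred (phi z) by exact: coalg_red (phi_coalg z).
have uE : tmap phi phi u = dprec a.
  by rewrite /u /u0 (linB (tl _ _)) cp tmap_phi_g ?(linB dpA) //; exact: hpA.
have vE : tmap phi phi v = dsucc a.
  by rewrite /v /v0 (linB (tl _ _)) cs tmap_phi_g ?(linB dsA) //; exact: hsA.
(* The dendriform axioms at a, pulled back along g, are the relations between u and v. *)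
have [c1 c2 c3] := coalgA a; rewrite -uE -vE in c1 c2 c3.
have k1 : tassoc (tmap (@dprec K H) id u) = tmap id (@dred K H) u.
  apply: etrans (esym (pull_left cp dpA dprec_homog hu)) _.
  by rewrite c1; exact: pull_right cr drA dred_homog hu.
have k2 : tassoc (tmap (@dsucc K H) id u) = tmap id (@dprec K H) v.
  apply: etrans (esym (pull_left cs dsA dsucc_homog hu)) _.
  by rewrite c2; exact: pull_right cp dpA dprec_homog hv.
have k3 : tassoc (tmap (@dred K H) id v) = tmap id (@dsucc K H) v.
  apply: etrans (esym (pull_left cr drA dred_homog hv)) _.
  by rewrite c3; exact: pull_right cs dsA dsucc_homog hv.
have k4 : tmap pi id u = 0 by rewrite /u (linB (tl _ _)) e2 subrr.
have k5 : tmap id pi v = 0 by rewrite /v (linB (tl _ _)) e3 subrr.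
have k6 : tmap id rh v = 0 by rewrite /v (linB (tl _ _)) e4 subrr.
have coH z : tassoc (tmap (@dprec K H) id (dprec z)) = tmap id (@dred K H) (dprec z).
  by have [c _ _] := coalgH z.
have [u_eq0 v_eq0] := kernel_cocycle dp ds pi_lin J2_lin J3_lin J4_lin G_lin coH PsiK
  k1 k2 k3 k4 k5 k6.
have pa : prim a by split; rewrite -?uE -?vE ?u_eq0 ?v_eq0 (lin0 (tl _ _)).
have [z hz zE] := prim_span pa ha; exists (x + z); first exact: homogD.
by rewrite (linD phi_lin) zE /a addrC subrK.
Qed.

(** Below degree n phi has the left inverse g, so both coproducts of z vanish and Psi z = pi z. The
    same holds for pi z, which is primitive and fixed by pi; hence z = pi z, a combination of
    vertices. *)
Lemma inj_step z : homog degH n z -> phi z = 0 -> z = 0.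
Proof.
move=> hz z0; have [cp cs] := phi_coalg z.
have p0 : dprec z = 0.
  by rewrite -[LHS]tmap_g_phi ?cp ?z0 ?(lin0 dpA) ?(lin0 (tl _ _)) //; exact: dprec_homog.
have s0 : dsucc z = 0.
  by rewrite -[LHS]tmap_g_phi ?cs ?z0 ?(lin0 dsA) ?(lin0 (tl _ _)) //; exact: dsucc_homog.
have PsiE x : prim x -> Psi x = pi x.
  case=> px sx; rewrite /Psi sx !(lin0 (tl _ _)) (lin0 J3_lin) (lin0 J4_lin) !addr0.
  by rewrite -[rh x]/(tmap pi id (dprec x)) px (lin0 (tl _ _)) (lin0 J2_lin) addr0.
have zE : z = pi z.
  rewrite -[LHS]PsiK -[RHS]PsiK; apply: (congr1 G).
  by rewrite (PsiE z) // (PsiE (pi z)) ?pi_pi.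
by rewrite zE; apply: vertex_inj; rewrite -zE.
Qed.

End Step.

(** Both statements are proved together: injectivity in degree n uses the partial inverse below n,
    and the extended g is a left inverse in degree n by injectivity there. *)
Lemma partial_inverse_ex n : exists g, partial_inverse n g /\
  forall m z, (m < n)%N -> homog degH m z -> phi z = 0 -> z = 0.
Proof.
elim: n => [|n [g [gP inj]]].
  exists (fun=> 0); split=> //; split=> // [a x y|b].
    by rewrite scaler0 addr0.
  exact: homog0.
have inj' m z : (m < n.+1)%N -> homog degH m z -> phi z = 0 -> z = 0.
  rewrite ltnS leq_eqVlt => /predU1P[->|]; last exact: inj.
  exact: inj_step gP _.
have [gl gh gk _] := gP.
have ex b : exists x, homog degH (degA b) x /\ ((degA b < n.+1)%N -> phi x = << b >>).
  have [db|nb] := eqVneq (degA b) n.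
    by have [x hx xE] := surj_step gP db; exists x; rewrite db.
  by exists (g << b >>); split=> //; rewrite ltnS leq_eqVlt (negPf nb); exact: gk.
pose f b := proj1_sig (constructive_indefinite_description _ (ex b)).
have fP b : homog degH (degA b) (f b) /\ ((degA b < n.+1)%N -> phi (f b) = << b >>).
  exact: proj2_sig (constructive_indefinite_description _ (ex b)).
have fl : linear (lext f) by exact: linearP.
exists (lext f); split=> //; split=> // [b|b|c].
- by rewrite lextU; have [] := fP b.
- by move=> bn; rewrite lextU; have [_ ->] := fP b.
move=> cn; have hc : homog degA (degH c) (phi << c >>).
  by apply: phi_homog; exact: homogU.
apply/eqP; rewrite -subr_eq0; apply/eqP/(inj' _ _ cn).
  apply: homogB; last exact: homogU.
  by apply: homog_lext hc => b <-; have [] := fP b.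
rewrite (linB phi_lin); apply/eqP; rewrite subr_eq0; apply/eqP.
rewrite [X in lext f X]malg_sumE (lin_sum fl) (lin_sum phi_lin) [RHS]malg_sumE.
apply: eq_big_seq => b bc; rewrite (linZ fl) (linZ phi_lin) lextU.
by have [_ -> //] := fP b; rewrite (hc b bc).
Qed.

(** The preimage of b is taken from the partial inverse of level [degA b + 1]; injectivity in each
    degree makes the resulting right inverse a left inverse. *)
Theorem bijection : exists f : space A -> space H,
  [/\ linear f, cancel f phi, cancel phi f &
      forall n x, homog degA n x -> homog degH n (f x)].
Proof.
have ex b : exists x, homog degH (degA b) x /\ phi x = << b >>.
  have [g [[_ gh gk _] _]] := partial_inverse_ex (degA b).+1.
  by exists (g << b >>); split=> //; exact: gk.
pose f b := proj1_sig (constructive_indefinite_description _ (ex b)).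
have fP b : homog degH (degA b) (f b) /\ phi (f b) = << b >>.
  exact: proj2_sig (constructive_indefinite_description _ (ex b)).
have fl : linear (lext f) by exact: linearP.
have fK : cancel (lext f) phi.
  apply: (@eq_lin_basis _ _ _ (fun x => phi (lext f x)) id) => [a x y|//|b].
    by rewrite fl phi_lin.
  by rewrite lextU; have [] := fP b.
have fh n x : homog degA n x -> homog degH n (lext f x).
  by apply: homog_lext => b <-; have [] := fP b.
exists (lext f); split=> //.
apply: (@eq_lin_basis _ _ _ (fun x => lext f (phi x)) id) => [a x y|//|b].
  by rewrite phi_lin fl.
have [g [_ inj]] := partial_inverse_ex (degH b).+1.
apply/eqP; rewrite -subr_eq0; apply/eqP/(inj (degH b)) => //.
  by apply: homogB; [apply/fh/phi_homog; exact: homogU | exact: homogU].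
by rewrite (linB phi_lin) fK subrr.
Qed.

End Bijection.

Lemma lin_eq4 (K : fieldType) (U W : lmodType K) (f : U -> W) (p a b c a' b' c' : U)
    (x y z x' y' z' : W) :
  linear f -> p + a + b + c = a' + b' + c' -> f p = 0 ->
  f a = x -> f b = y -> f c = z -> f a' = x' -> f b' = y' -> f c' = z' ->
  x + y + z = x' + y' + z'.
Proof.
by move=> fl E p0 <- <- <- <- <- <-; rewrite -!(linD fl) -E !(linD fl) p0 add0r.
Qed.

Lemma add_zeros (U : zmodType) (x y : U) :
  [/\ x + 0 + 0 = y + 0 + 0 -> x = y, 0 + x + 0 = 0 + y + 0 -> x = y
    & 0 + 0 + x = 0 + 0 + y -> x = y].
Proof. by rewrite !addr0 !add0r. Qed.

(** * Telling the terms of Psi apart *)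

Section Separation.
Variables (D : choiceType) (deg : D -> nat) (K : fieldType).
Notation forest := (seq (ptree D)).
Let H := Hp deg K.
Let B := bas H.
Let vF : forest -> space H := vec K (@hp_basis D).
Let pr := Hp_presentation deg K.
Local Opaque J2 J3 J4.
Notation pi := (@pi_vertex D deg K).
Notation rh := (@rho D deg K).
Notation J2 := (@J2 D deg K).
Notation J3 := (@J3 D deg K).
Notation J4 := (@J4 D deg K).

Local Opaque tens tmap tmap2 dot nw lext bext dprec dsucc rho pi_vertex.

Let tl (C E C' E' : choiceType) (f : {malg K[C]} -> {malg K[C']})
    (g : {malg K[E]} -> {malg K[E']}) : linear (tmap f g).
Proof. exact: tmap_lin. Qed.
Let pl : linear pi. Proof. exact: pi_lin. Qed.
Let rl : linear rh. Proof. exact: rho_lin. Qed.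
Let li (C : choiceType) : linear (@id {malg K[C]}). Proof. exact: lin_id. Qed.

(** J2 produces forests with only L empty, J3 with only R empty, J4 with neither empty, pi with
    both. Each of [sep2], [sep3], [sep4] returns the tensor from which such a forest was assembled;
    on the other kinds it vanishes, by its test or because [vec] is 0 at the empty forest. *)
Definition sep2 : space H -> space2 H := lext (fun b : B =>
  if nilp (dec (val b)).1 then tens (vF (rt (val b))) (vF (dec (val b)).2) else 0).
Definition sep3 : space H -> space2 H := lext (fun b : B =>
  if nilp (dec (val b)).2 then tens (vF (dec (val b)).1) (vF (rt (val b))) else 0).
Definition sep4 : space H -> {malg K[(B * (B * B))%type]} := lext (fun b : B =>
  tens (vF (dec (val b)).1) (tens (vF (rt (val b))) (vF (dec (val b)).2))).

Lemma sep2_lin : linear sep2. Proof. exact: linearP. Qed.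
Lemma sep3_lin : linear sep3. Proof. exact: linearP. Qed.
Lemma sep4_lin : linear sep4. Proof. exact: linearP. Qed.

Lemma vF_val (b : B) : vF (val b) = << b >>.
Proof. exact: (pr_vec pr b). Qed.

Lemma vF_nil : vF [::] = 0.
Proof. exact: (pr_vec0 pr). Qed.

Lemma sep2_vec F : F != [::] ->
  sep2 (vF F) = if nilp (dec F).1 then tens (vF (rt F)) (vF (dec F).2) else 0.
Proof. by move=> nF; rewrite /vF (vecE _ nF) /sep2 lextU. Qed.

Lemma sep3_vec F : F != [::] ->
  sep3 (vF F) = if nilp (dec F).2 then tens (vF (dec F).1) (vF (rt F)) else 0.
Proof. by move=> nF; rewrite /vF (vecE _ nF) /sep3 lextU. Qed.

Lemma sep4_vec F : F != [::] ->
  sep4 (vF F) = tens (vF (dec F).1) (tens (vF (rt F)) (vF (dec F).2)).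
Proof. by move=> nF; rewrite /vF (vecE _ nF) /sep4 lextU. Qed.

Lemma pi_basis (b : B) : pi (<< b >> : space H) = if single (val b) then << b >> else 0.
Proof. by rewrite -vF_val pi_vec. Qed.

Lemma rho_basis (b : B) :
  rh (<< b >> : space H) = tens (vF (rt (val b))) (vF (del (val b))).
Proof. by rewrite -vF_val rho_vec. Qed.

Lemma single_leaf (F : forest) : single F -> exists d, F = [:: leaf d].
Proof. by case: F => // -[d [|? ?]] [|? ?] // _; exists d. Qed.

Lemma J2_basis (b c : B) : (exists d,
    tmap pi id (<< (b, c) >> : space2 H) = tens (vF [:: leaf d]) (vF (val c)) /\
    J2 (tmap pi id (<< (b, c) >> : space2 H)) = vF (graft0 (val c) (rcons [::] (leaf d)))) \/
  (tmap pi id (<< (b, c) >> : space2 H) = 0).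
Proof.
have tE : tmap pi id (<< (b, c) >> : space2 H) = tens (pi (<< b >> : space H)) (<< c >> : space H).
  by rewrite -tensUU (tmap_tens _ _ pl (@li _)).
rewrite tE pi_basis; case: ifP => [/single_leaf[d bd]|_]; last by right; rewrite tens0l.
left; exists d; split; first (rewrite -bd (vF_val b) (vF_val c); reflexivity).
rewrite J2_tens (graft0_graft _ (@Hp_valP D deg K c)).
rewrite -!vF_val bd.
by apply: Hp_nw; [exact: Hp_valP | by []].
Qed.

Lemma J3_basis (b c : B) : (exists d,
    tmap id pi (<< (b, c) >> : space2 H) = tens (vF (val b)) (vF [:: leaf d]) /\
    J3 (tmap id pi (<< (b, c) >> : space2 H)) = vF (graft0 [::] (rcons (val b) (leaf d)))) \/
  (tmap id pi (<< (b, c) >> : space2 H) = 0).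
Proof.
have tE : tmap id pi (<< (b, c) >> : space2 H) = tens (<< b >> : space H) (pi (<< c >> : space H)).
  by rewrite -tensUU (tmap_tens _ _ (@li _) pl).
rewrite tE pi_basis; case: ifP => [/single_leaf[d cd]|_]; last by right; rewrite tens0r.
left; exists d; split; first (rewrite -cd (vF_val b) (vF_val c); reflexivity).
rewrite J3_tens -!vF_val cd -cats1.
by apply: Hp_dot; [exact: Hp_valP | by []].
Qed.

Lemma J4_basis (b c : B) : (exists d, [/\ del (val c) != [::],
    tmap id rh (<< (b, c) >> : space2 H) =
    tens (vF (val b)) (tens (vF [:: leaf d]) (vF (del (val c)))) &
    J4 (tmap id rh (<< (b, c) >> : space2 H)) =
    vF (graft0 (del (val c)) (rcons (val b) (leaf d)))]) \/
  (tmap id rh (<< (b, c) >> : space2 H) = 0).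
Proof.
have tE : tmap id rh (<< (b, c) >> : space2 H) = tens (<< b >> : space H) (rh (<< c >> : space H)).
  by rewrite -tensUU (tmap_tens _ _ (@li _) rl).
rewrite tE rho_basis; have [->|nd] := eqVneq (del (val c)) [::].
  by right; rewrite vF_nil !tens0r.
have /single_leaf[d rtE] := rt_single (@Hp_valP D deg K c).
left; exists d; split; [by [] | rewrite rtE (vF_val b); reflexivity |].
rewrite J4_tens rtE (graft0_graft _ nd) -(vF_val b) -cats1.
rewrite [X in nw _ X](_ : _ = vF (val b ++ [:: leaf d])); last first.
  by apply: Hp_dot; [exact: Hp_valP | by []].
apply: Hp_nw; first exact: nd.
by case: (val b).
Qed.

Lemma sep_basis R L d :
  [/\ sep2 (vF (graft0 R (rcons L (leaf d)))) =
        if nilp L then tens (vF [:: leaf d]) (vF R) else 0,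
      sep3 (vF (graft0 R (rcons L (leaf d)))) =
        if nilp R then tens (vF L) (vF [:: leaf d]) else 0
    & sep4 (vF (graft0 R (rcons L (leaf d)))) =
        tens (vF L) (tens (vF [:: leaf d]) (vF R))].
Proof.
have nF : graft0 R (rcons L (leaf d)) != [::].
  by rewrite graft0_eq0 (negPf (rcons_neq0 _ _)) andbF.
rewrite (sep2_vec nF) (sep3_vec nF) (sep4_vec nF) dec_graft0 rt_graft0.
split; reflexivity.
Qed.

Lemma sep_pi x : [/\ sep2 (pi x) = 0, sep3 (pi x) = 0 & sep4 (pi x) = 0].
Proof.
have b0 (b : B) : [/\ sep2 (pi << b >>) = 0, sep3 (pi << b >>) = 0 & sep4 (pi << b >>) = 0].
  rewrite pi_basis; case: ifP => [/single_leaf[d bd]|_]; last first.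
    rewrite (lin0 sep2_lin) (lin0 sep3_lin) (lin0 sep4_lin); split; reflexivity.
  have [h2 h3 h4] := sep_basis [::] [::] d.
  rewrite -vF_val bd h2 h3 h4 vF_nil !tens0l tens0r; split; reflexivity.
split.
- apply: (@eq_lin_basis _ _ _ (fun x => sep2 (pi x)) (fun=> 0)) => [a y z|a y z|b].
  + by rewrite pl sep2_lin.
  + by rewrite scaler0 addr0.
  have [h2 h3 h4] := b0 b; exact: h2.
- apply: (@eq_lin_basis _ _ _ (fun x => sep3 (pi x)) (fun=> 0)) => [a y z|a y z|b].
  + by rewrite pl sep3_lin.
  + by rewrite scaler0 addr0.
  have [h2 h3 h4] := b0 b; exact: h3.
apply: (@eq_lin_basis _ _ _ (fun x => sep4 (pi x)) (fun=> 0)) => [a y z|a y z|b].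
+ by rewrite pl sep4_lin.
+ by rewrite scaler0 addr0.
have [h2 h3 h4] := b0 b; exact: h4.
Qed.

Lemma sep_J2 t : [/\ sep2 (J2 (tmap pi id t)) = tmap pi id t,
  sep3 (J2 (tmap pi id t)) = 0 & sep4 (J2 (tmap pi id t)) = 0].
Proof.
have b0 (q : B * B) : [/\ sep2 (J2 (tmap pi id << q >>)) = tmap pi id << q >>,
    sep3 (J2 (tmap pi id << q >>)) = 0 & sep4 (J2 (tmap pi id << q >>)) = 0].
  case: q => b c; have [[d [tE JE]]|tE] := J2_basis b c; last first.
    rewrite tE (lin0 (@J2_lin D deg K)) (lin0 sep2_lin) (lin0 sep3_lin) (lin0 sep4_lin).
    split; reflexivity.
  have [h2 h3 h4] := sep_basis (val c) [::] d.
  rewrite JE h2 h3 h4 tE vF_nil !tens0l; split; [reflexivity | | reflexivity].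
  by rewrite /nilp size_eq0 (negPf (@Hp_valP D deg K c)).
have Jl := @J2_lin D deg K; split.
- apply: (@eq_lin_basis _ _ _ (fun t => sep2 (J2 (tmap pi id t))) (tmap pi id)) => [a y z||q].
  + by rewrite tl Jl sep2_lin.
  + exact: tl.
  have [h2 h3 h4] := b0 q; exact: h2.
- apply: (@eq_lin_basis _ _ _ (fun t => sep3 (J2 (tmap pi id t))) (fun=> 0)) => [a y z|a y z|q].
  + by rewrite tl Jl sep3_lin.
  + by rewrite scaler0 addr0.
  have [h2 h3 h4] := b0 q; exact: h3.
apply: (@eq_lin_basis _ _ _ (fun t => sep4 (J2 (tmap pi id t))) (fun=> 0)) => [a y z|a y z|q].
+ by rewrite tl Jl sep4_lin.
+ by rewrite scaler0 addr0.
have [h2 h3 h4] := b0 q; exact: h4.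
Qed.

Lemma sep_J3 t : [/\ sep2 (J3 (tmap id pi t)) = 0,
  sep3 (J3 (tmap id pi t)) = tmap id pi t & sep4 (J3 (tmap id pi t)) = 0].
Proof.
have b0 (q : B * B) : [/\ sep2 (J3 (tmap id pi << q >>)) = 0,
    sep3 (J3 (tmap id pi << q >>)) = tmap id pi << q >> & sep4 (J3 (tmap id pi << q >>)) = 0].
  case: q => b c; have [[d [tE JE]]|tE] := J3_basis b c; last first.
    rewrite tE (lin0 (@J3_lin D deg K)) (lin0 sep2_lin) (lin0 sep3_lin) (lin0 sep4_lin).
    split; reflexivity.
  have [h2 h3 h4] := sep_basis [::] (val b) d.
  rewrite JE h2 h3 h4 tE vF_nil !tens0r; split; [| reflexivity | reflexivity].
  by rewrite /nilp size_eq0 (negPf (@Hp_valP D deg K b)).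
have Jl := @J3_lin D deg K; split.
- apply: (@eq_lin_basis _ _ _ (fun t => sep2 (J3 (tmap id pi t))) (fun=> 0)) => [a y z|a y z|q].
  + by rewrite tl Jl sep2_lin.
  + by rewrite scaler0 addr0.
  have [h2 h3 h4] := b0 q; exact: h2.
- apply: (@eq_lin_basis _ _ _ (fun t => sep3 (J3 (tmap id pi t))) (tmap id pi)) => [a y z||q].
  + by rewrite tl Jl sep3_lin.
  + exact: tl.
  have [h2 h3 h4] := b0 q; exact: h3.
apply: (@eq_lin_basis _ _ _ (fun t => sep4 (J3 (tmap id pi t))) (fun=> 0)) => [a y z|a y z|q].
+ by rewrite tl Jl sep4_lin.
+ by rewrite scaler0 addr0.
have [h2 h3 h4] := b0 q; exact: h4.
Qed.

Lemma sep_J4 t : [/\ sep2 (J4 (tmap id rh t)) = 0,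
  sep3 (J4 (tmap id rh t)) = 0 & sep4 (J4 (tmap id rh t)) = tmap id rh t].
Proof.
have b0 (q : B * B) : [/\ sep2 (J4 (tmap id rh << q >>)) = 0,
    sep3 (J4 (tmap id rh << q >>)) = 0 & sep4 (J4 (tmap id rh << q >>)) = tmap id rh << q >>].
  case: q => b c; have [[d [nd tE JE]]|tE] := J4_basis b c; last first.
    rewrite tE (lin0 (@J4_lin D deg K)) (lin0 sep2_lin) (lin0 sep3_lin) (lin0 sep4_lin).
    split; reflexivity.
  have [h2 h3 h4] := sep_basis (del (val c)) (val b) d.
  rewrite JE h2 h3 h4 tE; split; [| | reflexivity].
    by rewrite /nilp size_eq0 (negPf (@Hp_valP D deg K b)).
  by rewrite /nilp size_eq0 (negPf nd).
have Jl := @J4_lin D deg K; split.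
- apply: (@eq_lin_basis _ _ _ (fun t => sep2 (J4 (tmap id rh t))) (fun=> 0)) => [a y z|a y z|q].
  + by rewrite tl Jl sep2_lin.
  + by rewrite scaler0 addr0.
  have [h2 h3 h4] := b0 q; exact: h2.
- apply: (@eq_lin_basis _ _ _ (fun t => sep3 (J4 (tmap id rh t))) (fun=> 0)) => [a y z|a y z|q].
  + by rewrite tl Jl sep3_lin.
  + by rewrite scaler0 addr0.
  have [h2 h3 h4] := b0 q; exact: h3.
apply: (@eq_lin_basis _ _ _ (fun t => sep4 (J4 (tmap id rh t))) (tmap id rh)) => [a y z||q].
+ by rewrite tl Jl sep4_lin.
+ exact: tl.
have [h2 h3 h4] := b0 q; exact: h4.
Qed.

(** Each of the three separating maps kills all terms but one on either side. *)
Lemma separation x t s t' s' :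
  pi x + J2 (tmap pi id t) + J3 (tmap id pi s) + J4 (tmap id rh s) =
  J2 (tmap pi id t') + J3 (tmap id pi s') + J4 (tmap id rh s') ->
  [/\ tmap pi id t = tmap pi id t', tmap id pi s = tmap id pi s'
     & tmap id rh s = tmap id rh s'].
Proof.
move=> E; have [p2 p3 p4] := sep_pi x.
have [t2 t3 t4] := sep_J2 t; have [t2' t3' t4'] := sep_J2 t'.
have [s2 s3 s4] := sep_J3 s; have [s2' s3' s4'] := sep_J3 s'.
have [r2 r3 r4] := sep_J4 s; have [r2' r3' r4'] := sep_J4 s'.
split.
- have [h _ _] := add_zeros (tmap pi id t) (tmap pi id t').
  apply: h; exact: lin_eq4 sep2_lin E p2 t2 s2 r2 t2' s2' r2'.
- have [_ h _] := add_zeros (tmap id pi s) (tmap id pi s').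
  apply: h; exact: lin_eq4 sep3_lin E p3 t3 s3 r3 t3' s3' r3'.
have [_ _ h] := add_zeros (tmap id rh s) (tmap id rh s').
apply: h; exact: lin_eq4 sep4_lin E p4 t4 s4 r4 t4' s4' r4'.
Qed.

End Separation.

(** * The span of the one-vertex forests *)

Section Vertex.
Variables (D : choiceType) (deg : D -> nat) (K : fieldType).
Notation forest := (seq (ptree D)).
Let H := Hp deg K.
Let vF : forest -> space H := vec K (@hp_basis D).
Let pr := Hp_presentation deg K.
Notation pi := (@pi_vertex D deg K).
Notation degH := (@bdeg K H).

Local Opaque tens tmap tmap2 dot nw lext bext dprec dsucc.

Lemma vec_leaf (d : D) : hp_basis [:: leaf d]. Proof. by []. Qed.

Lemma prim_leaf d : prim (vF [:: leaf d]).
Proof.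
have c0 : all (fun c => ~~ proper [::] c) (forest_cut [:: leaf d]) by [].
have z P : \sum_(c <- forest_cut [:: leaf d] | P c) vcut vF c = 0 :> space2 H.
  rewrite (sum_vcut_proper pr) (eq_in_filter (a2 := pred0)); first by rewrite filter_pred0 big_nil.
  by move=> c /(allP c0)/negPf.
split; [rewrite (dprec_ve pr) // | rewrite (dsucc_ve pr) //]; exact: z.
Qed.

Lemma pi_basisP (P : space H -> Prop) (x : space H) :
  P 0 -> (forall a y z, P y -> P z -> P (a *: y + z)) -> (forall d, P (vF [:: leaf d])) ->
  P (pi x).
Proof.
move=> P0 PD PU; rewrite (malg_sumE x) (lin_sum (@pi_lin D deg K)).
elim/big_rec: _ => [|b y _ Py]; first exact: P0.
rewrite (linZ (@pi_lin D deg K)); apply: PD => //.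
rewrite pi_basis; case: ifP => // /single_leaf[d bd].
by rewrite -(vF_val b) bd; exact: PU.
Qed.

Lemma pi_leaf d : pi (vF [:: leaf d]) = vF [:: leaf d].
Proof. by rewrite pi_vec. Qed.

Lemma prim_pi x : prim (pi x).
Proof.
apply: pi_basisP => [|a y z|d]; last exact: prim_leaf.
  by split; [exact: (lin0 (@dprec_lin K H)) | exact: (lin0 (@dsucc_lin K H))].
exact: prim_lin.
Qed.

Lemma pi_idem x : pi (pi x) = pi x.
Proof.
have pl := @pi_lin D deg K.
apply: (pi_basisP (P := fun y => pi y = y)) => [|a y z yE zE|d]; first exact: (lin0 pl).
  by rewrite pl yE zE.
exact: pi_leaf.
Qed.

Lemma pi_lext x : exists y : {malg K[D]}, pi x = lext (fun d => vF [:: leaf d]) y.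
Proof.
apply: (pi_basisP (P := fun x => exists y : {malg K[D]}, x = lext (fun d => vF [:: leaf d]) y)).
- by exists 0; rewrite linear0.
- move=> a _ _ [y ->] [z ->]; exists (a *: y + z); exact: esym (linearP _ _ _ _).
by move=> d; exists << d >>; rewrite lextU.
Qed.

Lemma pi_homog n x : homog degH n x -> homog degH n (pi x).
Proof.
apply: homog_lext => b db; case: ifP => _; last exact: homog0.
exact: homogU.
Qed.

Lemma J2_homog n x : homog (deg_pair degH degH) n x -> homog degH n (@J2 D deg K x).
Proof.
have [_ _ _ [_ hnw _ _]] := Hp_bialgebra deg K.
apply: homog_lext => p <-; rewrite /deg_pair addnC.
by apply: hnw; exact: homogU.
Qed.

Lemma J3_homog n x : homog (deg_pair degH degH) n x -> homog degH n (@J3 D deg K x).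
Proof.
have [_ _ _ [hdot _ _ _]] := Hp_bialgebra deg K.
apply: homog_lext => p <-; rewrite /deg_pair.
by apply: hdot; exact: homogU.
Qed.

Lemma J4_homog n x : homog (deg_pair degH (deg_pair degH degH)) n x ->
  homog degH n (@J4 D deg K x).
Proof.
have [_ _ _ [hdot hnw _ _]] := Hp_bialgebra deg K.
apply: homog_lext => p <-; rewrite /deg_pair addnA addnC.
by apply: hnw; [exact: homogU | apply: hdot; exact: homogU].
Qed.

Lemma forest_deg_gt0 F : (forall d, 0 < deg d)%N -> F != [::] -> (0 < forest_deg deg F)%N.
Proof. by move=> deg0; case: F => // -[d ts] F _; rewrite forest_deg_cons !addn_gt0 deg0. Qed.

End Vertex.

(** * The rigidity theorem *)

Section RigidityTheorem.
Variables (K : fieldType) (A : based K) (rk : bas A -> nat).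
Hypothesis hA : graded_DupDend_bialgebra A.
Hypothesis deg_gt0 : forall b : bas A, (0 < bdeg b)%N.
Hypothesis rk_inj : injective rk.

Notation D := (gens rk).
Notation gd := (@gdeg K A rk).
Let H := Hp gd K.
Let vF : seq (ptree D) -> space H := vec K (@hp_basis D).
Let ph : space H -> space A := @phi K A rk.

Local Opaque tens tmap tmap2 dot nw lext bext dprec dsucc.

Let pl : linear ph. Proof. exact: phi_lin. Qed.
Let phv F : ph (vF F) = forest_phi F. Proof. exact: phi_vec. Qed.

(** A vertex is primitive and is sent to a primitive generator. Every forest is built from vertices
    by the two products, so [coalg_ops] propagates the property. *)
Lemma phi_coalg x : coalg ph x.
Proof.
have [dupA _ compA _] := hA; have [_ _ compH _] := Hp_bialgebra gd K.
have ops := coalg_ops pl compH compA (phi_dot hA) (phi_nw hA).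
have leafP d : coalg ph (vF [:: leaf d]).
  have [px sx] := prim_leaf gd K d; rewrite /coalg px sx !(lin0 (tmap_lin _ _)) phv.
  by have [[-> ->] _ _ _] := genP d.
have fP F : coalg ph (vF F).
  elim/forest_ind: F => [|d ts F IHt IHF].
    rewrite /vF vec_nil /coalg (lin0 pl) !(lin0 (dprec_lin (A := _))).
    by rewrite !(lin0 (dsucc_lin (A := _))) (lin0 (tmap_lin _ _)).
  have c1 : coalg ph (vF [:: Node d ts]).
    case: ts IHt => [|t ts] IHt; first exact: leafP.
    have dE : nw (vF [:: leaf d]) (vF (t :: ts)) = vF [:: Node d (t :: ts)] by exact: Hp_nw.
    by rewrite -dE; exact: proj2 (ops _ _ (leafP d) IHt).
  have [F0|nF] := eqVneq F [::]; first by rewrite F0.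
  have dE : dot (vF [:: Node d ts]) (vF F) = vF (Node d ts :: F) by exact: Hp_dot.
  by rewrite -dE; exact: proj1 (ops _ _ c1 IHF).
split.
  apply: (@eq_lin_basis _ _ _ (fun x => tmap ph ph (dprec x)) (fun x => dprec (ph x))) => [a y z|a y z|b].
  - by rewrite dprec_lin tmap_lin.
  - by rewrite pl dprec_lin.
  by rewrite -(@vF_val D gd K b); have [] := fP (val b).
apply: (@eq_lin_basis _ _ _ (fun x => tmap ph ph (dsucc x)) (fun x => dsucc (ph x))) => [a y z|a y z|b].
- by rewrite dsucc_lin tmap_lin.
- by rewrite pl dsucc_lin.
by rewrite -(@vF_val D gd K b); have [] := fP (val b).
Qed.

Lemma phi_leaves (y : {malg K[D]}) : ph (lext (fun d => vF [:: leaf d]) y) = lext (@gen K A rk) y.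
Proof.
rewrite [X in ph (lext _ X)]malg_sumE [X in _ = lext _ X]malg_sumE.
have l1 : linear (lext (fun d => vF [:: leaf d])) by exact: linearP.
have l2 : linear (lext (@gen K A rk)) by exact: linearP.
rewrite (lin_sum l1) (lin_sum pl) (lin_sum l2); apply: eq_bigr => d _.
by rewrite (linZ l1) (linZ pl) (linZ l2) !lextU phv.
Qed.

Theorem rigidity : exists (D : choiceType) (deg : D -> nat),
  isomorphic_graded_DupDend A (Hp deg K).
Proof.
exists D, gd; have hH := Hp_bialgebra gd K; split=> //.
have [_ cA _ gA] := hA; have [_ cH _ gH] := hH.
have [G [Gl GK PsiK Gh]] := Psi_inverse gd K.
have gd0 (d : D) : (0 < gd d)%N by exact: deg_gt0.
have dH (b : bas H) : (0 < bdeg b)%N by apply: forest_deg_gt0 => //; exact: Hp_valP.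
have span n y : prim y -> homog (@bdeg K A) n y ->
    exists2 x, homog (@bdeg K H) n x & ph x = y.
  move=> py hy; have [z hz zE] := gen_span rk_inj py hy.
  exists (lext (fun d => vF [:: leaf d]) z); last by rewrite phi_leaves -zE.
  apply: homog_lext hz => d <-; rewrite /vF (vecE _ (vec_leaf d)).
  by apply: homogU; rewrite /= /forest_deg /= !addn0.
have vinj x : ph (@pi_vertex D gd K x) = 0 -> @pi_vertex D gd K x = 0.
  have [z ->] := pi_lext x; rewrite phi_leaves => /(gen_free rk_inj)->; exact: linear0.
have [f [fl fK Kf fh]] := bijection pl (@phi_homog K A rk hA) phi_coalg dH deg_gt0 cH cA gH gA
  (@pi_lin D gd K) (@J2_lin D gd K) (@J3_lin D gd K) (@J4_lin D gd K) Gl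
  (@pi_homog D gd K) (@J2_homog D gd K) (@J3_homog D gd K) (@J4_homog D gd K) Gh
  PsiK GK (@separation D gd K) (@prim_pi D gd K) (@pi_idem D gd K) span vinj.
pose F := GRing.isLinear.Build K (space A) (space H) _ f fl.
pose f' : {linear space A -> space H} := HB.pack f F.
have cp x : tmap f f (dprec x) = dprec (f x).
  have [cx _] := phi_coalg (f x); rewrite -[x in LHS]fK -cx (tmap_comp _ _ _ fl fl).
  by rewrite -[RHS](tmap_id); apply: eq_tmap => b; exact: Kf.
have cs x : tmap f f (dsucc x) = dsucc (f x).
  have [_ cx] := phi_coalg (f x); rewrite -[x in LHS]fK -cx (tmap_comp _ _ _ fl fl).
  by rewrite -[RHS](tmap_id); apply: eq_tmap => b; exact: Kf.
exists f'; split; [by exists ph | exact: fh | | exact: cp | exact: cs].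
have pd u w : ph (dot u w) = dot (ph u) (ph w) by exact: phi_dot.
have pn u w : ph (nw u w) = nw (ph u) (ph w) by exact: phi_nw.
move=> x y; split.
  by transitivity (f (ph (dot (f x) (f y)))); [rewrite pd !fK | exact: Kf].
by transitivity (f (ph (nw (f x) (f y)))); [rewrite pn !fK | exact: Kf].
Qed.

End RigidityTheorem.

(** * Shuffles of words *)

Section Shuffles.
Variable T : eqType.
Implicit Types (s t u w : seq T) (a b : T).

Fixpoint sh s : seq T -> seq (seq T) :=
  match s with
  | [::] => fun t => [:: t]
  | a :: s' => fix sh_s t := match t with
      | [::] => [:: a :: s']
      | b :: t' => map (cons a) (sh s' (b :: t')) ++ map (cons b) (sh_s t')
      end
  end.

Lemma sh0s t : sh [::] t = [:: t]. Proof. by []. Qed.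
Lemma shs0 s : sh s [::] = [:: s]. Proof. by case: s. Qed.
Lemma sh_cons a s b t : sh (a :: s) (b :: t) =
  map (cons a) (sh s (b :: t)) ++ map (cons b) (sh (a :: s) t).
Proof. by []. Qed.

Lemma perm_sh s t : {in sh s t, forall w, perm_eq w (s ++ t)}.
Proof.
elim: s t => [|a s IHs] t w; first by rewrite inE => /eqP->.
elim: t w => [|b t IHt] w; first by rewrite shs0 inE cats0 => /eqP->.
rewrite sh_cons mem_cat => /orP[] /mapP[x xs ->].
  by rewrite perm_cons IHs.
by apply: (@perm_trans _ (b :: (a :: s) ++ t)); rewrite ?perm_cons ?IHt // perm_sym perm_catC perm_cons perm_catC.
Qed.

Definition splits w := [seq (take k w, drop k w) | k <- iota 0 (size w).+1].

Lemma splits_cons a w :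
  splits (a :: w) = ([::], a :: w) :: [seq (a :: p.1, p.2) | p <- splits w].
Proof.
rewrite /splits /=; congr cons; congr cons.
by rewrite -map_comp (iotaDl 1 1) -map_comp; apply: eq_map => k.
Qed.

Lemma splits_cat w : {in splits w, forall p, p.1 ++ p.2 = w}.
Proof. by move=> p /mapP[k _ ->]; rewrite cat_take_drop. Qed.

Section Sums.
Variable V : nmodType.

Lemma sum_sh_cons (F : seq T -> V) a s b t : \sum_(w <- sh (a :: s) (b :: t)) F w =
  \sum_(w <- sh s (b :: t)) F (a :: w) + \sum_(w <- sh (a :: s) t) F (b :: w).
Proof. by rewrite sh_cons big_cat !big_map. Qed.

Lemma sum_splits_cons (G : seq T -> seq T -> V) a w :
  \sum_(p <- splits (a :: w)) G p.1 p.2 =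
  G [::] (a :: w) + \sum_(p <- splits w) G (a :: p.1) p.2.
Proof. by rewrite splits_cons big_cons big_map. Qed.

Lemma sum_splits0 (G : seq T -> seq T -> V) : \sum_(p <- splits [::]) G p.1 p.2 = G [::] [::].
Proof. by rewrite /splits big_seq1. Qed.

(** Compatibility of deconcatenation with shuffles, by induction on first letters: the cut before
    everything is set apart, and in every other cut the first letter, from s or from t, belongs to
    the left part. *)
Lemma sum_sh_splits (G : seq T -> seq T -> V) s t :
  \sum_(w <- sh s t) \sum_(p <- splits w) G p.1 p.2 =
  \sum_(p <- splits s) \sum_(q <- splits t)
     \sum_(l <- sh p.1 q.1) \sum_(r <- sh p.2 q.2) G l r.
Proof.
elim: s t G => [|a s IHs] t G.
  rewrite sh0s big_seq1 (sum_splits0 (fun p1 p2 => \sum_(q <- splits t)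
    \sum_(l <- sh p1 q.1) \sum_(r <- sh p2 q.2) G l r)).
  by apply: eq_bigr => q _; rewrite !big_seq1.
elim: t G => [|b t IHt] G.
  rewrite shs0 big_seq1; apply: eq_bigr => p _.
  rewrite (sum_splits0 (fun q1 q2 => \sum_(l <- sh p.1 q1) \sum_(r <- sh p.2 q2) G l r)).
  by rewrite !shs0 !big_seq1.
rewrite sum_sh_cons.
under eq_bigr => w _ do rewrite sum_splits_cons.
under [X in _ + X]eq_bigr => w _ do rewrite sum_splits_cons.
rewrite !big_split /= (IHs _ (fun l r => G (a :: l) r)) (IHt (fun l r => G (b :: l) r)).
rewrite addrACA -(sum_sh_cons (fun w => G [::] w)).
rewrite (sum_splits_cons (fun p1 p2 => \sum_(q <- splits (b :: t))
    \sum_(l <- sh p1 q.1) \sum_(r <- sh p2 q.2) G l r)).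
rewrite (sum_splits_cons (fun q1 q2 =>
    \sum_(l <- sh [::] q1) \sum_(r <- sh (a :: s) q2) G l r)) big_seq1 -addrA.
congr (_ + _).
rewrite (sum_splits_cons (fun p1 p2 => \sum_(q <- splits t)
    \sum_(l <- sh p1 q.1) \sum_(r <- sh p2 q.2) G (b :: l) r)).
rewrite addrCA; congr (_ + _); first by apply: eq_bigr => q _; rewrite !big_seq1.
rewrite -big_split; apply: eq_bigr => p _ /=.
rewrite (sum_splits_cons (fun q1 q2 =>
    \sum_(l <- sh p.1 q1) \sum_(r <- sh p.2 q2) G (a :: l) r)).
rewrite (sum_splits_cons (fun q1 q2 =>
    \sum_(l <- sh (a :: p.1) q1) \sum_(r <- sh p.2 q2) G l r)).
rewrite !shs0 !big_seq1 -addrA; congr (_ + _).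
by rewrite -big_split; apply: eq_bigr => q _; rewrite sum_sh_cons.
Qed.

Lemma sum_splits_splits (G : seq T -> seq T -> seq T -> V) w :
  \sum_(p <- splits w) \sum_(q <- splits p.2) G p.1 q.1 q.2 =
  \sum_(p <- splits w) \sum_(q <- splits p.1) G q.1 q.2 p.2.
Proof.
elim: w G => [|a w IH] G; first by rewrite /splits !big_seq1.
rewrite (sum_splits_cons (fun x y => \sum_(q <- splits y) G x q.1 q.2)).
rewrite (sum_splits_cons (fun x y => \sum_(q <- splits x) G q.1 q.2 y)).
rewrite (IH (fun x y z => G (a :: x) y z)).
rewrite (sum_splits0 (fun x y => G x y _)) (sum_splits_cons (fun x y => G [::] x y)) -addrA.
congr (_ + _); rewrite -big_split; apply: eq_bigr => p _ /=.
by rewrite (sum_splits_cons (fun x y => G x y p.2)).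
Qed.

Lemma sum_splits_cat (G : seq T -> seq T -> V) s t :
  \sum_(p <- splits (s ++ t)) G p.1 p.2 =
  \sum_(k <- iota 0 (size s)) G (take k s) (drop k s ++ t) + \sum_(q <- splits t) G (s ++ q.1) q.2.
Proof.
rewrite /splits !big_map size_cat -addnS iotaD big_cat add0n; congr (_ + _).
  rewrite big_seq [RHS]big_seq; apply: eq_bigr => k; rewrite mem_iota add0n => /= ks.
  by rewrite take_cat drop_cat ks.
rewrite -{1}[size s]addn0 iotaDl big_map; apply: eq_bigr => k _.
by rewrite take_cat drop_cat ltnNge leq_addr /= addKn.
Qed.

(** The first letter of a triple shuffle comes from s, t or u, and both sides split into these three
    cases. *)
Lemma sum_shA (F : seq T -> V) s t u :
  \sum_(w <- sh s t) \sum_(x <- sh w u) F x = \sum_(w <- sh t u) \sum_(x <- sh s w) F x.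
Proof.
elim: s t u F => [|a s IHs] t u F.
  by rewrite sh0s big_seq1; apply: eq_bigr => w _; rewrite big_seq1.
elim: t u F => [|b t IHt] u F; first by rewrite shs0 sh0s !big_seq1.
elim: u F => [|c u IHu] F.
  rewrite shs0 big_seq1; apply: eq_bigr => w _; by rewrite shs0 big_seq1.
rewrite sum_sh_cons.
under eq_bigr => w _ do rewrite sum_sh_cons.
under [X in _ + X]eq_bigr => w _ do rewrite sum_sh_cons.
rewrite !big_split /= (IHs _ _ (fun w => F (a :: w))) (IHt _ (fun w => F (b :: w))).
rewrite addrACA -(sum_sh_cons (fun w => \sum_(x <- sh w u) F (c :: x))) (IHu (fun w => F (c :: w))).
rewrite [X in _ = X]sum_sh_cons.
under [X in _ = X + _]eq_bigr => w _ do rewrite sum_sh_cons.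
under [X in _ = _ + X]eq_bigr => w _ do rewrite sum_sh_cons.
rewrite !big_split /= [in RHS]addrACA -addrA; congr (_ + _).
by rewrite (sum_sh_cons (fun w => \sum_(x <- sh s w) F (a :: x))).
Qed.

(** The letter M divides each shuffle in two: d is deconcatenated into its letters before and after
    M. It is applied below with M the last maximal letter of the second word. *)
Lemma sum_sh_letter (F : seq T -> V) d x M y :
  \sum_(w <- sh d (x ++ M :: y)) F w =
  \sum_(p <- splits d) \sum_(l <- sh p.1 x) \sum_(r <- sh p.2 y) F (l ++ M :: r).
Proof.
elim: x d F => [|b x IHx] d F.
  elim: d F => [|a d IHd] F.
    by rewrite (sum_splits0 (fun p1 p2 => \sum_(l <- sh p1 _) \sum_(r <- sh p2 _) F _)) !big_seq1.
  rewrite [[::] ++ _]/= sum_sh_cons addrC [X in _ + X](IHd (fun w => F (a :: w))).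
  rewrite (sum_splits_cons (fun p1 p2 => \sum_(l <- sh p1 [::]) \sum_(r <- sh p2 y) F (l ++ M :: r))).
  rewrite sh0s big_seq1; congr (_ + _); apply: eq_bigr => p _.
  by rewrite !shs0 !big_seq1.
elim: d F => [|a d IHd] F.
  by rewrite (sum_splits0 (fun p1 p2 => \sum_(l <- sh p1 _) \sum_(r <- sh p2 _) F _)) !big_seq1.
rewrite cat_cons sum_sh_cons -cat_cons (IHd (fun w => F (a :: w))) (IHx _ (fun w => F (b :: w))).
rewrite (sum_splits_cons (fun p1 p2 => \sum_(l <- sh p1 x) \sum_(r <- sh p2 y) F (b :: l ++ M :: r))).
rewrite (sum_splits_cons (fun p1 p2 => \sum_(l <- sh p1 (b :: x)) \sum_(r <- sh p2 y) F (l ++ M :: r))).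
rewrite addrCA !sh0s !big_seq1; congr (_ + _); rewrite -big_split; apply: eq_bigr => p _ /=.
by rewrite sum_sh_cons.
Qed.

End Sums.
End Shuffles.

Lemma sh_map (T U : eqType) (f : T -> U) s t : sh (map f s) (map f t) = map (map f) (sh s t).
Proof.
elim: s t => // a s IHs; elim=> // b t IHt.
rewrite [map f (a :: s)]/= [map f (b :: t)]/= sh_cons -[f b :: _]/(map f (b :: t)) IHs.
by rewrite -[f a :: _]/(map f (a :: s)) IHt sh_cons map_cat -!map_comp.
Qed.

Lemma splits_map (T U : eqType) (f : T -> U) w :
  splits (map f w) = [seq (map f p.1, map f p.2) | p <- splits w].
Proof. by rewrite /splits size_map -map_comp; apply: eq_map => k /=; rewrite map_take map_drop. Qed.

(** * Parkization *)

Section Parkization.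
Local Open Scope nat_scope.

(* The amount by which parkization decreases the letters a of a word having c t
   letters <= t. *)
Fixpoint excess (c : nat -> nat) a :=
  if a is b.+1 then maxn (excess c b) (b - c b) else 0.

Notation cnt w := (fun t => count (fun a => a <= t) w).

(** The excess at a is the maximum over t < a of t minus the number of letters <= t. It is read off
    w alone, so that a single relabelling replaces the iteration of [park_step]. *)
Definition parkl (w : seq nat) a := a - excess (cnt w) a.

Lemma eq_excess c c' a : (forall t, t < a -> c t = c' t) -> excess c a = excess c' a.
Proof.
elim: a => //= a IH E; rewrite IH ?E // => t ta; apply: E; exact: leqW.
Qed.

Lemma excess_eq0 c a : (forall t, t < a -> t <= c t) -> excess c a = 0.
Proof.
elim: a => //= a IH E; rewrite IH => [|t ta]; last by apply: E; exact: leqW.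
by rewrite max0n; apply/eqP; rewrite subn_eq0 E.
Qed.

Lemma count_le_mem (w : seq nat) d : d \notin w -> 0 < d ->
  cnt w d = cnt w d.-1.
Proof. by case: d => // d dw _; rewrite count_leqS (count_memPn dw) addn0. Qed.

Definition step_letter (w : seq nat) a := if park_d w < a then a.-1 else a.

(** The step is computed for w but followed on a part v of w. With d = [park_d w], letters above d
    drop by one; v has no letter d, and the excess above d drops by one as well. *)
Lemma parkl_step w v : (forall P, count P v <= count P w) ->
  [seq parkl (map (step_letter w) v) b | b <- map (step_letter w) v] =
  [seq parkl v a | a <- v].
Proof.
move=> vw; pose d := park_d w; pose g := step_letter w; rewrite -/g.
have gE a : g a = if d < a then a.-1 else a by [].
have dv : d \notin v.
  by apply: contra (park_d_notin w); rewrite -!has_pred1 !has_count => /leq_trans; apply.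
have cd := park_d_count w; rewrite -/d in cd.
have cg t : cnt [seq g a | a <- v] t = if t < d then cnt v t else cnt v t.+1.
  rewrite count_map; case: ltnP => td.
    apply: eq_in_count => a av /=; rewrite gE; case: (ltnP d a) => da //.
    by move: td da; clear; lia.
  apply: eq_in_count => a av /=; rewrite gE; case: (ltnP d a) => da; first by move: td da; clear; lia.
  have : a != d by apply: contraNneq dv => <-.
  move: td da; clear; lia.
have low a : a <= d -> excess (cnt [seq g a | a <- v]) a = excess (cnt v) a.
  by move=> ad; apply: eq_excess => t ta; rewrite cg (leq_trans ta ad).
have d0 : 0 < d by exact: park_d_gt0.
have cw t : t < d -> t <= cnt w t.
  by case: t => // t td; apply: park_d_min.
(* By minimality of d, the word w has at most d - 1 - t letters in the interval from t + 1 to d - 1,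
   hence so has v; the maximum defining the excess at d is therefore reached at d - 1. *)
have top : excess (cnt v) d = d.-1 - cnt v d.-1.
  have le_top t : t < d -> t - cnt v t <= d.-1 - cnt v d.-1.
    move=> td; have cwd : cnt w d.-1 <= d.-1.
      by rewrite -ltnS prednK //; apply: leq_ltn_trans cd; apply: sub_count => a /leq_trans; apply; exact: leq_pred.
    have split_cnt (u : seq nat) : cnt u d.-1 = cnt u t + count (fun a => t < a <= d.-1) u.
      elim: u => //= a u ->; move: td; clear.
      by case: (leqP a t) => at_; case: (leqP a d.-1) => ad /=; lia.
    have := vw (fun a => t < a <= d.-1); have := cw t td.
    have := split_cnt w; have := split_cnt v; lia.
  case: (d) d0 le_top => // e _ le_top /=; apply/eqP; rewrite eqn_leq leq_maxr andbT geq_max leqnn andbT.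
  have: forall a, a <= e -> excess (cnt v) a <= e - cnt v e.
    elim=> //= a IH ae; rewrite geq_max IH ?(ltnW ae) //=; apply: le_top.
    by rewrite ltnS ltnW.
  by apply.
have cvd : cnt v d = cnt v d.-1 by exact: count_le_mem.
have cvd' : cnt v d.-1 <= d.-1.
  by rewrite -cvd -ltnS prednK //; apply: leq_ltn_trans cd; exact: vw.
(* As d is missing from v, the term t = d raises the maximum by exactly one; beyond it the two
   recursions run in parallel. *)
have high i : excess (cnt v) (d + i).+1 = (excess (cnt [seq g a | a <- v]) (d + i)).+1.
  elim: i => [|i IH].
    rewrite addn0 low // -[excess _ d.+1]/(maxn (excess (cnt v) d) (d - cnt v d)) top cvd.
    move: d0 cvd'; move: (cnt v d.-1) => c; clear; lia.
  rewrite addnS -[excess (cnt v) _]/(maxn (excess (cnt v) (d + i).+1) ((d + i).+1 - cnt v (d + i).+1)).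
  rewrite IH -[excess _ (d + i).+1]/(maxn (excess (cnt [seq g a | a <- v]) (d + i))
    ((d + i) - cnt [seq g a | a <- v] (d + i))).
  cbv beta; rewrite cg ltnNge leq_addr; move: (excess _ _) => E /=; move: (count _ _) => c; clear; lia.
rewrite -map_comp; apply/eq_in_map => a av /=; rewrite /parkl gE.
case: (ltnP d a) => da; last by rewrite low.
have -> : a = (d + (a - d.+1)).+1 by lia.
by rewrite high /= subSS.
Qed.

Lemma parkl_park_step (F : seq nat -> seq nat) w :
  (forall f u, F (map f u) = map f (F u)) -> (forall P, count P (F w) <= count P w) ->
  [seq parkl (F (park_step w)) a | a <- F (park_step w)] = [seq parkl (F w) a | a <- F w].
Proof.
move=> Fm Fc; rewrite /park_step; case: eqP => // _.
by rewrite Fm -(parkl_step Fc).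
Qed.

Lemma parkl_parking w : park_d w = (size w).+1 -> [seq parkl w a | a <- w] = w.
Proof.
move=> dw; have cw t : t <= size w -> t <= cnt w t.
  by case: t => // t tw; apply: park_d_min; rewrite dw ltnS.
have : all (fun a => a <= size w) w by rewrite all_count eqn_leq count_size cw.
move=> /allP wl; rewrite -[RHS]map_id; apply/eq_in_map => a /wl aw.
by rewrite /parkl excess_eq0 ?subn0 // => t ta; apply: cw; exact: leq_trans (ltnW ta) aw.
Qed.

(** F selects letters by their positions (all of them, [take k] or [drop k]), hence commutes with
    relabelling. Parkizing a word thus does not affect the parkization of its parts, which is what
    coassociativity rests on. *)
Lemma parkl_parkize (F : seq nat -> seq nat) w :
  (forall f u, F (map f u) = map f (F u)) -> (forall P u, count P (F u) <= count P u) ->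
  [seq parkl (F (parkize w)) a | a <- F (parkize w)] = [seq parkl (F w) a | a <- F w].
Proof.
move=> Fm Fc; apply: (@parkize_ind (fun u =>
  [seq parkl (F u) a | a <- F u] = [seq parkl (F w) a | a <- F w])) => // u <-.
exact: parkl_park_step.
Qed.

Lemma parkizeE w : parkize w = [seq parkl w a | a <- w].
Proof. by rewrite -(@parkl_parkize id) // parkl_parking // park_d_parkize. Qed.

Lemma parkize_take k w : parkize (take k (parkize w)) = parkize (take k w).
Proof.
rewrite 2!(parkizeE (take _ _)); apply: (parkl_parkize (F := take k)) => [f u|P u].
  by rewrite map_take.
by rewrite -{2}(cat_take_drop k u) count_cat leq_addr.
Qed.

Lemma parkize_drop k w : parkize (drop k (parkize w)) = parkize (drop k w).
Proof.
rewrite 2!(parkizeE (drop _ _)); apply: (parkl_parkize (F := drop k)) => [f u|P u].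
  by rewrite map_drop.
by rewrite -{2}(cat_take_drop k u) count_cat leq_addl.
Qed.

Lemma parkize_id w : is_parking w -> parkize w = w.
Proof.
move=> pw; rewrite parkizeE parkl_parking //; apply/eqP; rewrite eqn_leq park_d_le ltnNge.
have [_ cw] := is_parkingP _ pw.
by apply/negP => /cw; rewrite leqNgt park_d_count.
Qed.

(** Since a occurs in w, the count increases at a, and the excess grows by less than b - a between a
    and b. *)
Lemma parkl_ltn w a b : a \in w -> a < b -> parkl w a < parkl w b.
Proof.
move=> aw ab; rewrite /parkl.
have le_id t : excess (cnt w) t <= t by elim: t => //= t IH; rewrite geq_max; lia.
have key i : excess (cnt w) (a + i).+1 <= excess (cnt w) a + i.
  have ca t : a <= t -> cnt w a.-1 < cnt w t \/ a = 0.
    case: a aw {ab} => [|a] aw at_; [by right|left].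
    apply: (@leq_trans (cnt w a.+1)); last by apply: sub_count => x /= /leq_trans; apply.
    by rewrite count_leqS -addn1 leq_add2l -has_count has_pred1.
  elim: i => [|i IH].
    rewrite !addn0 /= geq_max leqnn /=; have [] := ca a (leqnn a); last by move->.
    by case: (a) => //= a'; rewrite leq_max; lia.
  rewrite addnS -[excess _ (a + i).+2]/(maxn (excess (cnt w) (a + i).+1) ((a + i).+1 - cnt w (a + i).+1)).
  have [] := ca (a + i).+1; first lia.
    have : a.-1 - cnt w a.-1 <= excess (cnt w) a by case: (a) => //= a'; exact: leq_maxr.
    move: IH; lia.
  move=> a0; have : 0 < cnt w (a + i).+1.
    by rewrite -has_count; apply/hasP; exists a => //; lia.
  move: IH; lia.
have := key (b - a.+1); have := le_id a; have := le_id b.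
have -> : (a + (b - a.+1)).+1 = b by lia.
lia.
Qed.

Lemma parkl_leq w a b : a \in w -> b \in w -> (parkl w a <= parkl w b) = (a <= b).
Proof.
move=> aw bw; have [ab|ab|->] := ltngtP a b; last by rewrite !leqnn.
  by rewrite ltnW // parkl_ltn.
by rewrite leqNgt parkl_ltn.
Qed.

Lemma perm_parkl w w' : perm_eq w w' -> parkl w =1 parkl w'.
Proof. by move=> /seq.permP ww' a; rewrite /parkl; congr (_ - _); apply: eq_excess => t _. Qed.

(** What a part of a parking function of degree k retains: few large letters. For t = k it bounds
    the letters by k, and for t = 0 it bounds the length when the letters are positive. *)
Definition subparking k (w : seq nat) :=
  forall t, t <= k -> count (fun a => t < a) w <= k - t.

Lemma subparking_count k v w : is_parking v -> size v = k ->
  (forall P, count P w <= count P v) -> subparking k w.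
Proof.
case/is_parkingP => _ cv <- wv t tk; apply: leq_trans (wv _) _.
have := cv t tk; rewrite -(count_predC (fun a => a <= t) v).
have -> : count (predC (fun a => a <= t)) v = count (fun a => t < a) v.
  by apply: eq_count => a /=; rewrite ltnNge.
lia.
Qed.

Lemma subparking_le k w : subparking k w -> all (fun a => a <= k) w.
Proof.
move=> /(_ k (leqnn k)); rewrite subnn leqn0 => /eqP c0.
have : ~~ has (fun a => k < a) w by rewrite has_count c0.
by rewrite -all_predC; apply: sub_all => a /=; rewrite -leqNgt.
Qed.

Lemma parkl_cat_l k w v a : all (fun b => 0 < b) v -> a <= k ->
  parkl (w ++ map (addn^~ k) v) a = parkl w a.
Proof.
move=> v0 ak; rewrite /parkl; congr (_ - _); apply: eq_excess => t ta.
rewrite count_cat count_map -[RHS]addn0; congr addn; apply/eqP.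
rewrite eqn0Ngt -has_count -all_predC; apply: sub_all v0 => b /=; lia.
Qed.

(** By [subparking], the maximum of t minus the number of letters <= t, over t <= k, is k - size w,
    reached at k. Letters shifted by k are lowered by this amount, and end up shifted by
    [size w]. *)
Lemma parkl_cat_r k w v b : subparking k w -> all (fun a => 0 < a) w -> all (fun b => 0 < b) v -> 0 < b ->
  parkl (w ++ map (addn^~ k) v) (b + k) = parkl v b + size w.
Proof.
move=> sw w0 v0 b0; have wk := subparking_le sw.
have szw t : t <= k -> size w <= cnt w t + (k - t).
  move=> tk; have := sw t tk; rewrite -(count_predC (fun a => a <= t) w).
  have -> : count (predC (fun a => a <= t)) w = count (fun a => t < a) w.
    by apply: eq_count => a /=; rewrite ltnNge.
  lia.
have szk : size w <= k.
  by have := sw 0 isT; rewrite subn0; apply: leq_trans; rewrite eq_leq //; apply/esym/eqP; rewrite -all_count.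
have low t : t <= k -> cnt (w ++ map (addn^~ k) v) t = cnt w t.
  move=> tk; rewrite count_cat count_map -[RHS]addn0; congr addn; apply/eqP.
  rewrite eqn0Ngt -has_count -all_predC; apply: sub_all v0 => c /=; lia.
have high t : cnt (w ++ map (addn^~ k) v) (t + k) = size w + cnt v t.
  rewrite count_cat count_map; congr addn.
    by apply/eqP; rewrite -all_count; apply: sub_all wk => a /=; lia.
  by apply: eq_count => a /=; rewrite leq_add2r.
have base t : t <= k -> excess (cnt (w ++ map (addn^~ k) v)) t <= k - size w.
  elim: t => //= t IH tk; rewrite geq_max IH ?(ltnW tk) //=.
  by rewrite low ?(ltnW tk) //; have := szw t (ltnW tk); lia.
have main i : excess (cnt (w ++ map (addn^~ k) v)) (i.+1 + k) = (k - size w) + excess (cnt v) i.+1.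
  elim: i => [|i IH].
    rewrite add1n /= low // sub0n maxnn addn0; apply/eqP; rewrite eqn_leq geq_max base //= leq_max.
    have -> : cnt w k = size w by apply/eqP; rewrite -all_count.
    by rewrite leqnn orbT.
  rewrite addSn -[excess _ (i.+1 + k).+1]/(maxn (excess (cnt (w ++ map (addn^~ k) v)) (i.+1 + k))
    ((i.+1 + k) - cnt (w ++ map (addn^~ k) v) (i.+1 + k))).
  rewrite IH high -[excess (cnt v) i.+2]/(maxn (excess (cnt v) i.+1) (i.+1 - cnt v i.+1)).
  move: szk; move: (excess _ _) => E /=; move: (count _ _) => c; clear; lia.
rewrite /parkl; case: b b0 => // b _; rewrite main.
have : excess (cnt v) b.+1 <= b.+1 by elim: b.+1 => //= t IH; rewrite geq_max; lia.
lia.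
Qed.

End Parkization.

(** * Products and cuts of parking functions as lists of words *)

Section ParkingWords.
Local Open Scope nat_scope.

Notation pos w := (all (fun a => 0 < a) w).

(* max x <= max y, for words of positive letters *)
Definition le_peak (x y : seq nat) := all (fun a => has (fun b => a <= b) y) x.

Lemma le_peak_map f (s x y : seq nat) : (forall a b, a \in s -> b \in s -> (f a <= f b) = (a <= b)) ->
  {subset x <= s} -> {subset y <= s} -> le_peak (map f x) (map f y) = le_peak x y.
Proof.
move=> fm xs ys; rewrite /le_peak all_map; apply: eq_in_all => a /xs ax /=.
by rewrite has_map; apply: eq_in_has => b /ys sb; exact: fm.
Qed.

Lemma perm_le_peak x x' y y' : perm_eq x x' -> perm_eq y y' ->
  le_peak x y = le_peak x' y'.
Proof.
move=> xx yy; rewrite /le_peak (perm_all _ xx); apply: eq_all => a.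
exact: perm_has.
Qed.

(** Shifted letters exceed k, hence all the others; as soon as there are some, they decide the
    comparison alone. *)
Lemma le_peak_cat k x1 x2 y1 y2 : all (fun a => a <= k) (x1 ++ y1) -> pos (x2 ++ y2) ->
  x2 ++ y2 != [::] ->
  le_peak (x1 ++ map (addn^~ k) x2) (y1 ++ map (addn^~ k) y2) = le_peak x2 y2.
Proof.
rewrite !all_cat => /andP[/allP x1k /allP y1k] /andP[/allP x20 /allP y20] n0.
have E : le_peak (map (addn^~ k) x2) (y1 ++ map (addn^~ k) y2) = le_peak x2 y2.
  rewrite /le_peak all_map; apply: eq_in_all => a /x20 a0 /=.
  rewrite has_cat has_map [X in X || _](_ : _ = false) /=.
    by apply: eq_has => b /=; rewrite leq_add2r.
  by apply/hasPn => b /y1k; lia.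
rewrite /le_peak all_cat -!/(le_peak _ _) E.
case: y2 {E} y20 n0 => [|b y2] y20 n0.
  by case: x2 n0 {x20} => //= a x2 _; rewrite /le_peak /= andbF.
rewrite [X in X && _](_ : _ = true) //; apply/allP => a /x1k ak.
by apply/hasP; exists (b + k); [rewrite mem_cat mem_head orbT | lia].
Qed.

Lemma le_peak_trans x y z :
  le_peak x (y ++ z) && le_peak y z = le_peak (x ++ y) z.
Proof.
rewrite /le_peak all_cat; case yz: (all _ y); rewrite ?andbF ?andbT //.
apply: eq_all => a; rewrite has_cat; case az: (has _ z); rewrite ?orbT ?orbF //.
apply/hasP => -[b /(allP yz)/hasP[c cz bc] ab].
by move/hasP: az; apply; exists c => //; exact: leq_trans ab bc.
Qed.

Lemma le_peak_catl x y z : ~~ le_peak y z -> le_peak x (y ++ z) = le_peak x y.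
Proof.
case/allPn => b bY /hasPn bz; apply: eq_all => a; rewrite has_cat.
case ay: (has _ y) => //=; apply/hasP => -[c cz ac].
move/hasP: ay; apply; exists b => //; apply: leq_trans ac _.
by rewrite ltnW // ltnNge bz.
Qed.

(** M is the last maximal letter, as required by the definition of m_s: the inequality is strict
    only after it. *)
Lemma peakP s : s != [::] -> exists p M d,
  [/\ s = p ++ M :: d, all (fun a => a <= M) p & all (fun a => a < M) d].
Proof.
elim: s => // a s IH _; have [->|/IH[p [M [d [-> pM dM]]]]] := eqVneq s [::].
  by exists [::], a, [::].
have [aM|Ma] := leqP a M; first by exists (a :: p), M, d; rewrite /= aM.
exists [::], a, (p ++ M :: d); split=> //; rewrite all_cat /= Ma; apply/andP; split.
  by apply: sub_all pM => b bM; exact: leq_ltn_trans Ma.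
by apply: sub_all dM => b bM; exact: ltn_trans Ma.
Qed.

Lemma max_posE p M d : all (fun a => a <= M) p -> all (fun a => a < M) d ->
  max_pos (p ++ M :: d) = (size p).+1.
Proof.
move=> /allP pM /allP dM; rewrite /max_pos.
have -> : \max_(a <- p ++ M :: d) a = M.
  rewrite big_cat big_cons /= maxnCA; apply/maxn_idPl.
  rewrite geq_max; apply/andP; split; apply/bigmax_leqP_seq => a ad _; first exact: pM.
  exact/ltnW/dM.
have lt_p : size p < size (p ++ M :: d) by rewrite size_cat /= addnS ltnS leq_addr.
apply/eqP; rewrite eqn_leq; apply/andP; split; last first.
  by apply: (bigmax_sup (Ordinal lt_p)) => //=; rewrite nth_cat ltnn subnn.
apply/bigmax_leqP => -[i lti] /eqP /= iM; rewrite leqNgt ltnS; apply/negP => ip.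
have di : i - size p < (size d).+1 by move: lti ip; rewrite size_cat /=; clear; lia.
move: iM; rewrite nth_cat ltnNge (ltnW ip) /= => iM.
have : M < M; last by rewrite ltnn.
rewrite -{1}iM; have := ip; rewrite -subn_gt0.
by case: (i - size p) di iM => // j /= jd _ _; apply: dM; exact: mem_nth.
Qed.

Lemma max_pos_map f (s : seq nat) : (forall a b, a \in s -> b \in s -> (f a <= f b) = (a <= b)) ->
  max_pos (map f s) = max_pos s.
Proof.
have [->|/peakP[p [M [d [-> pM dM]]]]] := eqVneq s [::]; first by [].
move=> fm; have Ms : M \in p ++ M :: d by rewrite mem_cat mem_head orbT.
rewrite map_cat map_cons !max_posE ?size_map //; rewrite all_map; apply/allP => a ap /=.
  by rewrite (fm _ _ _ Ms) ?(allP pM) // mem_cat ap.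
by rewrite ltnNge (fm _ _ Ms) -?ltnNge ?(allP dM) // mem_cat inE ap !orbT.
Qed.

Lemma max_pos_parkize s : max_pos (parkize s) = max_pos s.
Proof. by rewrite parkizeE; apply: max_pos_map => a b; exact: parkl_leq. Qed.

Lemma max_pos_gt0 s : s != [::] -> 0 < max_pos s <= size s.
Proof.
case/peakP => p [M [d [-> pM dM]]]; rewrite max_posE // size_cat /= addnS ltnS.
exact: leq_addr.
Qed.

(** Relates the flag of [cut] to the summation ranges of [pq_prec] and [pq_succ]. *)
Lemma le_peak_max_pos s k : s != [::] -> pos s -> k <= size s ->
  le_peak (take k s) (drop k s) = (k < max_pos s).
Proof.
case/peakP => p [M [d [-> pM dM]]] s0 ks; rewrite max_posE // ltnS.
have [kp|pk] := leqP k (size p).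
  have -> : drop k (p ++ M :: d) = drop k p ++ M :: d.
    by rewrite drop_cat; case: ltngtP kp => // -> _; rewrite subnn drop0 drop_size.
  apply/allP => a /mem_take; rewrite mem_cat inE => /orP[/(allP pM) aM|/predU1P[->|/(allP dM)/ltnW aM]];
    by apply/hasP; exists M => //; rewrite mem_cat mem_head orbT.
apply/negbTE/allPn; exists M.
  rewrite take_cat ltnNge (ltnW pk) /= mem_cat; move: pk; rewrite -subn_gt0.
  by case: (k - _) => // j _; rewrite /= inE eqxx orbT.
apply/hasPn => b; rewrite drop_cat ltnNge (ltnW pk) /=; move: pk; rewrite -subn_gt0.
by case: (k - _) => // j _ /= /mem_drop/(allP dM); rewrite ltnNge.
Qed.

Lemma le_peak_parkize k w :
  le_peak (take k (parkize w)) (drop k (parkize w)) = le_peak (take k w) (drop k w).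
Proof.
rewrite parkizeE -map_take -map_drop; apply: (le_peak_map (s := w)) => [a b|a|a].
- exact: parkl_leq.
- exact: mem_take.
exact: mem_drop.
Qed.

Lemma is_parking_pos w : is_parking w -> pos w.
Proof. by case/is_parkingP. Qed.

Lemma is_parking_le w : is_parking w -> all (fun a => a <= size w) w.
Proof.
case/is_parkingP => _ cw; have := cw _ (leqnn (size w)).
by rewrite leq_eqVlt ltnNge count_size orbF eq_sym -all_count.
Qed.

Notation shift k t := (map (addn^~ k) t).

Definition mul (s t : seq nat) := sh s (shift (size s) t).
(** The condition z(k+1) >= z(m_s) puts the first letter of t, hence all of t, after the first m_s
    letters of s. These form a prefix, and only the rest of s is shuffled. *)
Definition gr (s t : seq nat) :=
  map (cat (take (max_pos s) s)) (sh (drop (max_pos s) s) (shift (size s) t)).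
(** The second part comes first because the coproduct is the opposite of deconcatenation. *)
Definition cut (w : seq nat) :=
  [seq (le_peak p.1 p.2, (parkize p.2, parkize p.1)) | p <- splits w].

Lemma shift_shift j k t : shift j (shift k t) = shift (k + j) t.
Proof. by rewrite -map_comp; apply: eq_map => a /=; rewrite addnA. Qed.

Lemma perm_mul s t : {in mul s t, forall w, perm_eq w (s ++ shift (size s) t)}.
Proof. exact: perm_sh. Qed.

Lemma perm_gr s t : {in gr s t, forall w, perm_eq w (s ++ shift (size s) t)}.
Proof.
move=> w /mapP[x xs ->]; set k := size s.
have -> : s ++ shift k t = take (max_pos s) s ++ (drop (max_pos s) s ++ shift k t).
  by rewrite catA cat_take_drop.
rewrite perm_cat2l; exact: perm_sh.
Qed.

Lemma grE p M d t : all (fun a => a <= M) p -> all (fun a => a < M) d ->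
  gr (p ++ M :: d) t =
  [seq p ++ M :: w | w <- sh d (shift (size (p ++ M :: d)) t)].
Proof.
move=> pM dM; rewrite /gr max_posE // -cat_rcons take_size_cat ?size_rcons //.
by rewrite drop_size_cat ?size_rcons //; apply: eq_map => w; rewrite cat_rcons.
Qed.

Lemma gr_nil s : gr s [::] = [:: s].
Proof. by rewrite /gr shs0 /= cat_take_drop. Qed.

Section Sums.
Variable V : zmodType.
Local Open Scope ring_scope.

(** All the words q ++ w have the same letters, so one relabelling f parkizes all of them, and it
    commutes with shuffling. On q ++ d it acts as parkization, and it turns the shift by k into a
    shift by the length. The fixed prefix q is empty for the dot product and ends at the last
    maximal letter for nw. *)
Lemma sum_sh_parkize (F : seq nat -> V) k q d y :
  subparking k (q ++ d) -> pos (q ++ d) -> pos y ->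
  \sum_(w <- sh d (shift k y)) F (parkize (q ++ w)) =
  \sum_(w <- sh (drop (size q) (parkize (q ++ d))) (shift (size (q ++ d)) (parkize y)))
     F (take (size q) (parkize (q ++ d)) ++ w).
Proof.
move=> sqd qd0 y0; pose f := parkl (q ++ d ++ shift k y).
have fl : {in q ++ d, f =1 parkl (q ++ d)}.
  move=> a aqd; rewrite /f catA parkl_cat_l //.
  exact: (allP (subparking_le sqd)).
have fqd : map f q ++ map f d = parkize (q ++ d).
  by rewrite -map_cat parkizeE; apply/eq_in_map.
have fy : map f (shift k y) = shift (size (q ++ d)) (parkize y).
  rewrite parkizeE -!map_comp; apply/eq_in_map => b yb /=.
  by rewrite /f catA parkl_cat_r // (allP y0).
rewrite -fqd take_size_cat ?size_map // drop_size_cat ?size_map // -fy sh_map big_map.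
apply: eq_big_seq => w /perm_sh wp; congr F.
by rewrite parkizeE -map_cat; apply/eq_map/perm_parkl; rewrite perm_cat2l.
Qed.

Lemma sum_mul_parkize (F : seq nat -> V) k x y : subparking k x -> pos x -> pos y ->
  \sum_(w <- sh x (shift k y)) F (parkize w) = \sum_(w <- mul (parkize x) (parkize y)) F w.
Proof.
move=> sx x0 y0; have := @sum_sh_parkize F k [::] x y sx x0 y0.
by rewrite drop0 take0 /mul size_parkize.
Qed.

Lemma sum_gr_parkize (F : seq nat -> V) k q d y :
  max_pos (q ++ d) = size q -> subparking k (q ++ d) -> pos (q ++ d) -> pos y ->
  \sum_(w <- sh d (shift k y)) F (parkize (q ++ w)) =
  \sum_(w <- gr (parkize (q ++ d)) (parkize y)) F w.
Proof.
move=> mq sqd qd0 y0; rewrite sum_sh_parkize //.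
by rewrite /gr max_pos_parkize mq size_parkize big_map.
Qed.

Lemma sum_mulA (F : seq nat -> V) s t u :
  \sum_(w <- mul s t) \sum_(x <- mul w u) F x =
  \sum_(w <- mul t u) \sum_(x <- mul s w) F x.
Proof.
rewrite /mul; transitivity (\sum_(w <- sh s (shift (size s) t))
    \sum_(x <- sh w (shift (size s) (shift (size t) u))) F x).
  apply: eq_big_seq => w /perm_sh/perm_size; rewrite size_cat size_map => ->.
  by rewrite shift_shift addnC.
by rewrite sum_shA sh_map big_map.
Qed.

(* Both sides are shuffles of t gr u into q ++ d in which no letter is inserted
   into q; the shuffle of d with t = x ++ M :: y is cut at M, after which the
   maximal letter is known. *)
Lemma sum_sh_gr (F : seq nat -> V) k q d t u :
  all (fun a => (a <= k)%N) (q ++ d) -> size (q ++ d) = k -> t != [::] -> pos t ->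
  \sum_(w <- sh d (shift k t)) \sum_(x <- gr (q ++ w) u) F x =
  \sum_(w <- gr t u) \sum_(x <- sh d (shift k w)) F (q ++ x).
Proof.
move=> /allP qdk sqd /peakP[x [M [y [-> xM yM]]]]; rewrite all_cat /= => /and3P[_ M0 _].
rewrite map_cat map_cons sum_sh_letter (grE _ xM yM) big_map.
set k' := size (x ++ M :: y); set u' := shift k (shift k' u).
transitivity (\sum_(p <- splits d) \sum_(l <- sh p.1 (shift k x))
    \sum_(w <- sh y (shift k' u)) \sum_(r <- sh p.2 (shift k w)) F (q ++ l ++ (M + k)%N :: r)).
  apply: eq_big_seq => p /splits_cat pd; apply: eq_big_seq => l /perm_sh lp.
  have grl r : r \in sh p.2 (shift k y) -> gr (q ++ l ++ (M + k)%N :: r) u =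
      [seq q ++ l ++ (M + k)%N :: w | w <- sh r u'].
    move=> /perm_sh rp; rewrite catA grE; first last.
    - rewrite (perm_all _ rp) all_cat all_map; apply/andP; split; apply/allP => a ap /=.
        have := qdk a; rewrite -pd !mem_cat ap !orbT => /(_ isT); lia.
      by have := allP yM a ap; lia.
    - rewrite all_cat (perm_all _ lp) all_cat all_map; apply/and3P; split; apply/allP => a ap /=.
      + have := qdk a; rewrite mem_cat ap => /(_ isT); lia.
      + have := qdk a; rewrite -pd !mem_cat ap !orbT => /(_ isT); lia.
      by have := allP xM a ap; lia.
    have -> : size ((q ++ l) ++ (M + k)%N :: r) = (k' + k)%N.
      rewrite !size_cat /= (perm_size rp) (perm_size lp) !size_cat !size_map.
      have -> : k = (size q + (size p.1 + size p.2))%N by rewrite -sqd -pd !size_cat.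
      rewrite /k' size_cat /=; move: (size q) (size p.1) (size p.2) (size x) (size y); clear; lia.
    by rewrite -shift_shift; apply: eq_map => w; rewrite -catA.
  transitivity (\sum_(r <- sh p.2 (shift k y)) \sum_(w <- sh r u') F (q ++ l ++ (M + k)%N :: w)).
    by apply: eq_big_seq => r rp; rewrite (grl r rp) big_map.
  by rewrite (sum_shA (fun w => F (q ++ l ++ (M + k)%N :: w))) sh_map big_map.
transitivity (\sum_(w <- sh y (shift k' u)) \sum_(p <- splits d) \sum_(l <- sh p.1 (shift k x))
    \sum_(r <- sh p.2 (shift k w)) F (q ++ l ++ (M + k)%N :: r)).
  rewrite exchange_big; apply: eq_bigr => p _; exact: exchange_big.
apply: eq_bigr => w _; rewrite map_cat map_cons.
by rewrite (sum_sh_letter (fun x => F (q ++ x))).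
Qed.

(** The case of an empty prefix q in [sum_sh_gr]; for [sum_grA] the prefix is s up to its last
    maximal letter. *)
Lemma sum_mul_grA (F : seq nat -> V) s t u :
  is_parking s -> is_parking t -> t != [::] ->
  \sum_(w <- mul s t) \sum_(x <- gr w u) F x = \sum_(w <- gr t u) \sum_(x <- mul s w) F x.
Proof.
move=> ps pt tn; apply: (@sum_sh_gr F (size s) [::] s t u) => //.
  exact: is_parking_le.
exact: is_parking_pos.
Qed.


Lemma sum_grA (F : seq nat -> V) s t u :
  is_parking s -> is_parking t -> t != [::] ->
  \sum_(w <- gr s t) \sum_(x <- gr w u) F x = \sum_(w <- gr t u) \sum_(x <- gr s w) F x.
Proof.
move=> ps pt tn; rewrite /gr big_map.
rewrite (@sum_sh_gr F (size s) (take (max_pos s) s) (drop (max_pos s) s) t u) ?cat_take_drop //.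
- by apply: eq_bigr => w _; rewrite big_map.
- exact: is_parking_le.
exact: is_parking_pos.
Qed.


Lemma sum_cut (H : bool -> seq nat -> seq nat -> V) w :
  \sum_(c <- cut w) H c.1 c.2.1 c.2.2 =
  \sum_(p <- splits w) H (le_peak p.1 p.2) (parkize p.2) (parkize p.1).
Proof. by rewrite big_map. Qed.

Lemma subparking_l s p : is_parking s -> p \in splits s ->
  subparking (size s) p.1 /\ pos p.1.
Proof.
move=> ps /splits_cat pE; split.
  by apply: (subparking_count ps) => // P; rewrite -pE count_cat leq_addr.
by have := is_parking_pos ps; rewrite -pE all_cat => /andP[].
Qed.

Lemma subparking_r s p : is_parking s -> p \in splits s ->
  subparking (size s) p.2 /\ pos p.2.
Proof.
move=> ps /splits_cat pE; split.
  by apply: (subparking_count ps) => // P; rewrite -pE count_cat leq_addl.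
by have := is_parking_pos ps; rewrite -pE all_cat => /andP[].
Qed.

(** A cut of a shuffle of s and t is a cut of each of them, followed by shuffles of the parts. The
    letters of t are shifted above those of s, so the flag is that of the cut of t. *)
Lemma sum_mul_cut (H : bool -> seq nat -> seq nat -> V) s t :
  is_parking s -> is_parking t -> t != [::] ->
  \sum_(w <- mul s t) \sum_(c <- cut w) H c.1 c.2.1 c.2.2 =
  \sum_(c <- cut s) \sum_(d <- cut t) \sum_(l <- mul c.2.1 d.2.1)
     \sum_(r <- mul c.2.2 d.2.2) H d.1 l r.
Proof.
move=> ps pt tn; under eq_bigr => w _ do rewrite sum_cut.
rewrite (sum_sh_splits (fun x y => H (le_peak x y) (parkize y) (parkize x))) [RHS]big_map.
apply: eq_big_seq => p ip; rewrite splits_map [LHS]big_map [RHS]big_map; apply: eq_big_seq => q iq /=.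
have [s1 p1] := subparking_l ps ip; have [s2 p2] := subparking_r ps ip.
have [_ q1] := subparking_l pt iq; have [_ q2] := subparking_r pt iq.
transitivity (\sum_(l <- sh p.1 (shift (size s) q.1)) \sum_(r <- sh p.2 (shift (size s) q.2))
    H (le_peak q.1 q.2) (parkize r) (parkize l)).
  apply: eq_big_seq => l /perm_sh lp; apply: eq_big_seq => r /perm_sh rp.
  rewrite (perm_le_peak lp rp) le_peak_cat ?(splits_cat iq) //.
    by rewrite (splits_cat ip); exact: is_parking_le.
  exact: is_parking_pos.
rewrite exchange_big (sum_mul_parkize (fun r => \sum_(l <- _) H _ r (parkize l)) s2 p2 q2).
by apply: eq_bigr => l _; rewrite (sum_mul_parkize (fun l => H _ _ l) s1 p1 q1).
Qed.

(** Let q be s up to its last maximal letter, a prefix of all the words in [gr s t]. A cut inside q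
    has flag [true] and leaves t whole in the second part; a cut after q also cuts t, whose flag it
    inherits. *)
Lemma sum_gr_cut (H : bool -> seq nat -> seq nat -> V) s t :
  is_parking s -> is_parking t -> s != [::] -> t != [::] ->
  \sum_(w <- gr s t) \sum_(c <- cut w) H c.1 c.2.1 c.2.2 =
  \sum_(c <- cut s | c.1) \sum_(l <- gr c.2.1 t) H true l c.2.2 +
  \sum_(c <- cut s | ~~ c.1) \sum_(d <- cut t) \sum_(l <- mul c.2.1 d.2.1)
     \sum_(r <- gr c.2.2 d.2.2) H d.1 l r.
Proof.
move=> ps pt sn tn; have [p [M [d [sE pM dM]]]] := peakP sn.
have s0 := is_parking_pos ps; have sk := is_parking_le ps; have t0 := is_parking_pos pt.
pose q := rcons p M; have sqd : s = q ++ d by rewrite sE cat_rcons.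
have mq : max_pos s = size q by rewrite sE max_posE // size_rcons.
rewrite {1}/gr mq {1 2}sqd take_size_cat // drop_size_cat // big_map.
under eq_bigr => w _ do rewrite sum_cut
  (sum_splits_cat (fun x y => H (le_peak x y) (parkize y) (parkize x))).
have leT j u : (j < size q)%N -> le_peak (take j q) (drop j q ++ u).
  move=> jq; apply/allP => a aj; apply/hasP; exists M.
    by rewrite mem_cat /q drop_rcons ?mem_rcons ?inE ?eqxx //; move: jq; rewrite size_rcons ltnS.
  have := mem_take aj; rewrite mem_rcons inE => /predU1P[->//|]; exact: (allP pM).
have leF e1 e2 : e1 ++ e2 = d -> le_peak (q ++ e1) e2 = false.
  move=> ed; apply/negbTE/allPn; exists M; first by rewrite mem_cat mem_rcons mem_head.
  by apply/hasPn => b be; rewrite -ltnNge (allP dM) // -ed mem_cat be orbT.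
(* For s itself, the cuts inside q are those with flag [true] and the cuts of d after q those with
   flag [false]. *)
have cutE (P : pred bool) (G : seq nat -> seq nat -> V) :
    \sum_(c <- cut s | P c.1) G c.2.1 c.2.2 =
    (if P true then \sum_(j <- iota 0 (size q)) G (parkize (drop j q ++ d)) (parkize (take j q)) else 0) +
    (if P false then \sum_(e <- splits d) G (parkize e.2) (parkize (q ++ e.1)) else 0).
  rewrite big_mkcond (sum_cut (fun b l r => if P b then G l r else 0)) sqd.
  rewrite (sum_splits_cat (fun x y => if P (le_peak x y) then G (parkize y) (parkize x) else 0)).
  congr (_ + _); last first.
    transitivity (\sum_(e <- splits d) if P false then G (parkize e.2) (parkize (q ++ e.1)) else 0).
      by apply: eq_big_seq => e /splits_cat ed; rewrite leF.
    by case: (P false) => //; exact: big1_eq.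
  transitivity (\sum_(j <- iota 0 (size q))
      if P true then G (parkize (drop j q ++ d)) (parkize (take j q)) else 0).
    by apply: eq_big_seq => j; rewrite mem_iota add0n => /= jq; rewrite leT.
  by case: (P true) => //; exact: big1_eq.
rewrite big_split /=; congr (_ + _).
  rewrite (cutE id (fun l r => \sum_(x <- gr l t) H true x r)) /= addr0 exchange_big.
  apply: eq_big_seq => j; rewrite mem_iota add0n => /= jq.
  under eq_bigr => w _ do rewrite leT //.
  have js : (j < max_pos s)%N by rewrite mq.
  have ds : drop j q ++ d = drop j s by rewrite sqd drop_cat jq.
  rewrite (@sum_gr_parkize (fun l => H true l _) (size s)) ?ds ?(parkize_id pt) //.
  - rewrite -ds; have -> : drop j q = rcons (drop j p) M by rewrite /q drop_rcons //; move: jq; rewrite size_rcons ltnS.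
    rewrite cat_rcons max_posE //; first by rewrite size_rcons.
    by apply/allP => a /mem_drop; exact: (allP pM).
  - apply: (subparking_count ps) => // P.
    by rewrite -{2}(cat_take_drop j s) count_cat leq_addl.
  by apply/allP => a /mem_drop; exact: (allP s0).
rewrite (cutE negb (fun l r => \sum_(e <- cut t) \sum_(x <- mul l e.2.1) \sum_(y <- gr r e.2.2) H e.1 x y)).
rewrite /= add0r (sum_sh_splits (fun x y => H (le_peak (q ++ x) y) (parkize y) (parkize (q ++ x)))).
apply: eq_big_seq => e /splits_cat ed; rewrite splits_map [LHS]big_map [RHS]big_map.
apply: eq_big_seq => f fi /=.
have [_ f1] := subparking_l pt fi; have [_ f2] := subparking_r pt fi.
have qe : q ++ e.1 ++ e.2 = s by rewrite ed.
transitivity (\sum_(l <- sh e.1 (shift (size s) f.1)) \sum_(r <- sh e.2 (shift (size s) f.2))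
    H (le_peak f.1 f.2) (parkize r) (parkize (q ++ l))).
  apply: eq_big_seq => l /perm_sh lp; apply: eq_big_seq => r /perm_sh rp.
  have -> : le_peak (q ++ l) r =
      le_peak ((q ++ e.1) ++ shift (size s) f.1) (e.2 ++ shift (size s) f.2).
    by apply: perm_le_peak => //; rewrite -catA perm_cat2l.
  by rewrite le_peak_cat ?(splits_cat fi) // -catA qe.
rewrite exchange_big (@sum_mul_parkize (fun r => \sum_(l <- _) H _ r (parkize (q ++ l)))) //.
- apply: eq_bigr => l _; rewrite (sum_gr_parkize (fun l => H _ _ l)) //.
  + rewrite cat_rcons max_posE ?size_rcons //.
    by move: dM; rewrite -ed all_cat => /andP[].
  + apply: (subparking_count ps) => // P.
    by rewrite -qe catA [X in (_ <= X)%N]count_cat leq_addr.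
  by move: s0; rewrite -qe !all_cat => /and3P[-> ->].
- apply: (subparking_count ps) => // P.
  by rewrite -qe catA [X in (_ <= X)%N]count_cat leq_addl.
by move: s0; rewrite -qe !all_cat => /and3P[].
Qed.

(** A parkized part has the same cuts and flags as the part itself. Both sides then run over the
    divisions of s into three consecutive pieces, and the index tells which piece contains the last
    maximal letter. *)
Lemma sum_cut_cut (H : nat -> seq nat -> seq nat -> seq nat -> V) s :
  \sum_(c <- cut s) \sum_(d <- cut c.2.1)
     H (if c.1 then (if d.1 then 0 else 1) else 2)%N d.2.1 d.2.2 c.2.2 =
  \sum_(c <- cut s) \sum_(d <- cut c.2.2)
     H (if c.1 then 0 else (if d.1 then 1 else 2))%N c.2.1 d.2.1 d.2.2.
Proof.
have cutP (G : bool -> seq nat -> seq nat -> V) w : \sum_(d <- cut (parkize w)) G d.1 d.2.1 d.2.2 =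
    \sum_(d <- cut w) G d.1 d.2.1 d.2.2.
  rewrite 2!sum_cut /splits size_parkize !big_map; apply: eq_bigr => k _ /=.
  by rewrite le_peak_parkize parkize_take parkize_drop.
rewrite (sum_cut (fun b l r => \sum_(d <- cut l)
  H (if b then (if d.1 then 0 else 1) else 2)%N d.2.1 d.2.2 r)).
rewrite (sum_cut (fun b l r => \sum_(d <- cut r)
  H (if b then 0 else (if d.1 then 1 else 2))%N l d.2.1 d.2.2)).
transitivity (\sum_(p <- splits s) \sum_(q <- splits p.2)
    H (if le_peak p.1 (q.1 ++ q.2) then (if le_peak q.1 q.2 then 0 else 1) else 2)%N
      (parkize q.2) (parkize q.1) (parkize p.1)).
  apply: eq_bigr => p _; rewrite (cutP (fun b l r => H (if _ then (if b then 0 else 1) else 2)%N l r _)).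
  rewrite (sum_cut (fun b l r => H (if _ then (if b then 0 else 1) else 2)%N l r _)).
  by apply: eq_big_seq => q /splits_cat ->.
transitivity (\sum_(p <- splits s) \sum_(q <- splits p.1)
    H (if le_peak (q.1 ++ q.2) p.2 then 0 else (if le_peak q.1 q.2 then 1 else 2))%N
      (parkize p.2) (parkize q.2) (parkize q.1)); last first.
  apply: eq_bigr => p _; rewrite (cutP (fun b l r => H (if _ then 0 else (if b then 1 else 2))%N _ l r)).
  rewrite (sum_cut (fun b l r => H (if _ then 0 else (if b then 1 else 2))%N _ l r)).
  by apply: eq_big_seq => q /splits_cat ->.
rewrite (sum_splits_splits (fun x y z =>
  H (if le_peak x (y ++ z) then (if le_peak y z then 0 else 1) else 2)%N
     (parkize z) (parkize y) (parkize x))).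
apply: eq_bigr => p _; apply: eq_bigr => q _; congr (H _ _ _ _).
rewrite -le_peak_trans; case yz: (le_peak q.2 p.2); last by rewrite andbF le_peak_catl ?yz.
rewrite andbT; case: ifP => // xyz; case: ifP => // xy; case/negP: (negbT xyz).
by apply: sub_all xy => a; rewrite has_cat => ->.
Qed.
End Sums.

End ParkingWords.

(** * PQSym and FQSym *)

Section ShuffleWords.
Variables (T : eqType) (P : pred T).

Lemma uniq_sh s t : all P s -> all (predC P) t -> uniq (sh s t).
Proof.
elim: s t => // a s IHs t /andP[Pa Ps]; elim: t => // b t IHt /andP[Pb Pt].
have Pbt : all (predC P) (b :: t) by apply/andP.
have inj c : injective (@cons T c) by move=> ? ? [].
rewrite sh_cons cat_uniq !(map_inj_uniq (inj _)) (IHs _ Ps Pbt) (IHt Pt) andbT /=.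
by apply/hasPn => _ /mapP[x _ ->]; apply/negP => /mapP[y _ [ab _]]; move: Pb; rewrite /= ab Pa.
Qed.

(** As P separates the letters of s from those of t, a shuffle is recognised by its two
    restrictions. *)
Lemma mem_sh s t w : all P s -> all (predC P) t ->
  (w \in sh s t) = (filter P w == s) && (filter (predC P) w == t).
Proof.
have nilE u : filter P u == [::] -> filter (predC P) u = u.
  rewrite -size_eq0 size_filter => /eqP c0; apply/all_filterP.
  by rewrite all_predC has_count c0.
have nilE' u : filter (predC P) u == [::] -> filter P u = u.
  rewrite -size_eq0 size_filter => /eqP c0; apply/all_filterP.
  have : ~~ has (predC P) u by rewrite has_count c0.
  by rewrite -all_predC; apply: sub_all => x /=; rewrite negbK.
elim: w s t => [|c w IH] s t.
  case: s t => [|a s] [|b t] // _ _; rewrite sh_cons mem_cat.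
  by apply/negbTE; rewrite negb_or; apply/andP; split; apply/negP => /mapP[].
case: s t => [|a s] [|b t] Ps Pt.
- by rewrite inE /=; case: (P c); rewrite ?andbF.
- rewrite inE; apply/eqP/andP => [->|[/nilE E /eqP <-]]; last by rewrite E.
  by rewrite (all_filterP Pt) -size_eq0 size_filter -leqn0 leqNgt -has_count -all_predC.
- rewrite inE; apply/eqP/andP => [->|[/eqP <- /nilE' E]]; last by rewrite E.
  rewrite (all_filterP Ps) -size_eq0 size_filter -leqn0 leqNgt -has_count -all_predC.
  by split=> //; apply: sub_all Ps => x /=; rewrite negbK.
have [Pa Ps'] := andP Ps; have [Pb Pt'] := andP Pt; rewrite sh_cons mem_cat.
have memc x X : (c :: w \in map (cons x) X) = (c == x) && (w \in X).
  apply/mapP/andP => [[y yX [-> ->]]|[/eqP-> wX]]; [by rewrite eqxx | by exists w].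
rewrite !memc (IH _ _ Ps' Pt) (IH _ _ Ps Pt') /=.
case Pc: (P c) => /=.
  rewrite [c == b](_ : _ = false) ?orbF ?eqseq_cons ?andbA //.
  by apply/eqP => cb; move: Pb; rewrite /= -cb Pc.
rewrite [c == a](_ : _ = false) ?eqseq_cons //=; last by apply/eqP => ca; rewrite ca Pa in Pc.
by rewrite andbCA.
Qed.

(** If M precedes b, the first letter of the second word, then so does p, and nothing is inserted
    before the end of p ++ [:: M]. *)
Lemma filter_sh_index (p d t : seq T) (M b : T) : M \notin p -> b \notin p -> M != b ->
  [seq w <- sh (p ++ M :: d) (b :: t) | index M w <= index b w]%N =
  [seq p ++ M :: w | w <- sh d (b :: t)].
Proof.
move=> + + Mb; elim: p => [|a p IH].
  move=> _ _; rewrite [_ ++ _]/= sh_cons filter_cat !filter_map.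
  rewrite (eq_filter (a2 := predT)) => [|w /=]; last by rewrite eqxx.
  rewrite filter_predT (eq_filter (a2 := pred0)) => [|w /=]; last by rewrite eqxx eq_sym (negPf Mb).
  by rewrite filter_pred0 cats0.
rewrite !inE !negb_or => /andP[Ma Mp] /andP[ba bp]; rewrite cat_cons sh_cons filter_cat !filter_map.
rewrite [X in _ ++ map _ X](eq_filter (a2 := pred0)) => [|w /=].
  rewrite [X in X ++ _](_ : _ = [seq a :: w | w <- [seq w <- sh (p ++ M :: d) (b :: t) | index M w <= index b w]%N]).
    by rewrite IH // filter_pred0 cats0 -map_comp.
  congr map; apply: eq_filter => w /=.
  by rewrite eq_sym (negPf Ma) eq_sym (negPf ba).
by rewrite eqxx eq_sym (negPf Mb).
Qed.

End ShuffleWords.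

(** * Shuffle permutations as shuffles of positions *)

Section Permutations.
Variables k l : nat.
Implicit Type z : 'S_(k + l).

(** Positions are shuffled instead of letters: letters may be repeated, and different permutations
    would then give the same word. *)
Definition index_word z : seq nat := [seq val ((z^-1)%g i) | i : 'I_(k + l)].

Lemma perm_index_word z : perm_eq (index_word z) (iota 0 (k + l)).
Proof.
rewrite -val_enum_ord /index_word [X in perm_eq X _](map_comp val) perm_map //.
rewrite uniq_perm ?enum_uniq //; first by rewrite map_inj_uniq ?enum_uniq //; exact: perm_inj.
move=> i; rewrite mem_enum; apply/mapP; exists (z i); rewrite ?mem_enum //.
by rewrite permK.
Qed.

Lemma uniq_index_word z : uniq (index_word z).
Proof. by rewrite (perm_uniq (perm_index_word z)) iota_uniq. Qed.

Lemma index_index_word z i : index (val i) (index_word z) = z i.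
Proof.
rewrite -{1}(permK z i) /index_word -[X in index X _]/((fun j => val ((z^-1)%g j)) (z i)).
by rewrite index_map ?index_enum_ord // => x y /val_inj/perm_inj.
Qed.

Lemma index_word_inj : injective index_word.
Proof.
by move=> z z' zz; apply/permP => i; apply: val_inj; rewrite -[LHS]index_index_word -[RHS]index_index_word zz.
Qed.

Lemma index_word_surj w : perm_eq w (iota 0 (k + l)) -> exists z, index_word z = w.
Proof.
move=> pw; have uw : uniq w by rewrite (perm_uniq pw) iota_uniq.
have sw : size w = (k + l)%N by rewrite (perm_size pw) size_iota.
have lw i : (i < k + l -> nth 0 w i < k + l)%N.
  by move=> lti; have : nth 0%N w i \in w; [apply: mem_nth; rewrite sw | rewrite (perm_mem pw) mem_iota].
pose f (i : 'I_(k + l)) := Ordinal (lw i (ltn_ord i)).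
have fi : injective f.
  move=> i j /(congr1 val) /= E; apply: val_inj; apply/eqP.
  by rewrite -(nth_uniq 0%N _ _ uw) ?sw; [apply/eqP | exact: ltn_ord | exact: ltn_ord].
exists (perm fi)^-1%g; rewrite /index_word invgK -[RHS](mkseq_nth 0%N) /mkseq sw -val_enum_ord -map_comp.
by apply: eq_map => i /=; rewrite permE.
Qed.

Lemma sorted_index (s : seq nat) : uniq s -> sorted (fun x y => index x s < index y s)%N s.
Proof. by move=> us; apply/(sortedP 0%N) => i si; rewrite !index_uniq // ltnW. Qed.

Lemma filter_sorted (P : pred nat) z m n :
  (forall i j : 'I_(k + l), P i -> P j -> (i < j)%N -> (z i < z j)%N) ->
  {in iota 0 (k + l), forall i, P i = (i \in iota m n)} -> {subset iota m n <= iota 0 (k + l)} ->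
  filter P (index_word z) = iota m n.
Proof.
move=> zP Pmn sub; have pw := perm_mem (perm_index_word z).
apply: (irr_sorted_eq ltn_trans ltnn) (iota_ltn_sorted _ _) _; last first.
  move=> i; rewrite mem_filter pw; case iI: (i \in iota 0 (k + l)).
    by rewrite Pmn ?andbT.
  by rewrite andbF; apply/esym/negbTE; apply: contraFN iI; exact: sub.
have tr : transitive (fun x y => index x (index_word z) < index y (index_word z))%N.
  by move=> y x u; exact: ltn_trans.
have := sorted_filter tr P (sorted_index (uniq_index_word z)).
apply: (sub_in_sorted (P := [pred i | P i & i \in iota 0 (k + l)])); last first.
  by apply/allP => i; rewrite mem_filter pw.
move=> i j; rewrite !inE !mem_iota !add0n /= => /andP[Pi li] /andP[Pj lj].
rewrite (index_index_word z (Ordinal li)) (index_index_word z (Ordinal lj)).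
move=> zij; case: (ltngtP i j) => // [ji|ij].
  by have := zP (Ordinal lj) (Ordinal li) Pj Pi ji; rewrite ltnNge ltnW.
by move: zij; rewrite (_ : Ordinal li = Ordinal lj) ?ltnn //; exact: val_inj.
Qed.

Lemma filter_index (P : pred nat) w m n i j : uniq w -> filter P w = iota m n ->
  i \in iota m n -> j \in iota m n -> (i < j)%N -> (index i w < index j w)%N.
Proof.
move=> uw fw im jm ij; have tr : transitive (fun x y => index x w < index y w)%N.
  by move=> y x u; exact: ltn_trans.
have := sorted_filter tr P (sorted_index uw); rewrite fw => sw.
apply: (sorted_ltn_index tr sw) => //; move: im jm; rewrite !mem_iota => /andP[mi im] /andP[mj jm].
have E x : (m <= x < m + n)%N -> index x (iota m n) = (x - m)%N.
  move=> /andP[mx xm]; have xn : (x - m < n)%N by lia.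
  by rewrite -{1}(subnKC mx) -(nth_iota 0 m xn) index_uniq ?iota_uniq ?size_iota.
by rewrite !E ?mi ?mj //; lia.
Qed.

(** z is increasing on a block exactly when the block appears in increasing order in the index word;
    [mem_sh] applies with P the first block. *)
Lemma is_shuffleE z : is_shuffle z = (index_word z \in sh (iota 0 k) (iota k l)).
Proof.
have P1 : all (fun i => i < k)%N (iota 0 k) by apply/allP => i; rewrite mem_iota.
have P2 : all (predC (fun i => i < k)%N) (iota k l).
  by apply/allP => i; rewrite mem_iota /= -leqNgt => /andP[].
rewrite (mem_sh _ P1 P2); apply/idP/andP => [/forallP zs|[/eqP E1 /eqP E2]].
  have zs' (i j : 'I_(k + l)) : (i < j)%N -> ((j < k) || (k <= i))%N -> (z i < z j)%N.
    by move=> ij jk; have /forallP/(_ j) := zs i; rewrite ij jk.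
  split; apply/eqP; apply: filter_sorted => [i j Pi Pj ij|i|i].
  - by apply: zs' => //; rewrite Pj.
  - by rewrite !mem_iota.
  - by rewrite !mem_iota; lia.
  - by apply: zs' => //; move: Pi; rewrite /= -leqNgt => ->; rewrite orbT.
  - by rewrite !mem_iota /= -leqNgt; lia.
  by rewrite !mem_iota; lia.
apply/forallP => i; apply/forallP => j; apply/implyP => /andP[ij jk].
rewrite -!index_index_word; have ui := uniq_index_word z; have lj := ltn_ord j.
case/orP: jk => jk.
  by apply: (filter_index (i := nat_of_ord i) (j := nat_of_ord j) ui E1) => //; rewrite mem_iota; lia.
by apply: (filter_index (i := nat_of_ord i) (j := nat_of_ord j) ui E2) => //; rewrite mem_iota; lia.
Qed.

Lemma sum_shuffles (V : nmodType) (C : pred (seq nat)) (G : seq nat -> V) :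
  \sum_(z | is_shuffle z && C (index_word z)) G (index_word z) =
  \sum_(w <- sh (iota 0 k) (iota k l) | C w) G w.
Proof.
rewrite big_mkcondr [RHS]big_mkcond -big_filter.
rewrite -(big_map index_word xpredT (fun w => if C w then G w else 0)).
apply: perm_big; apply: uniq_perm.
- by rewrite (map_inj_uniq index_word_inj) filter_uniq ?index_enum_uniq.
- apply: (@uniq_sh _ (fun i => i < k)%N); apply/allP => i; rewrite mem_iota //=.
  by rewrite -leqNgt => /andP[].
move=> w; apply/mapP/idP => [[z + ->]|wsh].
  by rewrite mem_filter -is_shuffleE => /andP[].
have [z zw] : exists z, index_word z = w.
  by apply: index_word_surj; rewrite iotaD; exact: perm_sh.
by exists z => //; rewrite mem_filter is_shuffleE zw wsh mem_index_enum.
Qed.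

End Permutations.

Section SumShuffled.
Variables (V : zmodType) (G : seq nat -> V) (s t : seq nat).
Let f := nth 0%N (shift_cat s t).

Let map_f_s : map f (iota 0 (size s)) = s.
Proof.
rewrite -[RHS](mkseq_nth 0%N); apply/eq_in_map => i; rewrite mem_iota => /= si.
by rewrite /f nth_cat si.
Qed.

Let map_f_t : map f (iota (size s) (size t)) = [seq (b + size s)%N | b <- t].
Proof.
rewrite -[RHS](mkseq_nth 0%N) size_map /mkseq -{1}[size s]addn0 iotaDl -map_comp.
by apply: eq_map => i /=; rewrite /f nth_cat ltnNge leq_addr addKn.
Qed.

Lemma shuffledE z : @shuffled s t z = map f (index_word z).
Proof. by rewrite /index_word -map_comp. Qed.

Lemma sum_shuffled :
  \sum_(z | is_shuffle z) G (@shuffled s t z) = \sum_(w <- mul s t) G w.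
Proof.
have -> : mul s t = map (map f) (sh (iota 0 (size s)) (iota (size s) (size t))).
  by rewrite -sh_map map_f_s map_f_t.
rewrite big_map -(@sum_shuffles (size s) (size t) _ xpredT (fun w => G (map f w))).
by apply: eq_big => z; rewrite ?andbT // shuffledE.
Qed.

(** Since s and t are non-empty, each of the quantified positions in [after_max] has exactly one
    value. Positions start at 0 and m_s at 1, hence the predecessor. *)
Lemma after_maxE z : s != [::] -> t != [::] ->
  @after_max s t z = (index (max_pos s).-1 (index_word z) <= index (size s) (index_word z))%N.
Proof.
move=> sn tn; have /andP[m0 ms] := max_pos_gt0 sn.
have lm : ((max_pos s).-1 < size s + size t)%N by rewrite prednK // (leq_trans ms) ?leq_addr.
have lk : (size s < size s + size t)%N by rewrite -[X in (X < _)%N]addn0 ltn_add2l lt0n size_eq0.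
rewrite (index_index_word z (Ordinal lm)) (index_index_word z (Ordinal lk)).
apply/forallP/idP => [/(_ (Ordinal lm))/forallP/(_ (Ordinal lk))|zz i].
  by rewrite /= prednK // !eqxx.
apply/forallP => j; apply/implyP => /andP[/eqP im /eqP jk].
have -> : i = Ordinal lm by apply: val_inj; rewrite /= -im.
by have -> : j = Ordinal lk by apply: val_inj.
Qed.

Lemma sum_shuffled_after_max : s != [::] -> t != [::] ->
  \sum_(z | is_shuffle z && after_max z) G (@shuffled s t z) = \sum_(w <- gr s t) G w.
Proof.
move=> sn tn; have /andP[m0 ms] := max_pos_gt0 sn; set m := max_pos s in m0 ms *.
transitivity (\sum_(z : 'S_(size s + size t) | is_shuffle z &&
    (index m.-1 (index_word z) <= index (size s) (index_word z))%N) G (map f (index_word z))).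
  by apply: eq_big => z; [rewrite after_maxE | rewrite shuffledE].
rewrite (@sum_shuffles (size s) (size t) _ (fun w => index m.-1 w <= index (size s) w)%N (fun w => G (map f w))).
have imE : iota 0 m = iota 0 m.-1 ++ [:: m.-1].
  by rewrite -[X in iota 0 X = _](prednK m0) -addn1 iotaD add0n.
have im : iota 0 (size s) = iota 0 m.-1 ++ m.-1 :: iota m (size s - m).
  by rewrite -cat1s catA -imE -[X in iota 0 X = _](subnKC ms) iotaD.
have it : iota (size s) (size t) = size s :: iota (size s).+1 (size t).-1.
  by rewrite -[size t]prednK // lt0n size_eq0.
rewrite -big_filter im it filter_sh_index; first last.
- by rewrite neq_ltn prednK // ms.
- by rewrite mem_iota add0n /= -leqNgt (leq_trans (leq_pred m)).
- by rewrite mem_iota add0n /= ltnn.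
have takeE : take m s = map f (iota 0 m).
  by rewrite -[X in take _ X]map_f_s -map_take take_iota (minn_idPl ms).
have dropE : drop m s = map f (iota m (size s - m)).
  by rewrite -[X in drop _ X]map_f_s -map_drop drop_iota.
rewrite -it big_map /gr -/m takeE dropE -map_f_t sh_map !big_map.
by apply: eq_bigr => w _; rewrite -map_cat imE -catA.
Qed.

End SumShuffled.

Section PQSymPresentation.
Variable K : fieldType.
Let A := PQSym K.
Let ve : seq nat -> space A := vec K pq_basis.

Lemma is_parking_nil : is_parking [::].
Proof. by apply/is_parkingP; split=> // -[|]. Qed.

Lemma sum_cut_size (V : nmodType) (G : bool * (seq nat * seq nat) -> V) s :
  \sum_(c <- cut s) G c = \sum_(0 <= k < (size s).+1)
    G (le_peak (take k s) (drop k s), (parkize (drop k s), parkize (take k s))).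
Proof. by rewrite /cut /splits -map_comp big_map /index_iota subn0. Qed.

(** Cutting at 0 gives the total cut and at [size s] the empty one. The others are proper because
    parkization preserves lengths. *)
Lemma cut_proper s : is_parking s -> s != [::] ->
  perm_eq (cut s) [:: (true, (s, [::])), (false, ([::], s)) & filter (proper [::]) (cut s)].
Proof.
move=> ps sn; have s0 : (0 < size s)%N by rewrite lt0n size_eq0.
pose g k := (le_peak (take k s) (drop k s), (parkize (drop k s), parkize (take k s))).
have cE : cut s = (true, (s, [::])) :: rcons (map g (iota 1 (size s).-1)) (false, ([::], s)).
  rewrite /cut /splits -map_comp -[(size s).+1]addn1 iotaD map_cat -{1}(prednK s0) /=.
  rewrite take0 drop0 take_size drop_size parkize_id // -cats1; congr (_ :: _ ++ [:: (_, _)]).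
  by case: (s) sn.
have gp : all (proper [::]) (map g (iota 1 (size s).-1)).
  apply/allP => _ /mapP[k + ->]; rewrite mem_iota add1n prednK // => /andP[k0 ks].
  by rewrite /proper /= -!size_eq0 !size_parkize size_drop size_take ks -!lt0n subn_gt0 ks.
rewrite cE /= filter_rcons (all_filterP gp) /proper /= sn.
by rewrite perm_cons -cats1 perm_catC.
Qed.

Lemma PQSym_presentation :
  @presentation K A (seq nat) [::] is_parking val ve mul gr cut size.
Proof.
have ok_perm w s t : is_parking s -> is_parking t -> s != [::] ->
    perm_eq w (s ++ [seq (b + size s)%N | b <- t]) -> is_parking w && (w != [::]).
  move=> ps pt sn pw; rewrite (is_parking_perm pw) is_parking_shift_cat //=.
  by rewrite -size_eq0 (perm_size pw) size_cat addn_eq0 negb_and size_eq0 sn.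
have size_perm w s t : perm_eq w (s ++ [seq (b + size s)%N | b <- t]) ->
    (size w = size s + size t)%N.
  by move=> /perm_size->; rewrite size_cat size_map.
have okb (b : bas A) : is_parking (val b) by case/andP: (valP b).
have nb (b : bas A) : val b != [::] by case/andP: (valP b).
have v0 : ve [::] = 0 by rewrite /ve /vec insubF // /pq_basis andbF.
split.
- by move=> b; rewrite /ve /vec valK.
- exact: v0.
- exact: is_parking_nil.
- exact: okb.
- by move=> s ps sn; have bs : pq_basis s by [apply/andP]; exists (exist _ s bs).
- by move=> b c; rewrite -sum_shuffled.
- by move=> b c; rewrite -sum_shuffled_after_max.
- move=> b; set s := val b; have ms : (max_pos s <= (size s).+1)%N.
    by have /andP[_ ms] := max_pos_gt0 (nb b); exact: leqW.
  rewrite big_mkcond (sum_cut_size (fun c => if c.1 then vcut ve c else 0)) -big_mkcond big_nat_cond /=.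
  (* The range may start at 0: one factor is then the empty word, whose vector is 0. *)
  transitivity (\sum_(0 <= k < max_pos s) pq_cut K b k).
    have /andP[m0 _] := max_pos_gt0 (nb b); rewrite [RHS](big_ltn m0).
    rewrite (_ : pq_cut K b 0 = 0) ?add0r //.
    by rewrite /pq_cut take0 [vec _ _ (parkize [::])]v0 tens0r.
  rewrite (big_nat_widen _ _ _ _ _ ms) big_nat_cond; apply: eq_bigl => k /=.
  case: ltnP => //= ks; by rewrite (le_peak_max_pos (nb b) (is_parking_pos (okb b)) ks).
- move=> b; set s := val b; have /andP[m0 ms] := max_pos_gt0 (nb b).
  rewrite big_mkcond (sum_cut_size (fun c => if ~~ c.1 then vcut ve c else 0)) -big_mkcond big_nat_cond /=.
  (* Likewise, the added cut at [size s] has an empty factor. *)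
  transitivity (\sum_(max_pos s <= k < (size s).+1) pq_cut K b k).
    rewrite (big_nat_recr _ _ _ ms) /= (_ : pq_cut K b (size s) = 0) ?addr0 //.
    by rewrite /pq_cut drop_size [vec _ _ (parkize [::])]v0 tens0l.
  rewrite (big_nat_widenl _ _ _ _ _ (leq0n _)) big_nat_cond; apply: eq_bigl => k /=.
  case: ltnP => //= ks; by rewrite (le_peak_max_pos (nb b) (is_parking_pos (okb b)) ks) -leqNgt.
- by move=> s t ps pt sn _ w /perm_mul; exact: ok_perm.
- by move=> s t ps pt sn _ w /perm_gr; exact: ok_perm.
- move=> s ps _ /mapP[p ip ->] /=; have [_ p1] := subparking_l ps ip.
  by have [_ p2] := subparking_r ps ip; rewrite !is_parking_parkize.
- by move=> t _; rewrite /mul /=; congr [:: _]; rewrite -[RHS]map_id; apply: eq_map => a; rewrite addn0.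
- by move=> s _; rewrite /mul shs0.
- by move=> s _; exact: gr_nil.
- by move=> s; exact: cut_proper.
- by move=> V H s t ps pt _ tn; exact: sum_mul_cut.
- by move=> V H s t ps pt sn tn; exact: sum_gr_cut.
- by move=> c; rewrite inE => /eqP->.
- by move=> V H s _ _; exact: sum_cut_cut.
- by move=> V F s t u _ _ _ _ _ _; exact: sum_mulA.
- by move=> V F s t u ps pt _ _ tn _; exact: sum_grA.
- by move=> V F s t u ps pt _ _ tn _; exact: sum_mul_grA.
- by [].
- by move=> s t _ _ _ _ w /perm_mul/size_perm.
- by move=> s t _ _ _ _ w /perm_gr/size_perm.
by move=> s _ _ /mapP[p /splits_cat <- ->] /=; rewrite !size_parkize size_cat addnC.
Qed.

End PQSymPresentation.

Section PresentationRestrict.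
Variables (K : fieldType) (A : based K) (T : choiceType) (e : T) (ok : pred T)
  (v : bas A -> T) (ve : T -> space A) (mul gr : T -> T -> seq T)
  (cut : T -> seq (bool * (T * T))) (dg : T -> nat) (P : pred (bas A)) (okP : pred T).
Hypotheses (pr : presentation e ok v ve mul gr cut dg)
  (PE : forall b, P b = okP (v b)) (okP0 : okP e) (okP_ok : forall s, okP s -> ok s)
  (mul_okP : forall s t, okP s -> okP t -> {in mul s t, forall w, okP w})
  (gr_okP : forall s t, okP s -> okP t -> {in gr s t, forall w, okP w})
  (cut_okP : forall s, okP s -> {in cut s, forall c, okP c.2.1 && okP c.2.2}).

Local Opaque tens tmap tmap2 lext bext.

(** Products and cuts of indices are unchanged, so their identities are inherited; only the vectors
    are projected on the span of P. *)
Lemma presentation_restrict : @presentation K (restrict P) T e okP (fun b => v (val b))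
  (fun s => @restr K A P (ve s)) mul gr cut dg.
Proof.
have rl : linear (@restr K A P) by exact: linearP.
have rcut (s : T) (Q : pred (bool * (T * T))) :
    tmap (@restr K A P) (@restr K A P) (\sum_(c <- cut s | Q c) vcut ve c) =
    \sum_(c <- cut s | Q c) tens (@restr K A P (ve c.2.1)) (@restr K A P (ve c.2.2)).
  rewrite (lin_sum (tmap_lin _ _)); apply: eq_bigr => c _; exact: tmap_tens.
split.
- by move=> b; rewrite (pr_vec pr) /restr lextU /vec valK.
- by rewrite (pr_vec0 pr) (lin0 rl).
- exact: okP0.
- by move=> b; rewrite -PE; exact: (valP b).
- move=> s os sn; have [b bs] := pr_okP pr (okP_ok os) sn.
  have Pb : P b by rewrite PE bs.
  by exists (exist _ b Pb).
- by move=> b c; rewrite /= (pr_dot pr) (lin_sum rl).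
- by move=> b c; rewrite /= (pr_nw pr) (lin_sum rl).
- by move=> b; rewrite /= (pr_prec pr) rcut.
- by move=> b; rewrite /= (pr_succ pr) rcut.
- move=> s t os ot sn tn w ws; rewrite (mul_okP os ot ws).
  by have /andP[] := pr_mul_ok pr (okP_ok os) (okP_ok ot) sn tn ws.
- move=> s t os ot sn tn w ws; rewrite (gr_okP os ot ws).
  by have /andP[] := pr_gr_ok pr (okP_ok os) (okP_ok ot) sn tn ws.
- exact: cut_okP.
- by move=> t /okP_ok; exact: (pr_mul1 pr).
- by move=> t /okP_ok; exact: (pr_mulr1 pr).
- by move=> t /okP_ok; exact: (pr_gr1 pr).
- by move=> s /okP_ok; exact: (pr_cutE pr).
- by move=> V H s t /okP_ok os /okP_ok; exact: (pr_mul_cut pr).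
- by move=> V H s t /okP_ok os /okP_ok; exact: (pr_gr_cut pr).
- exact: (pr_cut0 pr).
- by move=> V H s /okP_ok; exact: (pr_coassoc pr).
- by move=> V F s t u /okP_ok os /okP_ok ot /okP_ok; exact: (pr_mulA pr).
- by move=> V F s t u /okP_ok os /okP_ok ot /okP_ok; exact: (pr_grA pr).
- by move=> V F s t u /okP_ok os /okP_ok ot /okP_ok; exact: (pr_mul_grA pr).
- by move=> b; exact: (pr_deg pr).
- by move=> s t /okP_ok os /okP_ok; exact: (pr_mul_deg pr).
- by move=> s t /okP_ok os /okP_ok; exact: (pr_gr_deg pr).
by move=> s /okP_ok; exact: (pr_cut_deg pr).
Qed.

End PresentationRestrict.

Lemma is_permutation_parking w : is_permutation w -> is_parking w.
Proof.
move=> pw; rewrite (is_parking_perm pw); apply/is_parkingP; split.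
  by apply/allP => a; rewrite mem_iota => /andP[].
move=> i; rewrite size_iota => iw; rewrite -[X in iota 1 X](subnKC iw) iotaD count_cat.
apply: leq_trans (leq_addr _ _); rewrite -{1}(size_iota 1 i) eq_leq //; apply/esym/eqP.
by rewrite -all_count; apply/allP => a; rewrite mem_iota add1n ltnS => /andP[].
Qed.

Lemma FQSym_presentation (K : fieldType) : @presentation K (FQSym K) (seq nat) [::]
  is_permutation (fun b => val (val b))
  (fun s => @restr K (PQSym K) (fun b => is_permutation (val b)) (vec K pq_basis s))
  mul gr cut size.
Proof.
have ok_perm w s t : is_permutation s -> is_permutation t ->
    perm_eq w (s ++ [seq (b + size s)%N | b <- t]) -> is_permutation w.
  move=> ps pt pw; rewrite /is_permutation (perm_size pw) (perm_trans pw) //.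
  exact: is_permutation_shift_cat.
apply: (presentation_restrict (PQSym_presentation K)) => //.
- exact: is_permutation_parking.
- by move=> s t ps pt w /perm_mul; exact: ok_perm.
- by move=> s t ps pt w /perm_gr; exact: ok_perm.
move=> s ps _ /mapP[p ip ->] /=.
have perm_parkize u : uniq u -> all (fun a => 0 < a)%N u -> is_permutation (parkize u).
  move=> uu u0; apply: uniq_is_permutation; first exact: is_parking_parkize.
  apply: (@parkize_ind uniq) => // x; exact: park_step_uniq.
have us := is_permutation_uniq ps; have s0 := is_parking_pos (is_permutation_parking ps).
have /splits_cat pE := ip; move: us s0; rewrite -pE cat_uniq all_cat.
by case/and3P => u1 _ u2 /andP[p1 p2]; rewrite !perm_parkize.
Qed.

Theorem theorem24 (K : fieldType) :
  (exists (D : choiceType) (deg : D -> nat),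
     isomorphic_graded_DupDend (PQSym K) (Hp deg K)) /\
  (exists (D : choiceType) (deg : D -> nat),
     isomorphic_graded_DupDend (FQSym K) (Hp deg K)).
Proof.
have size0 (s : bas (PQSym K)) : (0 < bdeg s)%N.
  by rewrite lt0n size_eq0; case/andP: (valP s).
(* Words of natural numbers are countable; their numbering provides the rank which selects leading
   terms. *)
have rk_inj : injective (fun s : bas (PQSym K) => choice.pickle (val s)).
  by move=> s t /(pcan_inj choice.pickleK)/val_inj.
split.
  exact: rigidity (presentation_bialgebra (PQSym_presentation K)) size0 rk_inj.
have rk_inj' : injective (fun s : bas (FQSym K) => choice.pickle (val (val s))).
  by move=> s t /rk_inj/val_inj.
have size0' (s : bas (FQSym K)) : (0 < bdeg s)%N by exact: (size0 (val s)).
exact: rigidity (presentation_bialgebra (FQSym_presentation K)) size0' rk_inj'.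
Qed.
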